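(* Let $A$ be a self-adjoint operator in the complex, separable Hilbert space $\mathcal H=(\mathcal V,(\cdot,\cdot)_{\mathcal H})$ satisfying $A\geq I_{\mathcal H}$. For $r\in[0,\infty)$ let $\mathcal V_r(A)=\operatorname{dom}(A^{r/2})$ and $\mathcal H_r(A)=\big(\mathcal V_r(A),(\cdot,\cdot)_{\mathcal H_r(A)}\big)$ with $(f,g)_{\mathcal H_r(A)}=(A^{r/2}f,A^{r/2}g)_{\mathcal H}$. Then the following items $(i)$--$(iii)$ hold: $(i)$ For every $r\in[0,\infty)$ there exists a unique operator $A_r$ in $\mathcal H_r(A)$ such that $A_r$ on $\operatorname{dom}(A_r)=\operatorname{dom}\big(A^{(r+2)/2}\big)=\mathcal V_{r+2}(A)$ is self-adjoint in $\mathcal H_r(A)$, $A_0=A$, and $A_r=A\big|_{\mathcal V_{r+2}(A)}$, $r\in[0,\infty)$. In particular, $$\mathcal V_{r+2}(A)=\operatorname{dom}(A_r)\subseteq\operatorname{dom}(A)=\mathcal V_2(A),\quad r\in[0,\infty),$$ $$\mathcal V_{s+2}(A)=\operatorname{dom}(A_s)\subseteq\operatorname{dom}(A_r)=\mathcal V_{r+2}(A),\quad 0\leq r<s,$$ and these inclusions are strict if $A$ is unbounded, that is, if $A$ is unbounded then $\mathcal V_{r+2}(A)=\operatorname{dom}(A_r)\subsetneq\operatorname{dom}(A)=\mathcal V_2(A)$ for $r\in(0,\infty)$, and $\mathcal V_{s+2}(A)=\operatorname{dom}(A_s)\subsetneq\operatorname{dom}(A_r)=\mathcal V_{r+2}(A)$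 for $0\leq r<s$. $(ii)$ If $A$ is a bounded operator on $\mathcal H$, then the norms induced by $(\cdot,\cdot)_{\mathcal H_r(A)}$ and $(\cdot,\cdot)_{\mathcal H_s(A)}$, $r,s\in[0,\infty)$ (in particular, those of $(\cdot,\cdot)_{\mathcal H_r(A)}$, $r\in[0,\infty)$, and $(\cdot,\cdot)_{\mathcal H}$) are equivalent, and hence (up to equivalence of norms) $\mathcal V_r(A)=\mathcal V$, $\mathcal H_r(A)=\mathcal H$, $A_r=A$ for all $r\in[0,\infty)$. $(iii)$ For $r,s,t\in[0,\infty)$, the map $$A^{(r-s)/2}\colon \mathcal H_{r+t}(A)\to\mathcal H_{s+t}(A),\quad u\mapsto A^{(r-s)/2}u,$$ is an isometric isomorphism (i.e., a unitary operator) from $\mathcal H_{r+t}(A)$ onto $\mathcal H_{s+t}(A)$, and $$A^{(r-s)/2}A_rA^{-(r-s)/2}=A_s,\quad r,s\in[0,\infty),$$ $$\mathcal V_{s+2}(A)=\operatorname{dom}(A_s)=A^{(r-s)/2}\operatorname{dom}(A_r)=A^{(r-s)/2}\mathcal V_{r+2}(A),\quad r,s\in[0,\infty).$$ Thus $A_r$ in $\mathcal H_r(A)$ and $A_s$ in $\mathcal H_s(A)$ are unitarily equivalent for all $r,s\in[0,\infty)$; in particular, $A_r$ in $\mathcal H_r(A)$ and $A$ in $\mathcal H$ are unitarily equivalent for all $r\in[0,\infty)$. As a consequence, all unitary invariants of $A_r$ and $A_s$, $r,s\in[0,\infty)$, and hence all unitary invariants of $A_r$, $r\in[0,\infty)$,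 and $A$, coincide.
   Context: Powers $A^{r}$, $r\in\mathbb R$, of the self-adjoint operator $A\geq I_{\mathcal H}$ are defined by the spectral theorem; for $r\le 0$ they are bounded. $\mathcal V$ denotes the underlying vector space of $\mathcal H$; $\mathcal H_0(A)$ is identified with $\mathcal H$, and $\mathcal V_0(A)$ with $\mathcal V$. The space $\mathcal H_r(A)$ is called the $r$th left-definite space associated with $(A,\mathcal H)$. Inner products are linear in the second argument. ''Unitary invariants'' of a self-adjoint operator $B$ in a complex separable Hilbert space are the data preserved under unitary equivalence, in particular the spectrum $\sigma(B)$, essential spectrum, point spectrum (set of eigenvalues), discrete spectrum, absolutely continuous spectrum, singularly continuous spectrum, resolvent set, and the spectral parts of uniform multiplicity. *)

(* Defs.v *)
From HB Require Import structures.
From mathcomp Require Import all_boot all_order all_algebra.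
From mathcomp Require Import complex.
From mathcomp Require Import all_classical all_reals all_analysis.

Set Implicit Arguments.
Unset Strict Implicit.
Unset Printing Implicit Defensive.

Import Order.TTheory GRing.Theory Num.Theory.
Import numFieldNormedType.Exports.

Local Open Scope classical_set_scope.
Local Open Scope ring_scope.
Local Open Scope complex_scope.

(* Every space lives inside an ambient complex vector space V: it is a pair
   (subspace of V, inner product), so that a space and its left-definite
   spaces, whose underlying vector spaces are nested, can be compared literally.
   The values of [ip] outside [carrier] are irrelevant. *)
Record hspace (R : realType) (V : lmodType R[i]) := Hspace {
  carrier : set V;
  ip : V -> V -> R[i] }.

(* Operators are graphs; hence equality of operators includes equality of the
   domains, and [(S \; T)%relation] is the product S T on its natural domain
   (T is applied first). *)
Definition operator (R : realType) (V : lmodType R[i]) := set (V * V).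

Section Spaces.
Variables (R : realType) (V : lmodType R[i]).
Implicit Types (K L : hspace V) (S T U : operator V) (D : set V) (u v w : V).

Definition hnorm K u : R := Num.sqrt (complex.Re (ip K u u)).

Definition hcvg K (x : nat -> V) (l : V) : Prop :=
  (fun n => hnorm K (x n - l)) @ \oo --> (0 : R).

Definition hcauchy K (x : nat -> V) : Prop :=
  forall e : R, 0 < e -> exists N : nat, forall m n : nat,
    (N <= m)%N -> (N <= n)%N -> hnorm K (x m - x n) < e.

Definition is_subspace D : Prop :=
  D 0 /\ forall (a : R[i]) u v, D u -> D v -> D (a *: u + v).

(* Inner products are linear in the second argument. *)
Definition inner_product K : Prop :=
  [/\ forall (a : R[i]) u v w, carrier K u -> carrier K v -> carrier K w ->
        ip K u (a *: v + w) = a * ip K u v + ip K u w,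
      forall u v, carrier K u -> carrier K v -> ip K v u = conjc (ip K u v),
      forall u, carrier K u -> 0 <= ip K u u
    & forall u, carrier K u -> ip K u u = 0 -> u = 0].

Definition hilbert K : Prop :=
  [/\ is_subspace (carrier K), inner_product K
    & forall x : nat -> V, (forall n, carrier K (x n)) -> hcauchy K x ->
        exists2 l, carrier K l & hcvg K x l].

Definition hdense K D : Prop :=
  forall u, carrier K u -> forall e : R, 0 < e -> exists2 v, D v & hnorm K (u - v) < e.

Definition hseparable K : Prop :=
  exists2 x : nat -> V, (forall n, carrier K (x n)) & hdense K (range x).

Definition equivalent_norms K L : Prop :=
  carrier K = carrier L /\
  exists c1 c2 : R, [/\ 0 < c1, 0 < c2
    & forall u, carrier K u ->
        c1 * hnorm K u <= hnorm L u /\ hnorm L u <= c2 * hnorm K u].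

Definition dom T : set V := fst @` T.

Definition ran T : set V := snd @` T.

Definition img T D : set V := [set w | exists2 u, D u & T (u, w)].

Definition restr T D : operator V := [set uw | D uw.1 /\ T uw].

Definition app T u : V := xget 0 [set w | T (u, w)].

Definition linear_operator K L T : Prop :=
  [/\ T `<=` carrier K `*` carrier L,
      T 0,
      forall (a : R[i]) (p q : V * V), T p -> T q -> T (a *: p + q)
    & forall u w w', T (u, w) -> T (u, w') -> w = w'].

Definition adjoint K T : operator V :=
  [set vw | [/\ carrier K vw.1, carrier K vw.2
    & forall u z, T (u, z) -> ip K vw.1 z = ip K vw.2 u]].

Definition selfadjoint K T : Prop :=
  [/\ linear_operator K K T, hdense K (dom T) & adjoint K T = T].

Definition bounded_operator K T : Prop :=
  exists c : R, forall u w, T (u, w) -> hnorm K w <= c * hnorm K u.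

Definition ge_identity K T : Prop :=
  forall u w, T (u, w) -> ip K u u <= ip K u w.

Definition unitary K L U : Prop :=
  [/\ linear_operator K L U, dom U = carrier K, ran U = carrier L
    & forall u u' w w', U (u, w) -> U (u', w') -> ip L w w' = ip K u u'].

Definition unitarily_equivalent K S L T : Prop :=
  exists2 U, unitary K L U & (U \; S \; U^-1)%relation = T.

End Spaces.

Section SpectralTheorem.
Variables (R : realType) (V : lmodType R[i]).
Implicit Types (K : hspace V) (A B T : operator V) (E : set R -> V -> V) (u : V).

(* E is only meaningful on Borel sets and on the vectors of K. *)
Definition projection_valued_measure K E : Prop :=
  [/\ forall M, measurable M ->
        [/\ forall u, carrier K u -> carrier K (E M u),
            forall (a : R[i]) u v, carrier K u -> carrier K v ->
              E M (a *: u + v) = a *: E M u + E M v,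
            forall u, carrier K u -> E M (E M u) = E M u
          & forall u v, carrier K u -> carrier K v ->
              ip K u (E M v) = ip K (E M u) v],
      forall u, carrier K u -> E setT u = u
    & forall F : nat -> set R, (forall n, measurable (F n)) ->
        trivIset setT F -> forall u, carrier K u ->
        hcvg K (fun n => \sum_(i < n) E (F i) u) (E (\bigcup_n F n) u)].

(* The scalar measure M |-> (u, E(M)u). *)
Definition spectral_dist K E u : set (measurableTypeR R) -> \bar R :=
  fun M => (complex.Re (ip K u (E M u)))%:E.

Definition spectral_integral_dom K E (f : R -> R) : set V :=
  [set u | carrier K u /\
    (\int[spectral_dist K E u]_(x in setT) ((f x) ^+ 2)%:E < +oo)%E].

(* T is the integral of f with respect to E; by polarization T is determined by
   its domain and its quadratic form. *)
Definition is_spectral_integral K E (f : R -> R) T : Prop :=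
  [/\ linear_operator K K T,
      dom T = spectral_integral_dom K E f
    & forall u w, T (u, w) ->
        ip K u w = (fine (\int[spectral_dist K E u]_(x in setT) (f x)%:E)%E)%:C].

Definition is_spectral_measure K A E : Prop :=
  projection_valued_measure K E /\ is_spectral_integral K E id A.

Definition spectral_measure K A : set R -> V -> V :=
  xget (fun _ _ => 0) [set E | is_spectral_measure K A E].

(* Only used for A >= I, where the spectral measure is carried by [1, +oo[; the
   values of [powR] on negative numbers therefore do not matter. *)
Definition power K A (r : R) : operator V :=
  xget set0 [set T |
    is_spectral_integral K (spectral_measure K A) (fun x => x `^ r) T].

Definition left_definite_dom K A (r : R) : set V := dom (power K A (r / 2)).

Definition left_definite K A (r : R) : hspace V :=
  Hspace (left_definite_dom K A r)
    (fun f g => ip K (app (power K A (r / 2)) f) (app (power K A (r / 2)) g)).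

Definition is_left_definite_operator K A (r : R) T : Prop :=
  [/\ linear_operator (left_definite K A r) (left_definite K A r) T,
      dom T = left_definite_dom K A (r + 2),
      selfadjoint (left_definite K A r) T,
      (r = 0 -> T = A)
    & T = restr A (left_definite_dom K A (r + 2))].

End SpectralTheorem.

Section UnitaryInvariants.
Variables (R : realType) (V : lmodType R[i]).
Implicit Types (K L : hspace V) (B C : operator V) (z : R[i]).

Definition unitary_invariant (X : Type) (inv : hspace V -> operator V -> X) : Prop :=
  forall K B L C,
    hilbert K -> hseparable K -> selfadjoint K B ->
    hilbert L -> hseparable L -> selfadjoint L C ->
    unitarily_equivalent K B L C -> inv K B = inv L C.

Definition resolvent_set K B : set R[i] :=
  [set z | (forall w, carrier K w -> exists! u, B (u, w + z *: u)) /\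
    exists c : R, forall u w, carrier K w -> B (u, w + z *: u) ->
      hnorm K u <= c * hnorm K w].

Definition spectrum K B : set R[i] := ~` resolvent_set K B.

Definition op_eigenspace B z : set V := [set u | B (u, z *: u)].

Definition point_spectrum B : set R[i] :=
  [set z | exists2 u, u != 0 & op_eigenspace B z u].

Definition finite_dimensional (D : set V) : Prop :=
  exists (n : nat) (e : 'I_n -> V), forall u, D u ->
    exists c : 'I_n -> R[i], u = \sum_i c i *: e i.

Definition discrete_spectrum K B : set R[i] :=
  [set z | [/\ spectrum K B z, point_spectrum B z,
      finite_dimensional (op_eigenspace B z)
    & exists2 e : R[i], 0 < e &
        forall z', spectrum K B z' -> `|z' - z| < e -> z' = z]].

Definition essential_spectrum K B : set R[i] :=
  spectrum K B `\` discrete_spectrum K B.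

(* The spectral measure of a self-adjoint operator is unique, so "exists" below
   just names it. *)
Definition ac_subspace K B : set V :=
  [set u | carrier K u /\ exists2 E, is_spectral_measure K B E &
     forall M : set (measurableTypeR R), measurable M ->
       lebesgue_measure M = 0%E -> spectral_dist K E u M = 0%E].

Definition sc_subspace K B : set V :=
  [set u | carrier K u /\ exists2 E, is_spectral_measure K B E &
     (forall x : R, spectral_dist K E u [set x] = 0%E) /\
     exists N : set (measurableTypeR R), [/\ measurable N,
       lebesgue_measure N = 0%E & spectral_dist K E u (~` N) = 0%E]].

(* Spectrum of the part of B in the subspace D of K. *)
Definition spectrum_in K B (D : set V) : set R[i] :=
  spectrum (Hspace D (ip K)) (B `&` (D `*` D)).

Definition ac_spectrum K B : set R[i] := spectrum_in K B (ac_subspace K B).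

Definition sc_spectrum K B : set R[i] := spectrum_in K B (sc_subspace K B).

(* The part of B in the range of its spectral projection E(Om) has uniform
   multiplicity n ([None] is countably infinite) with spectral type mu, i.e. it
   is unitarily equivalent to multiplication by the independent variable in the
   orthogonal sum of n copies of L^2(R, mu).  The vector [e k] corresponds to
   the constant function 1 in the k-th copy, and E(M)[e k] to the indicator
   function of M. *)
Definition uniform_multiplicity_part K B (n : option nat) (Om : set R)
    (mu : {measure set (measurableTypeR R) -> \bar R}) : Prop :=
  let I := [set k : nat | if n is Some m then (k < m)%N else true] in
  [/\ n <> Some 0%N, mu setT <> 0%E, measurable Om &
    exists (E : set R -> V -> V) (e : nat -> V),
    [/\ is_spectral_measure K B E,
        forall k, I k -> [/\ carrier K (e k), E Om (e k) = e k
          & forall M, measurable M -> spectral_dist K E (e k) M = mu M],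
        forall j k, I j -> I k -> j <> k ->
          forall M, measurable M -> ip K (e j) (E M (e k)) = 0
      & forall u, carrier K u -> E Om u = u ->
          (forall k M, I k -> measurable M -> ip K (E M (e k)) u = 0) -> u = 0]].

Definition same_listed_invariants K B L C : Prop :=
  [/\ spectrum K B = spectrum L C,
      essential_spectrum K B = essential_spectrum L C,
      point_spectrum B = point_spectrum C
    & discrete_spectrum K B = discrete_spectrum L C] /\
  [/\ ac_spectrum K B = ac_spectrum L C,
      sc_spectrum K B = sc_spectrum L C,
      resolvent_set K B = resolvent_set L C
    & forall n Om mu,
        uniform_multiplicity_part K B n Om mu <->
        uniform_multiplicity_part L C n Om mu].

End UnitaryInvariants.

(* Main.v *)
Require Import Defs.
From HB Require Import structures.
From mathcomp Require Import all_boot all_order all_algebra.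
From mathcomp Require Import complex finmap.
From mathcomp Require Import all_classical all_reals all_analysis.
From mathcomp Require Import measurable_realfun ring lra zify.

(** The map A^(r/2) is by construction an isometry of the r-th left-definite
    space into H, and it is onto because its inverse A^(-r/2) is bounded.  As it
    commutes with A, the restriction of A to V_(r+2) is A conjugated by a
    unitary, and every claim of the theorem is either transported along this
    unitary ([iso], [intertwine]) or read off the group law of the powers of A
    ([powers]): A^s A^r u is defined, for u in the domain of A^r, exactly when
    A^(s+r) u is, and then both agree.

    The powers are integrals against a spectral measure of A, so most of the
    text establishes the spectral theorem for A >= I and a functional calculus
    for nonnegative Borel functions.

    Existence of a spectral measure.  The inverse B of A is a positive injective
    contraction defined on the whole space ([sa_inv]).  The range of its spectral
    projection for [0, l] has a description that involves only iterates: it is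
    the set [spec l] of the vectors u with ||B^n u|| <= l^n ||u|| for all n.  By
    the convexity of the moments n |-> (u, B^n u) this is a closed subspace
    ([contr_vec_closed]); on it B is at most l, and on its orthogonal complement
    B is at least l ([contr_vec_orth]).  The functions l |-> (u, P_l u) formed
    with the projections P_l onto [spec l] are therefore distribution functions
    of scalar measures, and (u, Bu) is the first moment of the measure of u
    ([spec_measure_exists]).  Each of these measures is a quadratic form given by
    a projection on half-lines, hence on all Borel sets ([represents_exists]).
    Pushing them forward under x |-> 1/x gives a spectral measure of A
    ([sa_spectral_exists]).

    Functional calculus.  For a nonnegative Borel function f, the operator of f
    is the strong limit of the operators of simple functions that increase to f
    ([fcalc]), on the vectors for which f is square-integrable ([fdom]); it is
    the only operator with the prescribed domain and quadratic form
    ([spectral_integral_unique]), and it is multiplicative ([fcalc_comp]).  Since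
    any spectral measure of A is carried by [1, +oo[ ([spectral_full]), the
    powers of A obey the law above ([power_powers]).

    Strictness of the inclusions.  If two of the domains coincide, the group law
    shows that A is defined everywhere; then it is bounded by the theorem of
    Hellinger and Toeplitz ([sop_bounded], [total_bounded]).

    Unitary invariants.  A unitary that conjugates B into C also conjugates the
    resolvents, the eigenspaces and the spectral measures ([same_invariants]). *)

Set Implicit Arguments.
Unset Strict Implicit.
Unset Printing Implicit Defensive.

Import Order.TTheory GRing.Theory Num.Theory.
Import numFieldNormedType.Exports.

Local Open Scope classical_set_scope.
Local Open Scope ring_scope.
Local Open Scope complex_scope.

(** * Hilbert spaces, orthogonal projections and symmetric operators *)

(** The completeness and the inner product axioms travel with the space, so that
    the lemmas below need only ask their vectors to lie in it. *)
Record hilb (R : realType) (V : lmodType R[i]) :=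
  Hilb { hsp :> hspace V; hilbP : hilbert hsp }.

(** Inequalities and limits are taken for the real part of the inner product;
    nothing is lost, because multiplying a vector by i recovers the imaginary
    part ([ip_ri]). *)
Definition rip (R : realType) (V : lmodType R[i]) (K : hspace V) (u v : V) : R :=
  complex.Re (ip K u v).

Section Basics.
Variables (R : realType) (V : lmodType R[i]) (K : hilb V).
Implicit Types (u v w : V) (a : R) (c : R[i]).
Local Notation car := (carrier K).
Local Notation "<< u , v >>" := (rip K u v).
Local Notation "n[ u ]" := (hnorm K u).

Lemma car0 : car 0. Proof. by case: (hilbP K) => [[]]. Qed.
Lemma carP c u v : car u -> car v -> car (c *: u + v).
Proof. by case: (hilbP K) => [[_ h] _ _]; exact: h. Qed.
Lemma carD u v : car u -> car v -> car (u + v).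
Proof. by move=> hu hv; rewrite -[u]scale1r; exact: carP. Qed.
Lemma carZ c u : car u -> car (c *: u).
Proof. by move=> hu; rewrite -[_ *: _]addr0; apply: carP => //; exact: car0. Qed.
Lemma carN u : car u -> car (- u).
Proof. by move=> hu; rewrite -scaleN1r; exact: carZ. Qed.
Lemma car_sum (I : Type) (s : seq I) (P : pred I) (F : I -> V) :
  (forall i, P i -> car (F i)) -> car (\sum_(i <- s | P i) F i).
Proof. by move=> h; apply: big_ind => //; [exact: car0|exact: carD]. Qed.
Hint Resolve car0 carD carZ carN : car.
Hint Extern 4 (carrier _ _) => refine (carN _) : car.
Hint Extern 4 (carrier _ _) => refine (carD _ _) : car.
Hint Extern 4 (carrier _ _) => refine (carZ _ _) : car.
Hint Extern 0 (carrier _ _) => solve [auto 20 with car nocore] : core.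

Lemma ipDr u v w : car u -> car v -> car w -> ip K u (v + w) = ip K u v + ip K u w.
Proof.
move=> hu hv hw; case: (hilbP K) => [_ [h _ _ _] _].
by rewrite -[v in LHS]scale1r h// mul1r.
Qed.
Lemma ipZr c u v : car u -> car v -> ip K u (c *: v) = c * ip K u v.
Proof.
move=> hu hv; case: (hilbP K) => [_ [h _ _ _] _].
have h0 : ip K u 0 = 0.
  have := h (-1) u 0 0 hu car0 car0; rewrite scaler0 addr0 mulN1r addNr. by [].
by have := h c u v 0 hu hv car0; rewrite !addr0 h0 addr0.
Qed.
Lemma ipC u v : car u -> car v -> ip K v u = conjc (ip K u v).
Proof. by move=> hu hv; case: (hilbP K) => [_ [_ h _ _] _]; exact: h. Qed.

Lemma ripC u v : car u -> car v -> << u, v >> = << v, u >>.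
Proof. by move=> hu hv; rewrite /rip (ipC hu hv); case: (ip K u v). Qed.
Lemma ripDr u v w : car u -> car v -> car w -> << u, v + w >> = << u, v >> + << u, w >>.
Proof. by move=> *; rewrite /rip ipDr//; case: (ip _ _ _) (ip _ _ _) => ? ? []. Qed.
Lemma ripZr a u v : car u -> car v -> << u, a%:C *: v >> = a * << u, v >>.
Proof.
by move=> *; rewrite /rip ipZr//; case: (ip _ _ _) => x y /=; rewrite mul0r subr0.
Qed.
Lemma ripDl u v w : car u -> car v -> car w -> << v + w, u >> = << v, u >> + << w, u >>.
Proof. by move=> *; rewrite ripC// ripDr// !(@ripC u). Qed.
Lemma ripZl a u v : car u -> car v -> << a%:C *: v, u >> = a * << v, u >>.
Proof. by move=> *; rewrite ripC// ripZr// ripC. Qed.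
Lemma ripNr u v : car u -> car v -> << u, - v >> = - << u, v >>.
Proof.
move=> *; rewrite -scaleN1r -(_ : (-1)%:C = -1); last by rewrite rmorphN.
by rewrite ripZr// mulN1r.
Qed.
Lemma ripNl u v : car u -> car v -> << - v, u >> = - << v, u >>.
Proof. by move=> *; rewrite ripC// ripNr// ripC. Qed.
Lemma ripBr u v w : car u -> car v -> car w -> << u, v - w >> = << u, v >> - << u, w >>.
Proof. by move=> *; rewrite ripDr// ripNr. Qed.
Lemma ripBl u v w : car u -> car v -> car w -> << v - w, u >> = << v, u >> - << w, u >>.
Proof. by move=> *; rewrite ripDl// ripNl. Qed.
Lemma rip0r u : car u -> << u, 0 >> = 0.
Proof. by move=> hu; rewrite -(scale0r 0) ripZr// mul0r. Qed.
Lemma rip0l u : car u -> << 0, u >> = 0.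
Proof. by move=> hu; rewrite ripC// rip0r. Qed.
Lemma rip_sumr (I : Type) (s : seq I) (F : I -> V) u : car u ->
  (forall i, car (F i)) -> << u, \sum_(i <- s) F i >> = \sum_(i <- s) << u, F i >>.
Proof.
move=> hu hF; elim: s => [|i s IH]; first by rewrite !big_nil rip0r.
by rewrite !big_cons ripDr ?IH//; apply: car_sum.
Qed.
Lemma rip_suml (I : Type) (s : seq I) (F : I -> V) u : car u ->
  (forall i, car (F i)) -> << \sum_(i <- s) F i, u >> = \sum_(i <- s) << F i, u >>.
Proof.
move=> hu hF; rewrite ripC//; last by apply: car_sum.
by rewrite rip_sumr//; apply: eq_bigr => i _; rewrite ripC.
Qed.

Lemma ip_ri u v : car u -> car v ->
  ip K u v = Complex << u, v >> (- << u, 'i%C *: v >>).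
Proof.
by move=> hu hv; rewrite /rip ipZr//; case: (ip K u v) => x y /=;
  rewrite mul0r mul1r sub0r opprK.
Qed.

Lemma rip_ge0 u : car u -> 0 <= << u, u >>.
Proof.
move=> hu; case: (hilbP K) => [_ [_ _ h _] _].
by have := h u hu; rewrite lecE => /andP[].
Qed.
Lemma ip_self u : car u -> ip K u u = << u, u >>%:C.
Proof.
move=> hu; case: (hilbP K) => [_ [_ _ h _] _].
have := ger0_Im (h u hu); rewrite /rip; case: (ip K u u) => x y /= ->. by [].
Qed.
Lemma rip_eq0 u : car u -> << u, u >> = 0 -> u = 0.
Proof.
move=> hu h0; case: (hilbP K) => [_ [_ _ _ h] _].
by apply: h => //; rewrite ip_self// h0.
Qed.

Lemma hnorm_ge0 u : 0 <= n[u]. Proof. exact: sqrtr_ge0. Qed.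
Lemma hnorm2 u : car u -> n[u] ^+ 2 = << u, u >>.
Proof. by move=> hu; rewrite /hnorm sqr_sqrtr// rip_ge0. Qed.
Lemma hnorm0 : n[0] = 0.
Proof. by rewrite /hnorm -/(rip K 0 0) rip0r// sqrtr0. Qed.
Lemma hnorm_eq0 u : car u -> n[u] = 0 -> u = 0.
Proof. by move=> hu h; apply: rip_eq0 => //; rewrite -hnorm2// h expr0n. Qed.
Lemma hnorm_le u v : car u -> car v -> (n[u] <= n[v]) = (<< u, u >> <= << v, v >>).
Proof. by move=> hu hv; rewrite -!hnorm2// ler_sqr// nnegrE hnorm_ge0. Qed.

Lemma rip_CS2 u v : car u -> car v -> << u, v >> ^+ 2 <= << u, u >> * << v, v >>.
Proof.
move=> hu hv; have [v0|vn0] := eqVneq << v, v >> 0.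
  by rewrite (rip_eq0 hv v0) rip0r// expr0n rip0r// mulr0.
have v_gt0 : 0 < << v, v >> by rewrite lt_def vn0 rip_ge0.
have := @rip_ge0 (<< v, v >>%:C *: u - << u, v >>%:C *: v).
rewrite ripBr// !ripBl// !ripZr// !ripZl// (ripC hv hu).
move=> /(_ ltac:(auto)) h; nra.
Qed.
Lemma rip_CS u v : car u -> car v -> `|<< u, v >>| <= n[u] * n[v].
Proof.
move=> hu hv; rewrite -ler_sqr ?nnegrE//; last by rewrite mulr_ge0// hnorm_ge0.
by rewrite exprMn !hnorm2// real_normK ?num_real// rip_CS2.
Qed.
Lemma rip_le u v : car u -> car v -> << u, v >> <= n[u] * n[v].
Proof. by move=> hu hv; apply: le_trans (rip_CS hu hv); exact: ler_norm. Qed.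

Lemma hnormD u v : car u -> car v -> n[u + v] <= n[u] + n[v].
Proof.
move=> hu hv; rewrite -ler_sqr ?nnegrE ?addr_ge0 ?hnorm_ge0//.
rewrite sqrrD !hnorm2// ripDr// !ripDl// (ripC hv hu).
have := rip_le hu hv; lra.
Qed.
Lemma hnormN u : car u -> n[- u] = n[u].
Proof. by move=> hu; rewrite /hnorm -!/(rip K _ _) ripNr// ripNl// opprK. Qed.
Lemma hnorm_distC u v : car u -> car v -> n[u - v] = n[v - u].
Proof. by move=> hu hv; rewrite -hnormN// opprB. Qed.
Lemma hnormZ c u : car u -> n[c *: u] = complex.Re `|c| * n[u].
Proof.
move=> hu; rewrite /hnorm ipZr// (ipC hu (carZ c hu)) ipZr// ip_self//.
rewrite rmorphM/= mulrA.
rewrite -[X in X * _](_ : (complex.Re `|c| ^+ 2)%:C = _) ; last first.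
  by rewrite -sqr_normc rmorphXn normc_def.
rewrite -[_ -i* 0]/(conjc (<< u, u >>%:C)) conjc_real -rmorphM.
rewrite [complex.Re _%:C]/= sqrtrM ?sqr_ge0//.
by rewrite sqrtr_sqr ger0_norm// /Normc.normc; case: (c) => ? ?; exact: sqrtr_ge0.
Qed.
Lemma hnormZr a u : car u -> n[a%:C *: u] = `|a| * n[u].
Proof.
by move=> hu; rewrite hnormZ// normc_def/= expr0n addr0 sqrtr_sqr.
Qed.
Lemma hnormBD u v w : car u -> car v -> car w -> n[u - w] <= n[u - v] + n[v - w].
Proof.
move=> hu hv hw; rewrite (_ : u - w = (u - v) + (v - w)); first exact: hnormD.
by rewrite addrA subrK.
Qed.
Lemma parallelogram u v : car u -> car v ->
  << u - v, u - v >> + << u + v, u + v >> = 2 * << u, u >> + 2 * << v, v >>.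
Proof.
by move=> hu hv; rewrite ripBr// !ripBl// ripDr// !ripDl// (ripC hv hu); ring.
Qed.

Lemma hcvgP (x : nat -> V) l : hcvg K x l <->
  forall e : R, 0 < e -> exists N, forall n, (N <= n)%N -> n[x n - l] < e.
Proof.
split=> [/cvgrPdist_lt h e e0|h].
  have [N _ hN] := h e e0; exists N => n Nn.
  by have := hN n Nn; rewrite sub0r normrN ger0_norm// hnorm_ge0.
apply/cvgrPdist_lt => e e0; have [N hN] := h e e0; exists N => // n /= Nn.
by rewrite sub0r normrN ger0_norm ?hnorm_ge0// hN.
Qed.

Lemma null_le (a b : nat -> R) : (forall n, 0 <= a n <= b n) ->
  b @ \oo --> (0 : R) -> a @ \oo --> (0 : R).
Proof. by move=> h hb; apply: (squeeze_cvgr _ (cvg_cst 0) hb); exact: nearW. Qed.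

Lemma cvg_dist_le (a b : nat -> R) (l : R) : (forall n, `|a n - l| <= b n) ->
  b @ \oo --> (0 : R) -> a @ \oo --> l.
Proof.
move=> h hb; apply/subr_cvg0/norm_cvg0P; apply: null_le hb => n.
by rewrite normr_ge0 h.
Qed.

Lemma cvgn_le (a : nat -> R) (l b : R) :
  a @ \oo --> l -> (forall n, a n <= b) -> l <= b.
Proof.
by move=> ha h; apply: ler_cvg_to ha (cvg_cst b) _; exact: nearW.
Qed.

Lemma hcvg_le (x y : nat -> V) l m (C : R) :
  (forall n, n[y n - m] <= C * n[x n - l]) -> hcvg K x l -> hcvg K y m.
Proof.
move=> h hx; apply: (@null_le _ (fun n => C * n[x n - l])).
- by move=> n; rewrite hnorm_ge0 h.
- by rewrite -(mulr0 C); apply: cvgMr.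
Qed.

Lemma hcvg_cst l : hcvg K (fun=> l) l.
Proof. by rewrite /hcvg subrr hnorm0; exact: cvg_cst. Qed.

Lemma hcvgD (x y : nat -> V) l m : (forall n, car (x n)) -> (forall n, car (y n)) ->
  car l -> car m ->
  hcvg K x l -> hcvg K y m -> hcvg K (fun n => x n + y n) (l + m).
Proof.
move=> cx cy cl cm hx hy.
apply: (@null_le _ (fun n => n[x n - l] + n[y n - m])).
- move=> n; rewrite hnorm_ge0/= opprD addrACA.
  exact: hnormD.
- by rewrite -(addr0 0); apply: cvgD.
Qed.

Lemma hcvgZ c (x : nat -> V) l : (forall n, car (x n)) -> car l ->
  hcvg K x l -> hcvg K (fun n => c *: x n) (c *: l).
Proof.
move=> cx cl; apply: (@hcvg_le _ _ _ _ (complex.Re `|c|)) => n.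
by rewrite -scalerBr hnormZ.
Qed.

Lemma hcvg_rip (x : nat -> V) l v : (forall n, car (x n)) -> car l -> car v ->
  hcvg K x l -> (fun n => << x n, v >>) @ \oo --> << l, v >>.
Proof.
move=> cx cl cv hx; apply: (@cvg_dist_le _ (fun n => n[v] * n[x n - l])).
  by move=> n; rewrite -ripBl// mulrC; exact: rip_CS.
by rewrite -(mulr0 n[v]); apply: cvgMr.
Qed.

Lemma hcvg_hnorm (x : nat -> V) l : (forall n, car (x n)) -> car l ->
  hcvg K x l -> (fun n => n[x n]) @ \oo --> n[l].
Proof.
move=> cx cl hx; apply: (@cvg_dist_le _ (fun n => n[x n - l])) => // n.
have h1 := hnormD cl (carD (cx n) (carN cl)).
have h2 := hnormD (cx n) (carD cl (carN (cx n))).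
move: h1 h2; rewrite ![_ + (_ - _)]addrC !subrK (hnorm_distC cl (cx n)) => h1 h2.
by rewrite ler_norml; apply/andP; split; lra.
Qed.

Lemma hcvg_rip2 (x : nat -> V) l : (forall n, car (x n)) -> car l ->
  hcvg K x l -> (fun n => << x n, x n >>) @ \oo --> << l, l >>.
Proof.
move=> cx cl hx; rewrite -hnorm2//; under eq_fun do rewrite -hnorm2//.
by rewrite expr2; under eq_fun do rewrite expr2; apply: cvgM; exact: hcvg_hnorm.
Qed.

Lemma hcvg_unique (x : nat -> V) l m : (forall n, car (x n)) -> car l -> car m ->
  hcvg K x l -> hcvg K x m -> l = m.
Proof.
move=> cx cl cm hl hm; apply/eqP; rewrite -subr_eq0; apply/eqP.
apply: hnorm_eq0 => //.
suff h : (fun _ : nat => n[l - m]) @ \oo --> (0 : R).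
  exact: cvg_unique (cvg_cst _) h.
apply: (@null_le _ (fun n => n[x n - l] + n[x n - m])).
- by move=> n; rewrite hnorm_ge0/= (hnorm_distC (cx n) cl) hnormBD.
- by rewrite -(addr0 0); apply: cvgD.
Qed.

Lemma hcauchy_cvg (x : nat -> V) : (forall n, car (x n)) -> hcauchy K x ->
  exists2 l, car l & hcvg K x l.
Proof. by case: (hilbP K) => _ _; apply. Qed.

Lemma hcvg_shift (x : nat -> V) l n : hcvg K x l -> hcvg K (fun k => x (n + k)%N) l.
Proof.
move/hcvgP => h; apply/hcvgP => e e0; have [N hN] := h e e0.
by exists N => k Nk; apply: hN; rewrite (leq_trans Nk)// leq_addl.
Qed.

(** The common reason why spectral approximations converge: the squared distances
    are increments of a bounded real sequence. *)
Lemma increment_cvg (x : nat -> V) (F : nat -> R) (b : R) : (forall n, car (x n)) ->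
  (forall n, F n <= b) ->
  (forall m n, (m <= n)%N -> << x m - x n, x m - x n >> <= F n - F m) ->
  exists2 l, car l & hcvg K x l.
Proof.
move=> cx Fc h.
have Fnd m n : (m <= n)%N -> F m <= F n.
  move=> mn; have := h _ _ mn; have := rip_ge0 (carD (cx m) (carN (cx n))); lra.
have Fcv : cvgn F.
  by apply: nondecreasing_is_cvgn; [move=> m n; exact: Fnd|exists b => _ [n _ <-]].
have Fl n : F n <= limn F by apply: nondecreasing_cvgn_le => // m k; exact: Fnd.
apply: hcauchy_cvg => // e e0; have e2 : 0 < e ^+ 2 by rewrite exprn_gt0.
have /cvgrPdist_lt/(_ _ e2)[N _ hN] := Fcv.
have key m n : (N <= m)%N -> (m <= n)%N -> n[x m - x n] < e.
  move=> Nm mn; rewrite -[_ < e]ltr_sqr ?nnegrE ?hnorm_ge0 ?(ltW e0)// hnorm2//.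
  apply: le_lt_trans (h _ _ mn) _; have := hN m Nm; rewrite ger0_norm ?subr_ge0// => hm.
  by have := Fl n; lra.
exists N => m n Nm Nn; have [mn|/ltnW nm] := leqP m n; first exact: key.
by rewrite hnorm_distC//; exact: key.
Qed.

Lemma halfD u : (2^-1)%:C *: (u + u) = u.
Proof.
rewrite -[X in _ *: (X + X)]scale1r -scalerDl scalerA.
rewrite -(rmorph1 (real_complex R)) -rmorphD -rmorphM.
by rewrite (_ : 2^-1 * (1 + 1) = 1 :> R) ?scale1r//; field.
Qed.

(** Points of almost minimal norm in a decreasing sequence of closed convex sets
    form a Cauchy sequence, by the parallelogram law.  This stands in for weak
    compactness of balls: it serves for the projection theorem (constant
    sequence) and to extract a limit of approximations in [contr_vec_orth]. *)
Lemma nested_convex (C : nat -> set V) (b0 : R) :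
  (forall n, C n `<=` car) ->
  (forall n m, (n <= m)%N -> C m `<=` C n) ->
  (forall n u v, C n u -> C n v -> C n ((2^-1)%:C *: (u + v))) ->
  (forall n x l, (forall k, C n (x k)) -> car l -> hcvg K x l -> C n l) ->
  (forall n, exists2 c, C n c & << c, c >> <= b0) ->
  exists l, (forall n, C n l) /\
    forall b, (forall n, exists2 c, C n c & << c, c >> <= b) -> << l, l >> <= b.
Proof.
move=> Ccar Cdec Cmid Ccl Cb0.
pose S n := [set << c, c >> | c in C n].
pose d n := inf (S n).
have Slb n : lbound (S n) 0.
  by move=> _ [c Cc <-]; apply: rip_ge0; exact: Ccar Cc.
have Sinf n : has_inf (S n).
  by split; [have [c Cc _] := Cb0 n; exists << c, c >>; exists c | exists 0; exact: Slb].
have dle n (c : V) : C n c -> d n <= << c, c >>.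
  by move=> Cc; apply: ge_inf; [exists 0; exact: Slb|exists c].
have dnd n m : (n <= m)%N -> d n <= d m.
  move=> nm; apply: lb_le_inf; first by case: (Sinf m).
  by move=> _ [c Cc <-]; apply: dle; exact: Cdec Cc.
have dleb b : (forall n, exists2 c, C n c & << c, c >> <= b) -> forall n, d n <= b.
  by move=> h n; have [c Cc cb] := h n; exact: le_trans (dle _ _ Cc) cb.
have pick n : exists c : V, C n c /\ << c, c >> < d n + (n.+1%:R)^-1.
  have [_ [c Cc <-] h] := @inf_adherent _ (S n) (n.+1%:R)^-1 ltac:(by rewrite invr_gt0) (Sinf n).
  by exists c; split.
have {pick} /choice[x hx] := pick.
have cx n : car (x n) by apply: Ccar (hx n).1.
have dcvg : cvgn d.
  apply: nondecreasing_is_cvgn; first by move=> n m; exact: dnd.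
  by exists b0 => _ [n _ <-]; exact: dleb.
have dD n : d n <= limn d by apply: nondecreasing_cvgn_le => // p m; exact: dnd.
have hcau : hcauchy K x.
  move=> e e0.
  have e4 : 0 < e ^+ 2 / 8 by rewrite divr_gt0// exprn_gt0.
  have /cvgrPdist_lt/(_ _ e4)[N1 _ hN1] := dcvg.
  have /cvgrPdist_lt/(_ _ e4)[N2 _ hN2] := @cvg_harmonic R.
  exists (maxn N1 N2) => m n Nm Nn.
  set N := maxn N1 N2 in Nm Nn.
  have {}hN1 : limn d - d N < e ^+ 2 / 8.
    have := hN1 N (leq_maxl _ _); rewrite ger0_norm// subr_ge0. exact: dD.
  have {}hN2 k : (N <= k)%N -> (k.+1%:R)^-1 < e ^+ 2 / 8.
    move=> Nk; have := hN2 k (leq_trans (leq_maxr _ _) Nk).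
    by rewrite /= sub0r normrN ger0_norm// invr_ge0.
  have cm := Cdec _ _ Nm _ (hx m).1; have cn := Cdec _ _ Nn _ (hx n).1.
  have := dle _ _ (Cmid _ _ _ cm cn).
  rewrite ripZr ?ripZl//; auto.
  have := parallelogram (cx m) (cx n).
  have := (hx m).2; have := (hx n).2; have := dD m; have := dD n.
  have := hN2 m Nm; have := hN2 n Nn.
  rewrite -[_ < e]ltr_sqr ?nnegrE ?hnorm_ge0 ?(ltW e0)// hnorm2//.
  move: (m.+1%:R^-1) (n.+1%:R^-1) => im jn; lra.
have [l cl xl] := hcauchy_cvg cx hcau.
exists l; split.
  move=> n; apply: (Ccl n (fun k => x (n + k)%N)) => //.
    by move=> k; apply: Cdec (hx (n + k)%N).1; rewrite leq_addr.
  exact: hcvg_shift.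
move=> b hb.
have h0 : (fun n => b + n.+1%:R^-1) @ \oo --> b + 0.
  by apply: cvgD; [exact: cvg_cst|exact: cvg_harmonic].
rewrite -[b]addr0; apply: ler_cvg_to (hcvg_rip2 cx cl xl) h0 _.
apply: nearW => n; apply: le_trans (ltW (hx n).2) _.
by rewrite lerD2r; exact: dleb.
Qed.

Definition closed_subspace (D : set V) :=
  [/\ is_subspace D, D `<=` car &
   forall x l, (forall k, D (x k)) -> car l -> hcvg K x l -> D l].

Section Proj.
Variables (D : set V) (hD : closed_subspace D).

Let Dcar u : D u -> car u. Proof. by case: hD => _ h _; exact: h. Qed.
Let D0 : D 0. Proof. by case: hD => -[]. Qed.
Let DP c u v : D u -> D v -> D (c *: u + v).
Proof. by case: hD => -[_ h] _ _; exact: h. Qed.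
Let DD u v : D u -> D v -> D (u + v).
Proof. by move=> hu hv; rewrite -[u]scale1r; exact: DP. Qed.
Let DZ c u : D u -> D (c *: u).
Proof. by move=> hu; rewrite -[_ *: _]addr0; apply: DP. Qed.

Lemma proj_exists u : car u ->
  exists p, D p /\ forall v, D v -> << u - p, v >> = 0.
Proof.
move=> hu; pose C := [set w | exists2 p, D p & w = u - p].
have Cc w : C w -> car w by move=> [p /Dcar hp ->].
have [] := @nested_convex (fun=> C) << u, u >>.
- by move=> _; exact: Cc.
- by move=> *.
- move=> _ _ _ [p hp ->] [q hq ->]; exists ((2^-1)%:C *: (p + q)); first exact/DZ/DD.
  rewrite addrACA scalerDr -opprD scalerN; congr (_ - _).
  exact: halfD.
- move=> _ x l hx hl xl; exists (u - l); last by rewrite opprB addrC subrK.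
  have hh k : D (u - x k).
    by have [p hp ->] := hx k; rewrite opprB addrC subrK.
  have cx k : car (x k) by exact: Cc.
  have [_ _ h] := hD; apply: (h (fun k => u - x k)) => //.
  apply: (@hcvg_le _ _ _ _ 1) xl => n.
  by rewrite mul1r opprB addrC addrA subrK hnorm_distC.
- by move=> _; exists u => //; exists 0; rewrite ?subr0.
move=> w [/(_ 0%N)[p hp wE] hmin]; exists p; split=> // v hv; rewrite -wE.
have cv := Dcar hv; have cp := Dcar hp; have cw : car w by rewrite wE.
(* Minimality of [w] along the line [w - t v]; the choice
   t = (w, v) / ((v, v) + 1) works also for [v = 0]. *)
have hh (t : R) : 0 <= - (2 * t * << w, v >>) + t ^+ 2 * << v, v >>.
  have : << w, w >> <= << w - t%:C *: v, w - t%:C *: v >>.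
    apply: hmin => _; exists (w - t%:C *: v) => //.
    exists (p + t%:C *: v); first by rewrite addrC; exact: DP.
    by rewrite wE opprD addrA.
  by rewrite ripBr// !ripBl// !ripZr// !ripZl// (ripC cv cw); lra.
apply/eqP/negPn/negP => wv0.
have vv := rip_ge0 cv.
have vv1 : 0 < << v, v >> + 1 by lra.
have := hh (<< w, v >> / (<< v, v >> + 1)).
set q := << w, v >> in wv0 *; set a := << v, v >> in vv vv1 *.
have q2 : 0 < q ^+ 2 by rewrite exprn_even_gt0.
rewrite [X in 0 <= X](_ : _ = - (q ^+ 2 * (a + 2) / (a + 1) ^+ 2)); last by field; rewrite gt_eqF.
rewrite oppr_ge0 leNgt => /negP; apply.
by rewrite divr_gt0 ?exprn_gt0// mulr_gt0//; lra.
Qed.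

Lemma closed_subspace_full : (forall u, car u -> (forall v, D v -> << u, v >> = 0) -> u = 0) ->
  D = car.
Proof.
move=> h; apply/seteqP; split=> [u /Dcar//|u hu].
have [p [hp hv]] := proj_exists hu.
by rewrite -(subrK p u) (h _ _ hv) ?add0r//; have := Dcar hp.
Qed.

Definition proj u : V := xget 0 [set p | D p /\ forall v, D v -> << u - p, v >> = 0].

Lemma projP u : car u -> D (proj u) /\ forall v, D v -> << u - proj u, v >> = 0.
Proof. by move=> /proj_exists pe; exact: (xgetPex 0 pe). Qed.

Lemma proj_uniq u p : car u -> D p -> (forall v, D v -> << u - p, v >> = 0) -> proj u = p.
Proof.
move=> hu hp hv; have [hq hw] := projP hu.
have cp := Dcar hp; have cq := Dcar hq.
apply/eqP; rewrite -subr_eq0; apply/eqP; apply: rip_eq0 => //.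
have dd : D (proj u - p) by rewrite -scaleN1r addrC; exact: DP.
have := hw _ dd; have := hv _ dd; rewrite !ripBl ?ripBr//; lra.
Qed.

Lemma orth_complex u : car u -> (forall v, D v -> << u, v >> = 0) ->
  forall c v, D v -> << c *: u, v >> = 0.
Proof.
move=> hu h c v hv; have cv := Dcar hv.
rewrite ripC// /rip ipZr// (ipC hu cv) ip_ri// h// h ?oppr0; last exact: DZ.
by case: c => x y /=; rewrite oppr0 !mulr0 subr0.
Qed.

End Proj.

(** Boundedness is no part of the record: it is automatic ([sop_bounded]). *)
Record sop := Sop { sop_fun :> V -> V;
  sop_car : forall u, car u -> car (sop_fun u);
  sop_lin : forall c u v, car u -> car v ->
    sop_fun (c *: u + v) = c *: sop_fun u + sop_fun v;
  sop_sym : forall u v, car u -> car v -> << sop_fun u, v >> = << u, sop_fun v >> }.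

Section Sop.
Variable T : sop.
Lemma sop0 : T 0 = 0.
Proof.
have := sop_lin T (-1) car0 car0; rewrite scaler0 addr0 scaleN1r addNr. by [].
Qed.
Lemma sopZ c u : car u -> T (c *: u) = c *: T u.
Proof. by move=> hu; rewrite -[c *: u]addr0 sop_lin// sop0 addr0. Qed.
Lemma sopD u v : car u -> car v -> T (u + v) = T u + T v.
Proof. by move=> hu hv; rewrite -[u in LHS]scale1r sop_lin// scale1r. Qed.
Lemma sopN u : car u -> T (- u) = - T u.
Proof. by move=> hu; rewrite -scaleN1r sopZ// scaleN1r. Qed.
Lemma sopB u v : car u -> car v -> T (u - v) = T u - T v.
Proof. by move=> hu hv; rewrite sopD// sopN. Qed.
Lemma sop_ip u v : car u -> car v -> ip K u (T v) = ip K (T u) v.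
Proof.
move=> hu hv; have := sop_car T hu; have := sop_car T hv => *; rewrite !ip_ri//.
by rewrite -!sopZ// !sop_sym.
Qed.
End Sop.

Lemma proj_lin D (hD : closed_subspace D) c u v : car u -> car v ->
  proj D (c *: u + v) = c *: proj D u + proj D v.
Proof.
move=> hu hv; have [hp ho] := projP hD hu; have [hq hr] := projP hD hv.
have [[D0 DP] Dc _] := hD.
apply: proj_uniq => //; first exact: DP.
move=> w hw; have cw := Dc _ hw; have cp := Dc _ hp; have cq := Dc _ hq.
rewrite opprD addrACA -scalerBr ripDl// hr// addr0.
exact: (orth_complex hD).
Qed.
Lemma proj_car D (hD : closed_subspace D) u : car u -> car (proj D u).
Proof. by move=> /(projP hD)[hp _]; case: hD => _ h _; exact: h. Qed.
Lemma proj_rip D (hD : closed_subspace D) u v : car u -> car v ->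
  << proj D u, v >> = << proj D u, proj D v >>.
Proof.
move=> hu hv; have [hp _] := projP hD hu; have [_ hr] := projP hD hv.
have cp := proj_car hD hu; have cq := proj_car hD hv.
have := hr _ hp; rewrite ripBl// (ripC cp hv) (ripC cp cq); lra.
Qed.
Lemma proj_sym D (hD : closed_subspace D) u v : car u -> car v ->
  << proj D u, v >> = << u, proj D v >>.
Proof.
move=> hu hv; have cp := proj_car hD hu; have cq := proj_car hD hv.
by rewrite proj_rip// (ripC hu)// (proj_rip hD hv)// ripC.
Qed.
Definition sproj D (hD : closed_subspace D) : sop :=
  Sop (proj_car hD) (proj_lin hD) (proj_sym hD).
Lemma proj_id D (hD : closed_subspace D) u : D u -> proj D u = u.
Proof.
move=> hu; have [_ Dc _] := hD; have cu := Dc _ hu; apply: proj_uniq => // v hv.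
by rewrite subrr rip0l//; exact: Dc.
Qed.
End Basics.
#[export] Hint Resolve car0 carD carZ carN sop_car : car.
#[export] Hint Extern 4 (carrier _ _) => refine (carN _) : car.
#[export] Hint Extern 4 (carrier _ _) => refine (carD _ _) : car.
#[export] Hint Extern 4 (carrier _ _) => refine (carZ _ _) : car.
#[export] Hint Extern 4 (carrier _ _) => refine (sop_car _ _) : car.
#[export] Hint Extern 0 (carrier _ _) => solve [auto 20 with car nocore] : core.

(** * Vectors on which the iterates of a positive operator stay bounded *)

Section ConvexSeq.
Variables (R : realType) (t : nat -> R).
Hypothesis tconv : forall k, 2 * t k.+1 <= t k + t k.+2.

Lemma convex_incr j k : (j <= k)%N -> t j.+1 - t j <= t k.+1 - t k.
Proof.
move=> /subnKC <-; elim: (k - j)%N => [|n IH]; first by rewrite addn0.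
by apply: le_trans IH _; rewrite addnS; have := tconv (j + n); lra.
Qed.

Lemma convex_le_ends a k b : (forall k, 0 <= t k) -> (a <= k <= b)%N -> t k <= t a + t b.
Proof.
move=> t0 /andP[ak kb]; have [d0|d0] := leP 0 (t k.+1 - t k).
  suff : t k <= t b by have := t0 a; lra.
  rewrite -(subnKC kb); elim: (b - k)%N => [|n IH]; first by rewrite addn0.
  by apply: le_trans IH _; rewrite addnS; have := @convex_incr k (k + n) (leq_addr _ _); lra.
suff : t k <= t a by have := t0 b; lra.
rewrite -(subnK ak) in d0 *; elim: (k - a)%N d0 => [|n IH] //= d0.
have d1 : t (n + a).+1 - t (n + a)%N < 0.
  by apply: le_lt_trans (convex_incr _) d0; rewrite addSn.
by have := IH d1; rewrite addSn; lra.
Qed.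

(** A convex sequence that increases somewhere grows at least linearly from there
    on, so a bounded one is nonincreasing. *)
Lemma convex_bounded_le c : (forall k, t k <= c) -> forall k, t k <= t 0%N.
Proof.
move=> tc; suff h k : t k.+1 <= t k.
  by elim=> // k IH; exact: le_trans (h k) IH.
rewrite leNgt; apply/negP => d0.
have grow n : t k + n%:R * (t k.+1 - t k) <= t (k + n)%N.
  elim: n => [|n IH]; first by rewrite mul0r addr0 addn0.
  have := @convex_incr k (k + n) (leq_addr _ _); rewrite addnS -natr1; lra.
have [n hn] : exists n : nat, (c - t k) / (t k.+1 - t k) < n%:R.
  exists (Num.bound ((c - t k) / (t k.+1 - t k))); apply: archi_boundP.
  by rewrite divr_ge0 ?subr_ge0 ?tc ?(ltW d0).
have := grow n; have := tc (k + n)%N.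
move: hn; rewrite ltr_pdivrMr ?subr_gt0//; lra.
Qed.
End ConvexSeq.

Section Powers.
Variables (R : realType) (V : lmodType R[i]) (K : hilb V) (C : sop K).
Implicit Types (u v w : V).
Local Notation car := (carrier K).
Local Notation "<< u , v >>" := (rip K u v).
Local Notation "n[ u ]" := (hnorm K u).

Lemma iter_car n u : car u -> car (iter n C u).
Proof. by move=> hu; elim: n => //= n IH. Qed.
Hint Extern 4 (carrier _ _) => refine (iter_car _ _) : car.

Lemma iter_lin n c u v : car u -> car v ->
  iter n C (c *: u + v) = c *: iter n C u + iter n C v.
Proof. by move=> hu hv; elim: n => //= n ->; rewrite sop_lin//. Qed.

Lemma iter_sym n u v : car u -> car v -> << iter n C u, v >> = << u, iter n C v >>.
Proof.
move=> hu; elim: n v => //= n IH v hv.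
by rewrite sop_sym// IH// -iterSr.
Qed.
Definition siter n : sop K := Sop (@iter_car n) (@iter_lin n) (@iter_sym n).

Lemma rip_iter m n u : car u -> << iter m C u, iter n C u >> = << u, iter (m + n) C u >>.
Proof. by move=> hu; rewrite iter_sym// iterD. Qed.

Lemma iter_0 n : iter n C 0 = 0. Proof. exact: (sop0 (siter n)). Qed.
Lemma iterZ n c u : car u -> iter n C (c *: u) = c *: iter n C u.
Proof. exact: (sopZ (siter n)). Qed.
Lemma iter_add n u v : car u -> car v -> iter n C (u + v) = iter n C u + iter n C v.
Proof. exact: (sopD (siter n)). Qed.
Lemma iterB n u v : car u -> car v -> iter n C (u - v) = iter n C u - iter n C v.
Proof. exact: (sopB (siter n)). Qed.

Hypothesis Cpos : forall u, car u -> 0 <= << u, C u >>.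
Variable b : R.
Hypothesis Cbnd : forall u, car u -> n[C u] <= b * n[u].

Lemma iter_bnd n u : car u -> n[iter n C u] <= `|b| ^+ n * n[u].
Proof.
move=> hu; elim: n => [|n IH]; first by rewrite mul1r.
rewrite iterS exprS -mulrA; apply: le_trans (Cbnd _) _ => //.
apply: le_trans (ler_wpM2l (normr_ge0 b) IH).
by rewrite ler_wpM2r ?hnorm_ge0// ler_norm.
Qed.

Lemma moment_ge0 k u : car u -> 0 <= << u, iter k C u >>.
Proof.
move=> hu; rewrite -(odd_double_half k) -addnn; case: (odd k) => /=.
  by rewrite add0n iterD -iterS iterSr -iter_sym// Cpos.
by rewrite add0n -rip_iter// rip_ge0.
Qed.

(** The difference of the two sides is (v, C^k v) for v = u - C u. *)
Lemma moment_convex k u : car u ->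
  2 * << u, iter k.+1 C u >> <= << u, iter k C u >> + << u, iter k.+2 C u >>.
Proof.
move=> hu; have := @moment_ge0 k (u - C u).
move/(_ ltac:(auto)); rewrite iterB// ripBr// !ripBl//=.
have -> : << C u, iter k C u >> = << u, iter k.+1 C u >> by rewrite sop_sym.
rewrite -iterSr.
have -> : << C u, iter k.+1 C u >> = << u, iter k.+2 C u >> by rewrite sop_sym.
by lra.
Qed.

Lemma even_moment_convex k u : car u ->
  2 * << u, iter (k.+1).*2 C u >> <=
    << u, iter k.*2 C u >> + << u, iter (k.+2).*2 C u >>.
Proof.
move=> hu; rewrite !doubleS.
have h1 := moment_convex k.*2 hu; have h2 := moment_convex (k.*2).+1 hu.
have h3 := moment_convex (k.*2).+2 hu.
by lra.
Qed.

Lemma iter_hnorm2 n u : car u -> n[iter n C u] ^+ 2 = << u, iter n.*2 C u >>.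
Proof. by move=> hu; rewrite hnorm2// rip_iter// addnn. Qed.

(** For a positive operator C this is the range of its spectral projection for
    [0, 1]: on the rest of the space the iterates grow. *)
Definition contr_vec : set V := [set u | car u /\ forall n, n[iter n C u] <= n[u]].

(** Bounded iterates are already bounded by the initial norm, because the squared
    norms ||C^k u||^2 = (u, C^(2k) u) form a convex sequence.  Any bound on the
    iterates suffices, which is what makes [contr_vec] stable under addition. *)
Lemma contr_vecP u c : car u -> (forall n, n[iter n C u] <= c) -> contr_vec u.
Proof.
move=> hu hc; split=> // n.
rewrite -ler_sqr ?nnegrE ?hnorm_ge0// iter_hnorm2// hnorm2//.
have := @convex_bounded_le R (fun k => << u, iter k.*2 C u >>)
  (fun k => even_moment_convex k hu) (c ^+ 2); apply=> k.
rewrite -iter_hnorm2// ler_sqr ?nnegrE ?hnorm_ge0//.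
exact: le_trans (hnorm_ge0 _ _) (hc 0%N).
Qed.

Lemma hcvg_sop_iter n (x : nat -> V) l : (forall k, car (x k)) -> car l ->
  hcvg K x l -> hcvg K (fun k => iter n C (x k)) (iter n C l).
Proof.
move=> cx cl; apply: (@hcvg_le _ _ _ _ _ _ _ (`|b| ^+ n)) => k.
by rewrite -iterB//; apply: iter_bnd.
Qed.

Lemma contr_vec_closed : closed_subspace K contr_vec.
Proof.
split.
- split; first by split=> // n; rewrite iter_0.
  move=> c u v [hu un] [hv vn].
  apply: (@contr_vecP _ (complex.Re `|c| * n[u] + n[v])) => // n.
  rewrite iter_lin//; apply: le_trans (hnormD _ _) _ => //.
  rewrite hnormZ//; apply: lerD (vn n); rewrite ler_wpM2l//.
  by rewrite normc_def sqrtr_ge0.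
- by move=> u [].
move=> x l hx cl xl; split=> // n.
have cx k : car (x k) by case: (hx k).
have h1 := hcvg_hnorm (fun k => iter_car n (cx k)) (iter_car n cl)
  (hcvg_sop_iter n cx cl xl).
have h2 := hcvg_hnorm cx cl xl.
apply: ler_cvg_to h1 h2 _; apply: nearW => k; by case: (hx k).
Qed.

Lemma contr_vec_inv u : contr_vec u -> contr_vec (C u).
Proof.
move=> [hu h]; apply: (@contr_vecP _ n[u]) => // n.
by rewrite -iterSr.
Qed.

Lemma contr_vec_le u : contr_vec u -> << u, C u >> <= << u, u >>.
Proof.
move=> [hu h]; apply: le_trans (rip_le _ _) _ => //.
by rewrite -hnorm2// expr2 ler_wpM2l ?hnorm_ge0// (h 1%N).
Qed.
End Powers.

#[export] Hint Extern 4 (carrier _ _) => refine (iter_car _ _ _) : car.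

Section Resolvent.
Variables (R : realType) (V : lmodType R[i]) (K : hilb V) (T : sop K).
Implicit Types (u v w : V).
Local Notation car := (carrier K).
Local Notation "<< u , v >>" := (rip K u v).
Local Notation "n[ u ]" := (hnorm K u).
Hypothesis Tpos : forall u, car u -> 0 <= << u, T u >>.
Variable b : R.
Hypothesis Tbnd : forall u, car u -> n[T u] <= b * n[u].

(** I + T is bounded below by 1 for positive T, so that its range is closed, and a
    vector w orthogonal to the range is orthogonal to w + T w, hence zero. *)
Lemma resolvent_exists u : car u -> exists2 v, car v & v + T v = u.
Proof.
pose D := [set v + T v | v in car].
have low v : car v -> n[v] <= n[v + T v].
  move=> hv; rewrite hnorm_le// ripDr// !ripDl//.
  by rewrite sop_sym//; have := Tpos hv; have := rip_ge0 (sop_car T hv); rewrite sop_sym//; lra.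
have hD : closed_subspace K D.
  split.
  - split; first by exists 0 => //; rewrite sop0 addr0.
    move=> c _ _ [v hv <-] [w hw <-]; exists (c *: v + w) => //.
    by rewrite sop_lin// scalerDr addrACA.
  - by move=> _ [v hv <-].
  move=> x l hx cl xl.
  have /choice[y hy] : forall k, exists v, car v /\ v + T v = x k.
    by move=> k; have [v hv <-] := hx k; exists v.
  have cy k : car (y k) := (hy k).1.
  have [|m cm ym] := @hcauchy_cvg _ _ K y cy.
    move=> e e0; have /hcvgP/(_ (e / 2))[|N hN] := xl; first by rewrite divr_gt0.
    exists N => p q Np Nq; apply: le_lt_trans (low _ _) _ => //.
    rewrite sopB// addrACA -opprD (hy p).2 (hy q).2.
    have cx k : car (x k) by rewrite -(hy k).2.
    have := hnormBD (cx p) cl (cx q); have := hN _ Np; have := hN _ Nq.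
    by rewrite (hnorm_distC (cx q) cl); lra.
  exists m => //; apply: (@hcvg_unique _ _ K x) => //; first by move=> k; rewrite -(hy k).2.
  rewrite (_ : x = fun k => y k + T (y k)); last by apply/funext => k; rewrite (hy k).2.
  apply: (@hcvgD _ _ K y (fun k => T (y k))) => //.
  apply: (@hcvg_le _ _ _ _ _ _ _ b) ym => k.
  by rewrite -sopB//; apply: Tbnd.
have -> : car u = D u.
  congr (_ u); apply/esym/(closed_subspace_full hD) => w hw wD.
  apply: (@rip_eq0 _ _ K) => //; have := wD (w + T w); rewrite ripDr//.
  have h : D (w + T w) by exists w.
  move=> /(_ h); have := Tpos hw; have := rip_ge0 hw; lra.
by move=> [v hv <-]; exists v.
Qed.
End Resolvent.

Section Gap.
Variables (R : realType) (V : lmodType R[i]) (K : hilb V) (C : sop K).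
Implicit Types (u v w : V).
Local Notation car := (carrier K).
Local Notation "<< u , v >>" := (rip K u v).
Local Notation "n[ u ]" := (hnorm K u).
Hypothesis Cpos : forall u, car u -> 0 <= << u, C u >>.
Variable b : R.
Hypothesis Cbnd : forall u, car u -> n[C u] <= b * n[u].

(** The vector v = (I + C^N)^(-1) u is a smooth substitute for the projection of u
    onto [contr_vec C], as 1 / (1 + x^N) tends to the indicator of [0, 1[ for
    large N. *)
Lemma approx_contr n u : car u -> exists v, [/\ car v,
  << u, u >> - << u, C u >> <= << v, u >> & forall m, (m <= n)%N -> n[iter m C v] <= n[u]].
Proof.
move=> hu; have [N [N0 nN]] : exists N, (0 < N)%N /\ (n <= N)%N by exists n.+1.
 have [] := @resolvent_exists _ _ K (siter C N) _ (`|b| ^+ N) _ u hu.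
- by move=> v hv; exact: (moment_ge0 Cpos).
- by move=> v hv; exact: (iter_bnd Cbnd).
move=> v hv /= vu; exists v; split=> //.
  rewrite -vu sopD// ripDr// !ripDl// !ripDr//.
  rewrite -(iterS _ C v) !rip_iter//.
  rewrite !(@ripC _ _ K (iter _ C v) v)//.
  have -> : << iter N C v, C v >> = << v, iter N.+1 C v >>.
    by rewrite iter_sym// -iterSr.
  have cvx k := moment_convex Cpos k hv.
  have ge0 k := moment_ge0 Cpos k hv.
  (* With the moments t_k = (v, C^k v), the claim reads
     t_N + t_(2N) <= t_1 + 2 t_(N+1) + t_(2N+1); by convexity
     t_N <= t_1 + t_(N+1) and t_(2N) <= t_(N+1) + t_(2N+1). *)
have h1 := @convex_le_ends _ (fun k => << v, iter k C v >>) cvx 1 N N.+1 ge0.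
  have h2 := @convex_le_ends _ (fun k => << v, iter k C v >>) cvx N.+1 (N + N) (N + N.+1) ge0.
  have {}h1 := h1 ltac:(lia). have {}h2 := h2 ltac:(lia).
  rewrite -[C v]/(iter 1 C v); lra.
move=> m mn; rewrite -ler_sqr ?nnegrE ?hnorm_ge0// iter_hnorm2// hnorm2// -vu.
have := @convex_le_ends _ (fun k => << v, iter k C v >>) (fun k => moment_convex Cpos k hv)
  0 m.*2 (N + N) (fun k => moment_ge0 Cpos k hv).
move=> /(_ ltac:(lia)).
rewrite ripDr// !ripDl// rip_iter// iter_sym//.
have := moment_ge0 Cpos N hv; lra.
Qed.

(** Otherwise the approximations of the previous lemma keep a fixed positive inner
    product with u.  For each n, those whose first n iterates are bounded by the
    norm of u form a closed convex set, and these sets decrease; a common point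
    belongs to [contr_vec C] and is not orthogonal to u. *)
Lemma contr_vec_orth u : car u -> (forall v, contr_vec C v -> << u, v >> = 0) ->
  << u, u >> <= << u, C u >>.
Proof.
move=> hu uM; rewrite leNgt; apply/negP => gap.
pose S n := [set v | [/\ car v, << u, u >> - << u, C u >> <= << v, u >>
  & forall m, (m <= n)%N -> n[iter m C v] <= n[u]]].
have [] := @nested_convex _ _ K S << u, u >>.
- by move=> n v [].
- by move=> n m nm v [hv h1 h2]; split=> // k kn; apply: h2; exact: leq_trans nm.
- move=> n v w [hv h1 h2] [hw h3 h4]; split=> //.
    by rewrite ripZl// ripDl//; lra.
  move=> m mn; rewrite iterZ// iter_add// hnormZr//.
  rewrite ger0_norm ?invr_ge0//; have := hnormD (iter_car C m hv) (iter_car C m hw).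
  by have := h2 _ mn; have := h4 _ mn; lra.
- move=> n x l hx cl xl; have cx k : car (x k) by case: (hx k).
  split=> //.
    apply: ler_cvg_to (cvg_cst _) (hcvg_rip cx cl hu xl) _.
    by apply: nearW => k; case: (hx k).
  move=> m mn; apply: (cvgn_le (hcvg_hnorm _ _ (hcvg_sop_iter Cbnd m cx cl xl))) => // k.
  by case: (hx k) => _ _; apply.
- move=> n; have [v [hv h1 h2]] := approx_contr n hu; exists v => //.
  by have := h2 0%N isT; rewrite /= hnorm_le.
move=> v [hS _]; have [hv h1 _] := hS 0%N.
have : contr_vec C v.
  apply: (@contr_vecP _ _ _ _ Cpos v n[u]) => // n.
  by have [_ _] := hS n; apply.
by move=> /uM; rewrite ripC//; lra.
Qed.
End Gap.

(** * The spectral family of a positive injective contraction *)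

Section SubspaceProj.
Variables (R : realType) (V : lmodType R[i]) (K : hilb V).
Implicit Types (u v w : V) (D : set V).
Local Notation car := (carrier K).
Local Notation "<< u , v >>" := (rip K u v).

Definition scaled (a : R) (T : sop K) : sop K.
Proof.
refine (@Sop _ _ K (fun u => a%:C *: T u) _ _ _).
- by move=> u hu; auto.
- by move=> c u v hu hv; rewrite sop_lin// scalerDr !scalerA mulrC.
- by move=> u v hu hv; rewrite ripZl// ripZr// sop_sym.
Defined.

Lemma iter_scaled a (T : sop K) n u : car u ->
  iter n (scaled a T) u = (a ^+ n)%:C *: iter n T u.
Proof.
move=> hu; elim: n => [|n IH]; first by rewrite expr0 scale1r.
by rewrite !iterS IH /= sopZ// scalerA -rmorphM exprS.
Qed.

Hint Extern 4 (carrier _ _) => refine (proj_car _ _) : car.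

Lemma proj_sub D D' (hD : closed_subspace K D) (hD' : closed_subspace K D') u :
  car u -> D `<=` D' -> proj K D (proj K D' u) = proj K D u.
Proof.
move=> hu DD; have cp := proj_car hD' hu; have cq := proj_car hD hu.
have [hp hv] := projP hD hu; have [hp' hv'] := projP hD' hu.
apply: proj_uniq => // v Dv; have [_ Dc _] := hD; have cv := Dc _ Dv.
have := hv _ Dv; have := hv' _ (DD _ Dv); rewrite !ripBl//; lra.
Qed.

Lemma proj_diff D D' (hD : closed_subspace K D) (hD' : closed_subspace K D') u :
  car u -> D `<=` D' ->
  << proj K D' u - proj K D u, proj K D' u - proj K D u >> =
  << u, proj K D' u >> - << u, proj K D u >>.
Proof.
move=> hu DD; have cp := proj_car hD' hu; have cq := proj_car hD hu.
rewrite !ripBr// !ripBl// (ripC cp cq) -!(@proj_rip _ _ K D)//.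
rewrite -[<< proj K D' u, proj K D' u >>](@proj_rip _ _ K D')//.
have -> : << proj K D u, proj K D' u >> = << proj K D u, u >>.
  by rewrite (proj_rip hD hu cp) proj_sub// -proj_rip.
by rewrite (ripC hu cp) (ripC hu cq); lra.
Qed.

Lemma proj_form_ge0 D (hD : closed_subspace K D) u : car u -> 0 <= << u, proj K D u >>.
Proof. by move=> hu; rewrite -proj_sym// proj_rip// rip_ge0// proj_car. Qed.

Lemma proj_form_mono D D' (hD : closed_subspace K D) (hD' : closed_subspace K D') u :
  car u -> D `<=` D' -> << u, proj K D u >> <= << u, proj K D' u >>.
Proof.
move=> hu DD; rewrite -subr_ge0 -proj_diff// rip_ge0//.
Qed.

(** The projections onto decreasing closed subspaces converge strongly to the
    projection onto the intersection: their quadratic forms decrease, and by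
    [proj_diff] differences of the forms control distances. *)
Lemma nested_proj (D : nat -> set V) D' (hD : forall n, closed_subspace K (D n))
  (hD' : closed_subspace K D') u : car u ->
  (forall n m, (n <= m)%N -> D m `<=` D n) -> (forall n, D' `<=` D n) ->
  (forall v, (forall n, D n v) -> D' v) ->
  hcvg K (fun n => proj K (D n) u) (proj K D' u).
Proof.
move=> hu dec sub cap.
pose x n := proj K (D n) u.
have cx n : car (x n) by exact: proj_car.
have [||l cl xl] := @increment_cvg _ _ K x (fun n => - << u, x n >>) 0 cx.
- by move=> n; rewrite oppr_le0; exact: proj_form_ge0.
- by move=> m n mn; rewrite proj_diff//; [rewrite opprK addrC|exact: dec].
suff -> : proj K D' u = l by [].
have Dl n : D n l.
  have [_ _ h] := hD n; apply: (h (fun k => x (n + k)%N)) => //.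
    by move=> k; apply: (dec _ (n + k)%N); rewrite ?leq_addr//; case: (projP (hD (n + k)%N) hu).
  exact: hcvg_shift.
apply: proj_uniq => //; first exact: cap.
move=> v hv; have [_ Dc _] := hD'; have cv := Dc _ hv.
rewrite ripBl//; apply/eqP; rewrite subr_eq0; apply/eqP.
suff h0 : (fun n => << x n, v >>) @ \oo --> << u, v >>.
  exact: cvg_unique h0 (hcvg_rip cx cl cv xl).
have h n : << x n, v >> = << u, v >>.
  by have [_ /(_ v (sub n _ hv))] := projP (hD n) hu; rewrite ripBl// -/(x n); lra.
by under eq_fun do rewrite h; exact: cvg_cst.
Qed.
End SubspaceProj.

Section Spec.
Variables (R : realType) (V : lmodType R[i]) (K : hilb V) (B : sop K).
Implicit Types (u v w : V) (l m : R).
Local Notation car := (carrier K).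
Local Notation "<< u , v >>" := (rip K u v).
Local Notation "n[ u ]" := (hnorm K u).
Hypothesis Bpos : forall u, car u -> 0 <= << u, B u >>.
Hypothesis Bcontr : forall u, car u -> n[B u] <= n[u].
Hypothesis Binj : forall u, car u -> B u = 0 -> u = 0.

(** The range of the spectral projection of B for [0, l].  At l = 0 it is {0}
    because B is injective, which is what the right continuity needs. *)
Definition spec l : set V := if 0 < l then contr_vec (scaled l^-1 B) else [set 0].

Let spos l (l0 : 0 < l) u : car u -> 0 <= << u, scaled l^-1 B u >>.
Proof. by move=> hu /=; rewrite ripZr// mulr_ge0 ?Bpos// invr_ge0 ltW. Qed.

Let sbnd l (l0 : 0 < l) u : car u -> n[scaled l^-1 B u] <= l^-1 * n[u].
Proof.
move=> hu /=; rewrite hnormZr// ger0_norm ?invr_ge0 ?(ltW l0)//.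
by rewrite ler_wpM2l ?invr_ge0 ?(ltW l0)// Bcontr.
Qed.

Lemma specE l u : 0 < l -> spec l u <-> car u /\ forall n, n[iter n B u] <= l ^+ n * n[u].
Proof.
move=> l0; rewrite /spec l0; split=> -[hu h]; split=> // n; have := h n;
  rewrite iter_scaled// hnormZr// ger0_norm ?exprn_ge0 ?invr_ge0 ?(ltW l0)//;
  by rewrite exprVn ler_pdivrMl// exprn_gt0.
Qed.

Lemma spec_car l : spec l `<=` car.
Proof.
by rewrite /spec; case: ifP => _ u; [case|move=> ->; exact: car0].
Qed.

Lemma set0_closed_subspace : closed_subspace K [set 0].
Proof.
split.
- by split=> // c u v -> ->; rewrite scaler0 addr0.
- by move=> u ->; exact: car0.
move=> x l hx cl xl; apply: (@hcvg_unique _ _ K x) => //.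
- by move=> k; rewrite (hx k).
- rewrite (_ : x = fun=> 0); first exact: hcvg_cst.
  by apply/funext => k; rewrite (hx k).
Qed.

Lemma spec_closed l : closed_subspace K (spec l).
Proof.
rewrite /spec; case: ifP => l0; last exact: set0_closed_subspace.
exact: (contr_vec_closed (spos l0) (sbnd l0)).
Qed.

Lemma spec_le0 l : l <= 0 -> spec l = [set 0].
Proof. by move=> l0; rewrite /spec ltNge l0. Qed.

Lemma spec_ge1 l : 1 <= l -> spec l = car.
Proof.
move=> l1; have l0 : 0 < l by lra.
apply/seteqP; split=> [|u hu]; first exact: spec_car.
apply/specE => //; split=> // n; elim: n => [|n IH]; first by rewrite mul1r.
rewrite iterS; apply: le_trans (Bcontr _) _ => //; apply: le_trans IH _.
by rewrite exprS -mulrA ler_peMl// mulr_ge0 ?hnorm_ge0// exprn_ge0// ltW.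
Qed.

Lemma spec_mono l m : l <= m -> spec l `<=` spec m.
Proof.
move=> lm; have [l0|l0] := ltP 0 l; last first.
  rewrite (spec_le0 l0) => _ ->; by case: (spec_closed m) => -[].
have m0 : 0 < m by exact: lt_le_trans lm.
move=> u /(specE _ l0)[hu h]; apply/specE => //; split=> // n.
apply: le_trans (h n) _; rewrite ler_wpM2r ?hnorm_ge0//.
by rewrite lerXn2r// nnegrE ltW.
Qed.

Lemma spec_inv l u : spec l u -> spec l (B u).
Proof.
rewrite /spec; case: ifP => l0; last by move=> ->; rewrite sop0.
move=> h; have := contr_vec_inv (spos l0) h; rewrite /= => h1.
have [[_ hZ] _ _] := contr_vec_closed (spos l0) (sbnd l0).
have := hZ l%:C _ 0 h1; rewrite addr0 scalerA -rmorphM mulfV ?gt_eqF// scale1r.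
apply; by case: (contr_vec_closed (spos l0) (sbnd l0)) => -[].
Qed.

Lemma spec_upper l u : spec l u -> << u, B u >> <= l * << u, u >>.
Proof.
rewrite /spec; case: ifP => l0; last by move=> ->; rewrite sop0 rip0r// mulr0.
move=> h; have [hu _] := h.
have := contr_vec_le h; rewrite /= ripZr//.
by rewrite ler_pdivrMl.
Qed.

Lemma spec_lower l u : car u -> (forall v, spec l v -> << u, v >> = 0) ->
  l * << u, u >> <= << u, B u >>.
Proof.
move=> hu; rewrite /spec; case: ifPn => l0; last first.
  move=> _; rewrite -leNgt in l0; apply: le_trans (Bpos hu).
  by rewrite mulr_le0_ge0// rip_ge0.
move=> h; have := contr_vec_orth (spos l0) (sbnd l0) hu h.
by rewrite /= ripZr// ler_pdivlMl.
Qed.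

(** The condition ||B^n u|| <= l^n ||u|| is closed in l.  At l = 0 it says B u = 0,
    and injectivity gives u = 0. *)
Lemma spec_rc l u : (forall n, spec (l + n.+1%:R^-1) u) -> spec l u.
Proof.
move=> h; have [l0|l0] := ltP l 0.
  have [n hn] : exists n : nat, n.+1%:R^-1 < - l.
    have l1 : 0 < - l by lra.
    have /cvgrPdist_lt/(_ _ l1)[N _ hN] := @cvg_harmonic R; exists N.
    by have := hN N (leqnn N); rewrite sub0r normrN ger0_norm//= ?invr_ge0.
  have l1 : l + n.+1%:R^-1 <= 0 by rewrite -lerBrDl sub0r ltW.
  by rewrite (spec_le0 (ltW l0)); have := h n; rewrite (spec_le0 l1).
have hu : car u by exact: spec_car (h 0%N).
have key k : n[iter k B u] <= l ^+ k * n[u].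
  have hc : (fun n => (l + n.+1%:R^-1) ^+ k * n[u]) @ \oo --> (l + 0) ^+ k * n[u].
    apply: cvgMl; apply: (@cvg_comp _ _ _ (fun n => l + n.+1%:R^-1) (fun x => x ^+ k)).
      by apply: cvgD; [exact: cvg_cst|exact: cvg_harmonic].
    exact: exprn_continuous.
  rewrite addr0 in hc.
  apply: ler_cvg_to (cvg_cst _) hc _; apply: nearW => n.
  have n0 : 0 < l + n.+1%:R^-1.
    by rewrite ltr_wpDl// invr_gt0.
  by have /(specE _ n0)[_] := h n; exact.
move: l0; rewrite le_eqVlt => /predU1P[l0|l0]; last by apply/specE.
rewrite -l0 spec_le0//; apply: Binj => //; apply: (@hnorm_eq0 _ _ K) => //.
by apply/eqP; rewrite eq_le hnorm_ge0 andbT; have := key 1%N; rewrite -l0 expr0n mul0r.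
Qed.

(** The distribution function of the spectral measure of B at u. *)
Definition sfun u l : R := << u, proj K (spec l) u >>.

Lemma sfun_nd u : car u -> {homo sfun u : l m / l <= m}.
Proof.
move=> hu l m lm; apply: proj_form_mono => //; try exact: spec_closed.
exact: spec_mono.
Qed.

Lemma sfun_rc u : car u -> right_continuous (sfun u).
Proof.
move=> hu l; apply/cvgrPdist_le => e e0.
have h : (fun n => sfun u (l + n.+1%:R^-1)) @ \oo --> sfun u l.
  have hh := @nested_proj _ _ K (fun n => spec (l + n.+1%:R^-1)) (spec l)
    (fun n => spec_closed _) (spec_closed l) u hu.
  have {}hh : hcvg K (fun n => proj K (spec (l + n.+1%:R^-1)) u) (proj K (spec l) u).
    apply: hh.
    - move=> n m nm; apply: spec_mono; rewrite lerD2l lef_pV2 ?posrE// ler_nat//.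
    - by move=> n; apply: spec_mono; rewrite lerDl invr_ge0.
    - by move=> v; exact: spec_rc.
  have cp m : car (proj K (spec m) u) by apply: proj_car => //; exact: spec_closed.
  rewrite /sfun; under eq_fun do rewrite ripC//.
  by rewrite ripC//; apply: hcvg_rip.
have /cvgrPdist_le/(_ _ e0)[N _ hN] := h.
have hN0 := hN N (leqnn N).
near=> y.
rewrite ler0_norm ?subr_le0; last by apply: sfun_nd => //; near: y; exact: nbhs_right_ge.
rewrite opprB; move: hN0; rewrite ler0_norm ?subr_le0; last first.
  by apply: sfun_nd => //; rewrite lerDl invr_ge0.
rewrite opprB; apply: le_trans; rewrite lerD2r; apply: sfun_nd => //.
near: y; apply: nbhs_right_le; rewrite ltrDl invr_gt0//.
Unshelve. all: end_near. Qed.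

Lemma sfun_le0 u l : car u -> l <= 0 -> sfun u l = 0.
Proof.
move=> hu l0; rewrite /sfun spec_le0//.
rewrite (@proj_uniq _ _ K _ set0_closed_subspace u 0)// ?rip0r// => v ->.
by rewrite subr0 rip0r.
Qed.

Lemma sfun_ge1 u l : car u -> 1 <= l -> sfun u l = << u, u >>.
Proof.
by move=> hu l1; rewrite /sfun (proj_id (spec_closed l))// spec_ge1.
Qed.

End Spec.

Section LS.
Variable R : realType.
(** The Lebesgue-Stieltjes measure of a distribution function that is constant
    outside [0, 1] also has the expected values on half-lines and on the line. *)
Lemma cumulative_measure (F : R -> R) (c : R) :
  {homo F : x y / x <= y} -> right_continuous F ->
  (forall x, x <= 0 -> F x = 0) -> (forall x, 1 <= x -> F x = c) ->
  exists mu : {measure set (measurableTypeR R) -> \bar R},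
    [/\ forall a, mu `]-oo, a]%classic = (F a)%:E & mu setT = c%:E].
Proof.
move=> Fnd Frc F0 F1.
pose f : cumulative R R := HB.pack F (isCumulative.Build R _ R F Fnd Frc).
pose mu : {measure set (measurableTypeR R) -> \bar R} := lebesgue_stieltjes_measure f.
have muoc a b : a <= b -> mu `]a, b]%classic = (F b - F a)%:E.
  move=> ab; rewrite /mu/= /lebesgue_stieltjes_measure /measure_extension.
  rewrite measurable_mu_extE/=; last exact: is_ocitv.
  by rewrite wlength_itv_bnd.
have muy a : mu `]-oo, a]%classic = (F a)%:E.
  pose S n : set (measurableTypeR R) := `]- n%:R, a]%classic.
  have SE : `]-oo, a]%classic = \bigcup_n S n.
    rewrite eqEsubset; split=> [x /= xa|x [n _]]; last first.
      by rewrite /S/= !in_itv/= => /andP[].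
    exists (Num.bound `|x|) => //; rewrite /S/= !in_itv/= in xa *; rewrite xa andbT.
    have := archi_boundP (normr_ge0 x); have := ler_norm (- x); rewrite normrN; lra.
  have mS n : measurable (S n) by exact: measurable_itv.
  have h : (mu \o S) @ \oo --> mu (\bigcup_n S n).
    apply: nondecreasing_cvg_mu => //; first exact: bigcup_measurable.
    move=> n m nm; apply/subsetPset => x; rewrite /S/= !in_itv/= => /andP[h ->].
    by rewrite andbT; apply: le_lt_trans h; rewrite lerN2 ler_nat.
  rewrite SE; apply: (cvg_unique _ h) => //.
  apply: cvg_near_cst; exists (Num.bound `|a|) => // n /= Nn.
  have an : - n%:R <= a.
    have := archi_boundP (normr_ge0 a); have := ler_norm (- a); rewrite normrN.
    have : (Num.bound `|a|)%:R <= n%:R :> R by rewrite ler_nat. lra.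
  by rewrite muoc// (F0 (- n%:R)) ?subr0// oppr_le0.
exists mu; split=> //.
pose S n : set (measurableTypeR R) := `]-oo, n%:R]%classic.
have SE : setT = \bigcup_n S n.
  rewrite eqEsubset; split=> [x _|//]; exists (Num.bound `|x|) => //.
  rewrite /S/= in_itv/=; have := archi_boundP (normr_ge0 x); have := ler_norm x; lra.
have mS n : measurable (S n) by exact: measurable_itv.
have h : (mu \o S) @ \oo --> mu (\bigcup_n S n).
  apply: nondecreasing_cvg_mu => //.
  - exact: bigcup_measurable.
  - move=> n m nm; apply/subsetPset => x; rewrite /S/= !in_itv/= => h.
    by apply: le_trans h _; rewrite ler_nat.
rewrite [X in mu X]SE; apply: (cvg_unique _ h) => //.
apply: cvg_near_cst; exists 1%N => // n /= Nn.
by rewrite muy F1// (ler_nat _ 1).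
Qed.
End LS.

(** * From scalar measures to a projection-valued measure *)

Section Forms.
Variables (R : realType) (V : lmodType R[i]) (K : hilb V).
Implicit Types (u v w : V) (S T P Q : sop K).
Local Notation car := (carrier K).
Local Notation "<< u , v >>" := (rip K u v).
Local Notation "n[ u ]" := (hnorm K u).

(** Polarization: expand the two forms at u + v. *)
Lemma sop_form_eq S T : (forall u, car u -> << u, S u >> = << u, T u >>) ->
  forall u, car u -> S u = T u.
Proof.
move=> h u hu.
have key v : car v -> << v, S u >> = << v, T u >>.
  move=> hv; have := h (u + v) ltac:(auto).
  rewrite !sopD// !ripDr// !ripDl// h// (h v)// -(sop_sym S hu hv) -(sop_sym T hu hv).
  by rewrite (ripC (sop_car S hu) hv) (ripC (sop_car T hu) hv); lra.
apply/eqP; rewrite -subr_eq0; apply/eqP; apply: (@rip_eq0 _ _ K) => //.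
by rewrite ripBr// key// subrr.
Qed.

Lemma sop_lim (S : nat -> sop K) : (forall u, car u -> exists2 l, car l & hcvg K (fun n => S n u) l) ->
  exists T, forall u, car u -> hcvg K (fun n => S n u) (T u).
Proof.
move=> hc; pose t u := xget 0 [set l | car l /\ hcvg K (fun n => S n u) l].
have ht u : car u -> car (t u) /\ hcvg K (fun n => S n u) (t u).
  move=> hu; have [l cl hl] := hc u hu.
  apply: (@xgetPex _ 0 [set l | car l /\ hcvg K (fun n => S n u) l]); by exists l.
have tcar u : car u -> car (t u) by move=> /ht[].
have tlin c u v : car u -> car v -> t (c *: u + v) = c *: t u + t v.
  move=> hu hv; have [_ h1] := ht u hu; have [_ h2] := ht v hv.
  have [_ h3] := ht (c *: u + v) ltac:(auto).
  have tu := tcar _ hu; have tv := tcar _ hv.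
  apply: (hcvg_unique _ _ _ h3); try by auto.
  rewrite (_ : (fun n => _) = (fun n => c *: S n u + S n v)); last first.
    by apply/funext => n; rewrite sop_lin.
  by apply: (@hcvgD _ _ K (fun n => c *: S n u)) => //; auto; apply: hcvgZ.
have tsym u v : car u -> car v -> << t u, v >> = << u, t v >>.
  move=> hu hv; have [tu h1] := ht u hu; have [tv h2] := ht v hv.
  have {}h1 := hcvg_rip (fun n => sop_car (S n) hu) tu hv h1.
  have {}h2 := hcvg_rip (fun n => sop_car (S n) hv) tv hu h2.
  rewrite [RHS]ripC//; apply: (cvg_unique _ h1) => //.
  rewrite (_ : (fun n => _) = (fun n => << S n v, u >>))//.
  by apply/funext => n; rewrite sop_sym// ripC.
by exists (Sop tcar tlin tsym) => u /ht[].
Qed.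

Definition sop_sum (T : nat -> sop K) (n : nat) : sop K.
Proof.
refine (@Sop _ _ K (fun u => \sum_(i < n) T i u) _ _ _).
- by move=> u hu; apply: car_sum => i _; auto.
- move=> c u v hu hv; rewrite scaler_sumr -big_split; apply: eq_bigr => i _.
  by rewrite sop_lin.
- move=> u v hu hv; rewrite rip_suml; [|by auto|by auto].
  rewrite rip_sumr; [|by auto|by auto].
  by apply: eq_bigr => i _; rewrite sop_sym.
Defined.

Definition scompl (T : sop K) : sop K.
Proof.
refine (@Sop _ _ K (fun u => u - T u) _ _ _).
- by auto.
- by move=> c u v hu hv; rewrite sop_lin// opprD addrACA -scalerBr.
- by move=> u v hu hv; rewrite ripBl// ripBr// sop_sym.
Defined.

Definition sop1 : sop K := @Sop _ _ K id (fun u hu => hu) (fun c u v _ _ => erefl)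
  (fun u v _ _ => erefl).

Definition idem T := forall u, car u -> T (T u) = T u.

Lemma idem_form T u : idem T -> car u -> << u, T u >> = << T u, T u >>.
Proof. by move=> hT hu; rewrite sop_sym// hT. Qed.

Lemma idem_ge0 T u : idem T -> car u -> 0 <= << u, T u >>.
Proof. by move=> hT hu; rewrite idem_form// rip_ge0. Qed.

(** Applied to Q u, the hypothesis leaves (Q u, P Q u) = ||P Q u||^2 <= 0. *)
Lemma idem_disj P Q : idem P -> idem Q ->
  (forall u, car u -> << u, P u >> + << u, Q u >> <= << u, u >>) ->
  forall u, car u -> P (Q u) = 0.
Proof.
move=> hP hQ h u hu; apply: (@rip_eq0 _ _ K) => //.
have := h (Q u) ltac:(auto); rewrite hQ//.
have := rip_ge0 (sop_car P (sop_car Q hu)); rewrite -idem_form//.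
by move=> *; apply/eqP; rewrite eq_le; apply/andP; split; lra.
Qed.

Lemma idem_le P Q : idem P -> idem Q ->
  (forall u, car u -> << u, P u >> <= << u, Q u >>) ->
  forall u, car u -> Q (P u) = P u.
Proof.
move=> hP hQ h u hu.
have hC : idem (scompl Q).
  by move=> v hv /=; rewrite sopB// hQ// subrr subr0.
have := @idem_disj (scompl Q) P hC hP.
move=> /(_ _ u hu)/= h0; apply/esym/eqP; rewrite -subr_eq0; apply/eqP; apply: h0.
by move=> v hv; rewrite ripBr//; have := h _ hv; lra.
Qed.

(** The partial sums of mutually orthogonal projections are projections whose
    quadratic forms increase and stay below the identity, so they converge
    strongly. *)
Lemma idem_series (T : nat -> sop K) : (forall i, idem (T i)) ->
  (forall i j, i != j -> forall u, car u -> << u, T i u >> + << u, T j u >> <= << u, u >>) ->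
  exists S, idem S /\ (forall u, car u -> hcvg K (fun n => \sum_(i < n) T i u) (S u)).
Proof.
move=> hT hdis.
have dis i j u : i != j -> car u -> T i (T j u) = 0.
  by move=> ij; apply: idem_disj => //; exact: hdis.
pose S n := sop_sum T n.
have TS i m u : car u -> T i (S m u) = if (i < m)%N then T i u else 0.
  move=> hu; elim: m => [|m IH]; first by rewrite /S/= big_ord0 sop0.
  have SE : S m.+1 u = S m u + T m u by rewrite /S/= big_ord_recr.
  rewrite SE sopD ?IH; [|by auto|by auto].
  rewrite ltnS; have [im|im|->] := ltngtP i m.
  - by rewrite dis ?addr0// ltn_eqF.
  - by rewrite dis ?addr0// gtn_eqF.
  - by rewrite hT// add0r.
have SS n m u : (m <= n)%N -> car u -> S n (S m u) = S m u.
  move=> mn hu; rewrite {1}/S/=.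
  rewrite (eq_bigr (fun i : 'I_n => if (i < m)%N then T i u else 0)); last first.
    by move=> i _; rewrite TS.
  rewrite -big_mkcond /S/= (big_ord_widen_cond n predT (fun i => T i u) mn).
  by apply: eq_bigl => i.
have SS' n m u : (m <= n)%N -> car u -> S m (S n u) = S m u.
  move=> mn hu; rewrite {1}/S/= (eq_bigr (fun i : 'I_m => T i u))//.
  by move=> i _; rewrite TS// (leq_trans _ mn).
have f_b u n : car u -> << u, S n u >> <= << u, u >>.
  move=> hu; have : 0 <= << u - S n u, u - S n u >> by apply: rip_ge0; auto.
  rewrite ripBr ?ripBl; [|by auto..].
  rewrite -[<< S n u, S n u >>](sop_sym (S n))//.
  by rewrite (sop_sym (S n))// SS// (sop_sym (S n))//; lra.
have diffS m n u : (m <= n)%N -> car u ->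
    << S m u - S n u, S m u - S n u >> = << u, S n u >> - << u, S m u >>.
  move=> mn hu; rewrite ripBr ?ripBl; [|by auto..].
  have E k l : << S k u, S l u >> = << u, S k (S l u) >> by rewrite (sop_sym (S k)); auto.
  by rewrite !E (SS n m)// (SS' n m)// (SS m m)// (SS n n)//; lra.
have [|U hU] := @sop_lim S.
  move=> u hu; apply: (@increment_cvg _ _ K _ (fun n => << u, S n u >>) << u, u >>).
  - by auto.
  - by move=> n; exact: f_b.
  - by move=> m n mn; rewrite diffS.
exists U; split=> // u hu; apply: (@hcvg_unique _ _ K (fun n => S n (U u))); try by auto.
rewrite (_ : (fun n => _) = (fun n => S n u)); first exact: hU.
apply/funext => n.
apply: (@hcvg_unique _ _ K (fun k => S n (S (n + k)%N u))); try by auto.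
  have sbnd v : car v -> n[S n v] <= 1 * n[v].
    by move=> hv; rewrite mul1r hnorm_le// (sop_sym (S n))// SS// f_b.
  apply: (@hcvg_le _ _ K (fun k => S (n + k)%N u) _ (U u) _ 1).
    by move=> k; rewrite -sopB//; apply: sbnd.
  exact: hcvg_shift (hU u hu).
rewrite (_ : (fun k => _) = (fun=> S n u)); first exact: hcvg_cst.
by apply/funext => k; rewrite SS'// leq_addr.
Qed.
End Forms.

Section PVM.
Variables (R : realType) (V : lmodType R[i]) (K : hilb V).
Implicit Types (u v w : V) (S T P Q : sop K).
Local Notation car := (carrier K).
Local Notation "<< u , v >>" := (rip K u v).
Notation mT := (measurableTypeR R).

Variable mu : V -> {measure set mT -> \bar R}.
Hypothesis muT : forall u, car u -> mu u setT = << u, u >>%:E.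

Definition represents (M : set mT) T :=
  idem T /\ forall u, car u -> mu u M = << u, T u >>%:E.

Lemma represents_bigcup (F : nat -> set mT) (T : nat -> sop K) :
  (forall n, measurable (F n)) -> trivIset setT F ->
  (forall n, represents (F n) (T n)) ->
  exists S, represents (\bigcup_n F n) S /\
    forall u, car u -> hcvg K (fun n => \sum_(i < n) T i u) (S u).
Proof.
move=> mF tF hT.
have [|i j ij u hu|S [hS hl]] := @idem_series _ _ K T; first by move=> i; case: (hT i).
  rewrite -lee_fin EFinD -(hT i).2// -(hT j).2// -muT// -measureU//; last first.
    by have /trivIsetP := tF; apply.
  by apply: le_measure; rewrite ?inE//; exact: measurableU.
exists S; split=> //; split=> // u hu.
have h1 := @measure_sigma_additive _ _ _ (mu u) F mF tF.
apply: (cvg_unique _ h1) => //.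
rewrite (_ : (fun n => _) = (fun n => << u, \sum_(i < n) T i u >>%:E)); last first.
  apply/funext => n; rewrite rip_sumr//.
  by rewrite big_mkord -sumEFin; apply: eq_bigr => i _; rewrite (hT i).2.
apply: cvg_EFin; first exact: nearW.
rewrite (_ : _ \o _ = (fun n => << sop_sum T n u, u >>)); last first.
  by apply/funext => n /=; rewrite ripC//; apply: car_sum => i _; auto.
rewrite ripC//; apply: hcvg_rip (hl u hu) => // n.
exact: (sop_car (sop_sum T n)).
Qed.

Hypothesis mu_ray : forall a, exists T, represents `]-oo, a]%classic T.

Lemma rays_generate : @measurable _ mT = <<s range (fun a : R => `]-oo, a]%classic) >>.
Proof.
apply/seteqP; split.
  apply: smallest_sub; first exact: smallest_sigma_algebra.
  move=> _ [[a b] _ <-] /=.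
  have -> : `]a, b]%classic = `]-oo, b] `&` ~` `]-oo, a].
    apply/seteqP; split=> x /=; rewrite !in_itv/=.
      by move=> /andP[ax ->]; split=> //; apply/negP; rewrite -ltNge.
    by move=> [-> /negP]; rewrite -ltNge => ->.
  pose T := g_sigma_algebraType (range (fun a : R => `]-oo, a]%classic)).
  have mr c : @measurable _ T `]-oo, c]%classic by apply: sub_sigma_algebra; exists c.
  apply: (@measurableI _ T); [exact: mr|apply: (@measurableC _ T); exact: mr].
apply: smallest_sub; first exact: sigma_algebra_measurable.
by move=> _ [a _ <-]; exact: measurable_itv.
Qed.

(** Half-lines generate the Borel sets and are stable under intersection, while
    the sets represented by a projection form a Dynkin system: complements
    correspond to I - T, and disjoint unions to [idem_series]. *)
Lemma represents_exists (M : set mT) : measurable M -> exists T, represents M T.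
Proof.
rewrite rays_generate; apply: (dynkin_induction (P := fun M => exists T, represents M T)).
- exact: rays_generate.
- move=> _ _ [a _ <-] [b _ <-]; exists (Num.min a b) => //.
  by apply/seteqP; split=> x /=; rewrite !in_itv/= le_min => /andP.
- by exists (sop1 K); split=> // u hu; rewrite muT.
- by move=> _ [a _ <-].
- move=> S mS [T [hT hTu]]; exists (scompl T); split=> [u hu|u hu] /=.
    by rewrite sopB// hT// subrr subr0.
  rewrite ripBr// EFinB -hTu// -muT// -setTD measureD ?setTI//.
  exact: (eq_ind_r (fun x => (x < +oo)%E) (ltry _) (muT hu)).
- move=> F mF tF /choice[T hT].
  by have [S [h _]] := represents_bigcup mF tF hT; exists S.
Qed.

Lemma pvm_exists : exists E, projection_valued_measure K E /\
  forall M, measurable M -> forall u, car u -> spectral_dist K E u M = mu u M.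
Proof.
have /choice[T hT] : forall M : set mT, exists T, measurable M -> represents M T.
  move=> M; have [mM|nM] := pselect (measurable M); last by exists (sop1 K).
  by have [T h] := represents_exists mM; exists T.
have uniq M S : measurable M -> represents M S -> forall u, car u -> S u = T M u.
  move=> mM [_ hS]; apply: sop_form_eq => u hu.
  by apply: EFin_inj; rewrite -hS// -(hT M mM).2.
exists (fun M => T M); split; last first.
  by move=> M mM u hu; rewrite /spectral_dist -/(rip K _ _) (hT M mM).2.
split.
- move=> M mM; split.
  + by auto.
  + by move=> c u v hu hv; rewrite sop_lin.
  + exact: (hT M mM).1.
  + by move=> u v hu hv; rewrite sop_ip.
- move=> u hu; rewrite -(uniq setT (sop1 K))//; split=> // v hv; exact: muT.
- move=> F mF tF u hu.
  have [S [h1 h2]] := represents_bigcup mF tF (fun n => hT _ (mF n)).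
  rewrite -(uniq _ S)//; [exact: h2|exact: bigcupT_measurable].
Qed.
End PVM.

(** * Operators of simple functions *)

Notation mT R := (measurableTypeR R).

Section RawIntegral.
Import HBNNSimple.
Variables (R : realType).
(** The integral is defined for any set function, and it only sees the values on
    measurable sets.  This links the integrals against [spectral_dist], which is
    not declared a measure, to integrals against measures. *)
Lemma raw_integral_eq (m1 m2 : set (mT R) -> \bar R) (f : mT R -> \bar R) :
  (forall M, measurable M -> m1 M = m2 M) ->
  (\int[m1]_(x in setT) f x = \int[m2]_(x in setT) f x)%E.
Proof.
move=> m12.
have key (h : {nnsfun (mT R) >-> R}) : sintegral m1 h = sintegral m2 h.
  by apply: eq_fsbigr => r _; rewrite m12.
rewrite /integral; congr (ereal_sup _ - ereal_sup _)%E;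
  by apply/seteqP; split=> _ [h hf <-]; exists h.
Qed.
End RawIntegral.

Section Calculus.
Variables (R : realType) (V : lmodType R[i]) (K : hilb V).
Implicit Types (u v w : V) (S T P Q : sop K) (M N : set (mT R)).
Local Notation car := (carrier K).
Local Notation "<< u , v >>" := (rip K u v).
Local Notation "n[ u ]" := (hnorm K u).

Variable E : set R -> V -> V.
Hypothesis hE : projection_valued_measure K E.

Let pvmP M (mM : measurable M) : [/\ forall u, car u -> car (E M u),
  forall c u v, car u -> car v -> E M (c *: u + v) = c *: E M u + E M v,
  forall u, car u -> E M (E M u) = E M u
  & forall u v, car u -> car v -> << E M u, v >> = << u, E M v >>].
Proof.
case: hE => h _ _; have [h1 h2 h3 h4] := h M mM; split=> // u v hu hv.
by rewrite /rip h4.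
Qed.

(** The spectral projection as a [sop], the identity for sets that are not
    measurable. *)
Definition spr M : sop K := match pselect (measurable M) with
  | left mM => let: And4 h1 h2 _ h4 := pvmP mM in Sop h1 h2 h4
  | right _ => sop1 K
  end.

Lemma sprE M u : measurable M -> spr M u = E M u.
Proof. by move=> mM; rewrite /spr; case: pselect => // mM'; case: pvmP. Qed.

Lemma spr_idem M : idem (spr M).
Proof.
have [mM|nM] := pselect (measurable M); last by rewrite /spr; case: pselect.
by move=> u hu; rewrite !sprE//; have [_ _ -> //] := pvmP mM.
Qed.

Lemma sprT u : car u -> spr setT u = u.
Proof. by move=> hu; rewrite sprE//; case: hE => _ -> . Qed.

Lemma spr_bigcup (F : nat -> set (mT R)) u : (forall n, measurable (F n)) ->
  trivIset setT F -> car u ->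
  hcvg K (fun n => \sum_(i < n) spr (F i) u) (spr (\bigcup_n F n) u).
Proof.
move=> mF tF hu; rewrite sprE; last exact: bigcupT_measurable.
case: hE => _ _ /(_ F mF tF u hu) h.
rewrite (_ : (fun n => _) = (fun n => \sum_(i < n) E (F i) u))//.
by apply/funext => n; apply: eq_bigr => i _; rewrite sprE.
Qed.

(** For the empty set, countable additivity says that the multiples n w of
    w = E(empty) u converge. *)
Lemma spr0 u : car u -> spr set0 u = 0.
Proof.
move=> hu; set w := spr set0 u.
have cw : car w by rewrite /w.
have := @spr_bigcup (fun=> set0) u (fun=> measurable0) (@trivIset_set0 _ _ _) hu.
rewrite bigcup0//.
rewrite (_ : (fun n => _) = (fun n => n%:R *: w)); last first.
  by apply/funext => n; rewrite sumr_const card_ord scaler_nat.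
move=> h.
have h1 := hcvg_hnorm (fun n => carZ n%:R cw) cw h.
apply: (@hnorm_eq0 _ _ K) => //; apply/eqP/negPn/negP => w0.
have {}w0 : 0 < n[w] by rewrite lt_def w0 hnorm_ge0.
have /cvgrPdist_lt/(_ _ w0)[N _ hN] := h1.
have := hN (N + 2)%N (leq_addr _ _); rewrite /= hnormZ// -(rmorph_nat (real_complex R)).
have -> : complex.Re `|(N + 2)%:R%:C| = (N + 2)%:R :> R.
  by rewrite normc_def /= expr0n addr0 sqrtr_sqr ger0_norm.
rewrite distrC ger0_norm; last first.
  by rewrite subr_ge0 ler_peMl ?hnorm_ge0// (ler_nat _ 1) addn2.
rewrite natrD mulrDl; have : 0 <= N%:R * n[w] by rewrite mulr_ge0// hnorm_ge0.
by lra.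
Qed.

(** Replacing the vectors outside K by 0 makes the scalar set functions measures
    for every vector of V. *)
Definition inK u := if pselect (car u) then u else 0.
Lemma inK_car u : car (inK u).
Proof. by rewrite /inK; case: pselect => // _; exact: car0. Qed.
Lemma inK_id u : car u -> inK u = u.
Proof. by move=> hu; rewrite /inK; case: pselect. Qed.

Definition smeas u M : \bar R := (<< inK u, spr M (inK u) >>)%:E.

Let smeas0 u : smeas u set0 = 0%E.
Proof. by rewrite /smeas spr0 ?rip0r//; exact: inK_car. Qed.
Let smeas_ge0 u M : (0 <= smeas u M)%E.
Proof. by rewrite lee_fin; apply: idem_ge0; [exact: spr_idem|exact: inK_car]. Qed.
Let smeas_sigma u : semi_sigma_additive (smeas u).
Proof.
move=> F mF tF mUF; rewrite /smeas; set v := inK u; have hv : car v by exact: inK_car.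
rewrite (_ : (fun n => _) = (fun n => << v, \sum_(i < n) spr (F i) v >>%:E)); last first.
  apply/funext => n; rewrite rip_sumr//.
  by rewrite big_mkord -sumEFin.
apply: cvg_EFin; first exact: nearW.
rewrite (_ : _ \o _ = (fun n => << sop_sum (fun i => spr (F i)) n v, v >>)); last first.
  by apply/funext => n /=; rewrite ripC//; apply: car_sum => i _; auto.
rewrite ripC//; apply: hcvg_rip (spr_bigcup mF tF hv) => // n.
exact: (sop_car (sop_sum (fun i => spr (F i)) n)).
Qed.
HB.instance Definition _ u := isMeasure.Build _ _ _ (smeas u)
  (smeas0 u) (smeas_ge0 u) (@smeas_sigma u).

Lemma smeasE u M : car u -> smeas u M = << u, spr M u >>%:E.
Proof. by move=> hu; rewrite /smeas inK_id. Qed.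
Lemma smeasT u : car u -> smeas u setT = << u, u >>%:E.
Proof. by move=> hu; rewrite smeasE// sprT. Qed.

Lemma spectral_dist_smeas u M : car u -> measurable M -> spectral_dist K E u M = smeas u M.
Proof. by move=> hu mM; rewrite smeasE// sprE. Qed.

Lemma integral_dist u (f : mT R -> \bar R) : car u ->
  (\int[spectral_dist K E u]_(x in setT) f x = \int[smeas u]_x f x)%E.
Proof. by move=> hu; apply: raw_integral_eq => M mM; exact: spectral_dist_smeas. Qed.

(** Orthogonality is not an axiom of projection-valued measures; it follows from
    additivity by [idem_disj]. *)
Lemma spr_disj M N u : measurable M -> measurable N -> M `&` N = set0 -> car u ->
  spr M (spr N u) = 0.
Proof.
move=> mM mN MN hu; apply: idem_disj => //; try exact: spr_idem.
move=> v hv; rewrite -lee_fin EFinD -!smeasE// -smeasT// -measureU//.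
by apply: le_measure; rewrite ?inE//; exact: measurableU.
Qed.

Lemma spr_sub M N u : measurable M -> measurable N -> M `<=` N -> car u ->
  spr N (spr M u) = spr M u.
Proof.
move=> mM mN MN hu; apply: idem_le => //; try exact: spr_idem.
move=> v hv; rewrite -lee_fin -!smeasE//.
by apply: le_measure; rewrite ?inE.
Qed.

Lemma sprU M N u : measurable M -> measurable N -> M `&` N = set0 -> car u ->
  spr (M `|` N) u = spr M u + spr N u.
Proof.
move=> mM mN MN hu.
pose S := sop_sum (fun i => if i == 0%N then spr M else spr N) 2.
have SE v : S v = spr M v + spr N v by rewrite /S/= big_ord_recr big_ord1.
rewrite -SE; apply: sop_form_eq => // v hv; rewrite SE ripDr//.
by apply: EFin_inj; rewrite EFinD -!smeasE// -measureU.
Qed.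

Lemma sprI M N u : measurable M -> measurable N -> car u ->
  spr M (spr N u) = spr (M `&` N) u.
Proof.
move=> mM mN hu; have mI := measurableI _ _ mM mN; have mD := measurableD mN mM.
rewrite -[N in LHS](setUIDK N M) sprU//; [|exact: measurableI|]; last first.
  by rewrite setDE setIACA setICr setI0.
rewrite sopD// (@spr_disj M (N `\` M))//; last by rewrite setDE setICA setICr setI0.
by rewrite addr0 setIC spr_sub//; apply: measurableI.
Qed.

Import HBNNSimple.
Implicit Types (g h : {nnsfun (mT R) >-> R}).

Let simpf g u := \sum_(c <- fset_set (range g)) c%:C *: spr (g @^-1` [set c]) u.
Let simpf_car g u : car u -> car (simpf g u).
Proof. by move=> hu; apply: car_sum => i _; auto. Qed.
Let simpf_lin g c u v : car u -> car v ->
  simpf g (c *: u + v) = c *: simpf g u + simpf g v.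
Proof.
move=> hu hv; rewrite /simpf scaler_sumr -big_split; apply: eq_bigr => i _.
by rewrite sop_lin// scalerDr !scalerA mulrC.
Qed.
Let simpf_sym g u v : car u -> car v -> << simpf g u, v >> = << u, simpf g v >>.
Proof.
move=> hu hv; rewrite rip_suml; [|by auto..]; rewrite rip_sumr; [|by auto..].
by apply: eq_bigr => i _; rewrite ripZl// ripZr// sop_sym.
Qed.
Definition simpop g : sop K :=
  locked (Sop (@simpf_car g) (@simpf_lin g) (@simpf_sym g)).

Lemma simpopE g u :
  simpop g u = \sum_(c <- fset_set (range g)) c%:C *: spr (g @^-1` [set c]) u.
Proof. by rewrite /simpop -lock. Qed.

Lemma nnsfun_sumE g x :
  g x = \sum_(c <- fset_set (range g)) c * \1_(g @^-1` [set c]) x.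
Proof. by rewrite {1}fimfunE fsbig_finite. Qed.

(** The product formula (E(M) E(N) u, u) = mu_u (M cap N), summed over the values of
    g and h. *)
Lemma simpop_form2 g h u : car u ->
  (<< u, simpop g (simpop h u) >>%:E = \int[smeas u]_x (g x * h x)%:E)%E.
Proof.
move=> hu; rewrite [simpop g _]simpopE rip_sumr//.
pose f (p : R * R) (x : mT R) : \bar R := ((p.1 * \1_(g @^-1` [set p.1]) x) *
  (p.2 * \1_(h @^-1` [set p.2]) x))%:E.
have f0 p x : (0 <= f p x)%E.
  have k (q : {nnsfun (mT R) >-> R}) r : 0 <= r * \1_(q @^-1` [set r]) x.
    rewrite indicE; case: (boolP (x \in _)); last by rewrite mulr0.
    by rewrite inE /= => <-; rewrite mulr1.
  by rewrite lee_fin mulr_ge0.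
have mf p : measurable_fun setT (f p).
  by apply/measurable_EFinP; apply: measurable_funM; apply: measurable_funM.
have fint p : (\int[smeas u]_x f p x =
    (p.1 * p.2 * << u, spr (g @^-1` [set p.1]) (spr (h @^-1` [set p.2]) u) >>)%:E)%E.
  set A := g @^-1` _; set B := h @^-1` _.
  have fE : f p = fun x => ((p.1 * p.2) * \1_(A `&` B) x)%:E.
    by apply/funext => x; rewrite /f -/A -/B indicI mulrACA.
  have mA : measurable A by rewrite /A.
  have mB : measurable B by rewrite /B.
  have mAB : measurable (A `&` B) by apply: measurableI.
  rewrite fE (integralZl_indic _ (fun=> A `&` B))//.
    by rewrite integral_indic// setIT sprI// [RHS]EFinM -(smeasE (A `&` B) hu).
  move=> p0; rewrite -subset0 => x [/= gx hx].
  by move: p0; rewrite -gx -hx ltNge mulr_ge0.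
pose s := [seq (c, d) | c <- fset_set (range g), d <- fset_set (range h)].
rewrite (_ : (fun x => _) = (fun x => \sum_(p <- s) f p x)%E); last first.
  apply/funext => x; rewrite /f sumEFin big_allpairs_dep /=; congr (_%:E).
  rewrite (nnsfun_sumE g) (nnsfun_sumE h) big_distrl /=; apply: eq_bigr => c _.
  by rewrite big_distrr.
rewrite ge0_integral_sum// (eq_bigr _ (fun p _ => fint p)) sumEFin big_allpairs_dep/=.
congr (_%:E); apply: eq_bigr => c _.
rewrite ripZr//.
rewrite -sop_sym// simpopE rip_sumr// big_distrr; apply: eq_bigr => d _.
by rewrite /= ripZr// sop_sym// mulrA.
Qed.

Lemma simpop_comm g h u : car u -> simpop g (simpop h u) = simpop h (simpop g u).
Proof.
move=> hu.
have sE q M (w : V) : car w -> spr M (simpop q w) =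
    \sum_(c <- fset_set (range q)) c%:C *: spr M (spr (q @^-1` [set c]) w).
  move=> hw; rewrite simpopE; elim: (fset_set _ : seq R) => [|c s IH].
    by rewrite !big_nil sop0.
  by rewrite !big_cons sopD ?IH ?sopZ//; apply: car_sum.
rewrite [LHS]simpopE [RHS]simpopE.
under eq_bigr do rewrite sE// scaler_sumr.
rewrite exchange_big; apply: eq_bigr => d _.
rewrite sE// scaler_sumr; apply: eq_bigr => c _.
by rewrite !scalerA mulrC !sprI// setIC.
Qed.

Lemma simpop_form g u : car u -> (<< u, simpop g u >>%:E = \int[smeas u]_x (g x)%:E)%E.
Proof.
move=> hu; rewrite integralT_nnsfun sintegralE fsbig_finite//=.
rewrite simpopE rip_sumr; [|by auto..].
by rewrite -sumEFin; apply: eq_bigr => c _; rewrite ripZr// EFinM smeasE.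
Qed.

(** Both sides have the same quadratic form; the left one is symmetric since the
    two factors commute. *)
Lemma simpop_mul g h u : car u -> simpop g (simpop h u) = simpop (mul_nnsfun g h) u.
Proof.
move=> hu.
pose gh : sop K := @Sop _ _ K (fun v => simpop g (simpop h v))
  (fun v hv => sop_car _ (sop_car _ hv))
  (fun c v w hv hw => etrans (congr1 (simpop g) (sop_lin (simpop h) c hv hw))
     (sop_lin (simpop g) c (sop_car _ hv) (sop_car _ hw)))
  (fun v w hv hw => etrans (sop_sym (simpop g) (sop_car _ hv) hw)
     (etrans (sop_sym (simpop h) hv (sop_car _ hw))
        (congr1 (rip K v) (simpop_comm h g hw)))).
apply: (@sop_form_eq _ _ _ gh) => // v hv; rewrite /gh /=.
by apply: EFin_inj; rewrite simpop_form2// simpop_form.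
Qed.

Lemma simpop_norm g u : car u -> (<< simpop g u, simpop g u >>%:E = \int[smeas u]_x (g x ^+ 2)%:E)%E.
Proof. by move=> hu; rewrite sop_sym// simpop_form2. Qed.

End Calculus.

(** * Operators of nonnegative Borel functions *)

Section Limits.
Variable R : realType.
Lemma Rcvg_eq (a b : nat -> R) (l m : R) : a @ \oo --> l -> b @ \oo --> m ->
  (forall n, a n = b n) -> l = m.
Proof. by move=> ha hb /funext ab; rewrite ab in ha; exact: cvg_unique ha hb. Qed.
Lemma Ecvg_eq (a : nat -> \bar R) (b : nat -> R) (l : \bar R) (m : R) :
  a @ \oo --> l -> b @ \oo --> m -> (forall n, a n = (b n)%:E) -> m%:E = l.
Proof.
move=> ha hb /funext ab; rewrite ab in ha; apply: cvg_unique ha => //.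
by apply: cvg_EFin; [exact: nearW|exact: hb].
Qed.
End Limits.

Section FormUnique.
Variables (R : realType) (V : lmodType R[i]) (K : hilb V).
Implicit Types (u v w : V) (D : set V) (t : V -> V).
Local Notation car := (carrier K).
Local Notation "<< u , v >>" := (rip K u v).
Local Notation "n[ u ]" := (hnorm K u).

Lemma rip_il u v : car u -> car v -> << 'i%C *: u, v >> = - << u, 'i%C *: v >>.
Proof.
move=> hu hv; rewrite /rip (ipC hv (carZ _ hu)) !ipZr// (ipC hu hv).
by case: (ip K u v) => x y /=; ring.
Qed.

Lemma sop_im0 (T : sop K) u : car u -> << u, 'i%C *: T u >> = 0.
Proof.
move=> hu; have h1 : << u, 'i%C *: T u >> = << 'i%C *: u, T u >>.
  by rewrite -sopZ// -sop_sym// ripC.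
by have := rip_il hu (sop_car T hu); rewrite -h1; lra.
Qed.

Lemma hdense_rip0 D w : hdense K D -> D `<=` car -> car w ->
  (forall v, D v -> << w, v >> = 0) -> w = 0.
Proof.
move=> dD Dc hw h; apply: (@hnorm_eq0 _ _ K) => //; apply/eqP/negPn/negP => w0.
have {}w0 : 0 < n[w] by rewrite lt_def w0 hnorm_ge0.
have [v Dv] := dD w hw _ w0; apply/negP; rewrite -leNgt.
have hv := Dc _ Dv; have h0 := h _ Dv.
rewrite hnorm_le// ripBr// !ripBl// (ripC hv hw) h0.
by have := rip_ge0 hv; lra.
Qed.

(** Over complex scalars an operator with real quadratic form is symmetric: apply
    the polarized identity to u and v, and to u and i v. *)
Lemma real_form_sym D t : is_subspace D -> D `<=` car -> (forall u, D u -> car (t u)) ->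
  (forall c u v, D u -> D v -> t (c *: u + v) = c *: t u + t v) ->
  (forall u, D u -> << u, 'i%C *: t u >> = 0) ->
  forall u v, D u -> D v -> << t u, v >> = << u, t v >>.
Proof.
move=> [D0 DP] Dc tc tl t0.
have DD u v : D u -> D v -> D (u + v) by move=> hu hv; rewrite -[u]scale1r; exact: DP.
have DZ c u : D u -> D (c *: u) by move=> hu; rewrite -[_ *: _]addr0; exact: DP.
have tD u v : D u -> D v -> t (u + v) = t u + t v.
  by move=> hu hv; rewrite -[u in LHS]scale1r tl// scale1r.
have tZ c u : D u -> t (c *: u) = c *: t u.
  move=> hu; have t00 : t 0 = 0.
    have := tl (-1) 0 0 D0 D0; rewrite scaler0 addr0 scaleN1r addNr; by [].
  by have := tl c u 0 hu D0; rewrite !addr0 t00 addr0.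
have key u v : D u -> D v -> << u, 'i%C *: t v >> + << v, 'i%C *: t u >> = 0.
  move=> hu hv; have cu := Dc _ hu; have cv := Dc _ hv.
  have ctu := tc _ hu; have ctv := tc _ hv.
  have := t0 _ (DD _ _ hu hv); rewrite tD// scalerDr !ripDr// !ripDl// !t0//; lra.
move=> u v hu hv; have cu := Dc _ hu; have cv := Dc _ hv.
have ctu := tc _ hu; have ctv := tc _ hv.
have := key u ('i%C *: v) hu (DZ _ _ hv).
rewrite tZ// scalerA -expr2 sqr_i scaleN1r ripNr// rip_il// scalerA -expr2 sqr_i.
by rewrite scaleN1r ripNr// opprK (ripC cv ctu); lra.
Qed.

(** Polarization on a dense domain: the difference of the two operators is
    orthogonal to it. *)
Lemma form_unique D t t' : is_subspace D -> D `<=` car -> hdense K D ->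
  (forall u, D u -> car (t u)) -> (forall u, D u -> car (t' u)) ->
  (forall u v, D u -> D v -> t (u + v) = t u + t v) ->
  (forall u v, D u -> D v -> t' (u + v) = t' u + t' v) ->
  (forall u v, D u -> D v -> << t u, v >> = << u, t v >>) ->
  (forall u v, D u -> D v -> << t' u, v >> = << u, t' v >>) ->
  (forall u, D u -> << u, t u >> = << u, t' u >>) ->
  forall u, D u -> t u = t' u.
Proof.
move=> [D0 DP] Dc Dd tc tc' tD tD' ts ts' tt u hu.
have DD w v : D w -> D v -> D (w + v) by move=> hw hv; rewrite -[w]scale1r; exact: DP.
apply/eqP; rewrite -subr_eq0; apply/eqP.
have ctu := tc _ hu; have ctu' := tc' _ hu.
apply: (hdense_rip0 Dd) => // v hv; have cu := Dc _ hu; have cv := Dc _ hv.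
have ctv := tc _ hv; have ctv' := tc' _ hv.
rewrite ripBl//; have := tt _ (DD _ _ hu hv); rewrite tD// tD'// !ripDr// !ripDl//.
rewrite (tt _ hu) (tt _ hv) -(ts u v)// -(ts' u v)//.
by rewrite (ripC cv ctu) (ripC cv ctu'); lra.
Qed.
End FormUnique.

Record nnmfun (R : realType) := NNMFun { nnmf :> mT R -> R;
  nnmf_ge0 : forall x, 0 <= nnmf x;
  nnmf_meas : measurable_fun setT nnmf }.

Section Functional.
Variables (R : realType) (V : lmodType R[i]) (K : hilb V).
Implicit Types (u v w : V) (S T P Q : sop K) (M N : set (mT R)) (f g h : nnmfun R).
Local Notation car := (carrier K).
Local Notation "<< u , v >>" := (rip K u v).
Local Notation "n[ u ]" := (hnorm K u).

Variable E : set R -> V -> V.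
Hypothesis hE : projection_valued_measure K E.
Import HBNNSimple.
Local Notation sm u := (smeas hE u).
Local Notation So := (simpop hE).

Lemma mono_int u (a : nat -> mT R -> R) (l : mT R -> R) :
  (forall n, measurable_fun setT (a n)) -> (forall n x, 0 <= a n x) ->
  (forall x, {homo a ^~ x : m n / (m <= n)%N >-> m <= n}) ->
  (forall x, a ^~ x @ \oo --> l x) ->
  ((fun n => \int[sm u]_x (a n x)%:E) @ \oo --> \int[sm u]_x (l x)%:E)%E.
Proof.
move=> ma a0 nda cva.
have -> : (fun x => (l x)%:E) = (fun x => limn (fun n => (a n x)%:E)).
  apply/funext => x; apply/esym/cvg_lim => //.
  by apply: cvg_EFin; [exact: nearW|exact: cva].
apply: cvg_monotone_convergence => //.
- by move=> n; exact/measurable_EFinP.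
- by move=> n x _; rewrite lee_fin.
- by move=> x _ m n mn; rewrite lee_fin nda.
Qed.

(** If E(N) u = u, then the measure of u is carried by N. *)
Lemma full_int_eq N u (a b : mT R -> R) : measurable N -> car u -> spr hE N u = u ->
  measurable_fun setT a -> measurable_fun setT b ->
  (forall x, 0 <= a x) -> (forall x, 0 <= b x) -> (forall x, N x -> a x = b x) ->
  (\int[sm u]_x (a x)%:E = \int[sm u]_x (b x)%:E)%E.
Proof.
move=> mN hu Nu ma mb a0 b0 ab; apply: ge0_ae_eq_integral => //.
- exact/measurable_EFinP.
- exact/measurable_EFinP.
- by move=> x _; rewrite lee_fin.
- by move=> x _; rewrite lee_fin.
exists (~` N); split; first exact: measurableC.
  rewrite /= (smeasE hE _ hu) -Nu (spr_disj hE)//; first by rewrite rip0r.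
  - exact: measurableC.
  - exact: setICl.
move=> x /= /not_implyP[_ nab] Nx; apply: nab; by rewrite ab.
Qed.

Definition apx f (n : nat) : {nnsfun (mT R) >-> R} :=
  nnsfun_approx measurableT ((measurable_EFinP setT f).2 (nnmf_meas f)) n.

Lemma apx_nd f x : {homo (fun n => apx f n x) : m n / (m <= n)%N >-> m <= n}.
Proof. by move=> m n mn; exact/lefP/nd_nnsfun_approx. Qed.

Lemma apx_cvg f x : (fun n => apx f n x) @ \oo --> f x.
Proof.
have h : (fun n => (apx f n x)%:E) @ \oo --> (f x)%:E.
  apply: (@cvg_nnsfun_approx _ _ _ setT measurableT (EFin \o f)) => // y _.
  by rewrite lee_fin nnmf_ge0.
by have /fine_cvgP[] := h.
Qed.

Lemma simpop_bound (q : {nnsfun (mT R) >-> R}) :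
  exists C, forall v, car v -> n[So q v] <= C * n[v].
Proof.
have spb M v : car v -> n[spr hE M v] <= n[v].
  move=> hv; rewrite hnorm_le// sop_sym// (spr_idem hE)//.
  have [mM|nM] := pselect (measurable M); last by rewrite /spr; case: pselect.
  rewrite -lee_fin -(smeasE hE M hv) -(smeasT hE hv).
  by apply: le_measure; rewrite ?inE.
exists (\sum_(c <- fset_set (range q)) `|c|) => v hv; rewrite simpopE.
elim: (fset_set _ : seq R) => [|c s IH]; first by rewrite !big_nil hnorm0 mul0r.
rewrite !big_cons mulrDl; apply: le_trans (hnormD _ _) _ => //.
  by apply: car_sum => i _.
by apply: lerD => //; rewrite hnormZr// ler_wpM2l// spb.
Qed.

Lemma simpop_cvg (q : {nnsfun (mT R) >-> R}) (x : nat -> V) l :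
  (forall n, car (x n)) -> car l -> hcvg K x l -> hcvg K (fun n => So q (x n)) (So q l).
Proof.
move=> cx cl; have [C hC] := simpop_bound q.
by apply: (@hcvg_le _ _ _ _ _ _ _ C) => n; rewrite -sopB//; apply: hC.
Qed.

Definition fdom f : set V := [set u | car u /\ (\int[sm u]_x ((f x) ^+ 2)%:E < +oo)%E].
Definition fcalc f u : V := xget 0 [set l | car l /\ hcvg K (fun n => So (apx f n) u) l].

Lemma fdom_car f : fdom f `<=` car. Proof. by move=> u []. Qed.

Lemma apx_norm_cvg f u : car u ->
  ((fun n => << So (apx f n) u, So (apx f n) u >>%:E) @ \oo --> \int[sm u]_x ((f x) ^+ 2)%:E)%E.
Proof.
move=> hu; under eq_fun do rewrite simpop_norm//.
apply: (@mono_int u (fun n x => apx f n x ^+ 2)).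
- by move=> n; apply: measurable_funX.
- by move=> n x; exact: sqr_ge0.
- by move=> x m n mn; rewrite lerXn2r ?nnegrE// apx_nd.
- by move=> x; rewrite expr2; under eq_fun do rewrite expr2; apply: cvgM; exact: apx_cvg.
Qed.

Lemma apx_norm_nd f u : car u ->
  {homo (fun n => << So (apx f n) u, So (apx f n) u >>) : m n / (m <= n)%N >-> m <= n}.
Proof.
move=> hu m n mn; rewrite -lee_fin !simpop_norm//; apply: ge0_le_integral => //.
- by move=> x _; rewrite lee_fin sqr_ge0.
- by apply/measurable_EFinP; apply: measurable_funX.
- by apply/measurable_EFinP; apply: measurable_funX.
- by move=> x _; rewrite lee_fin lerXn2r ?nnegrE// apx_nd.
Qed.

Lemma apx_norm_le f u n : car u ->
  (<< So (apx f n) u, So (apx f n) u >>%:E <= \int[sm u]_x ((f x) ^+ 2)%:E)%E.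
Proof.
move=> hu; have h := @apx_norm_cvg f u hu.
rewrite -(cvg_lim _ h)//; apply: lime_ge.
  by apply/cvg_ex; eexists; exact: h.
by exists n => // m /= nm; rewrite lee_fin; exact: apx_norm_nd.
Qed.

(** Since 0 <= f_m <= f_n for the approximations of f,
    (f_n - f_m)^2 <= f_n^2 - f_m^2; hence the convergence of the norms forces the
    vectors to form a Cauchy sequence. *)
Lemma apx_diff f u m n : car u -> (m <= n)%N ->
  << So (apx f m) u - So (apx f n) u, So (apx f m) u - So (apx f n) u >> <=
  << So (apx f n) u, So (apx f n) u >> - << So (apx f m) u, So (apx f m) u >>.
Proof.
move=> hu mn; rewrite ripBr// !ripBl//.
rewrite (ripC (sop_car (So (apx f n)) hu) (sop_car (So (apx f m)) hu)).
suff : << So (apx f m) u, So (apx f m) u >> <= << So (apx f m) u, So (apx f n) u >> by lra.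
rewrite -lee_fin simpop_norm// sop_sym// simpop_form2//; apply: ge0_le_integral => //.
- by move=> x _; rewrite lee_fin sqr_ge0.
- by apply/measurable_EFinP; apply: measurable_funX.
- by apply/measurable_EFinP; apply: measurable_funM.
- by move=> x _; rewrite lee_fin expr2 ler_wpM2l// apx_nd.
Qed.

Lemma fcalcP f u : fdom f u -> car (fcalc f u) /\ hcvg K (fun n => So (apx f n) u) (fcalc f u).
Proof.
move=> [hu If].
have [|||l cl hl] := @increment_cvg _ _ K (fun n => So (apx f n) u)
  (fun n => << So (apx f n) u, So (apx f n) u >>) (fine (\int[sm u]_x ((f x) ^+ 2)%:E)%E).
- by move=> n.
- move=> n; rewrite -lee_fin fineK ?apx_norm_le// ge0_fin_numE//.
  by apply: integral_ge0 => x _; rewrite lee_fin sqr_ge0.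
- by move=> m n; exact: apx_diff.
apply: (@xgetPex _ 0 [set l | car l /\ hcvg K (fun n => So (apx f n) u) l]).
by exists l.
Qed.

Lemma fcalc_car f u : fdom f u -> car (fcalc f u).
Proof. by move=> /fcalcP[]. Qed.

(** A uniform bound along the approximations is a convenient criterion for
    membership, since the integral of f^2 is the limit of their squared norms. *)
Lemma fdom_bounded f u C : car u -> (forall n, n[So (apx f n) u] <= C) -> fdom f u.
Proof.
move=> hu h; split=> //; apply: (@le_lt_trans _ _ (C ^+ 2)%:E); last exact: ltry.
have hc := @apx_norm_cvg f u hu; rewrite -(cvg_lim _ hc)//; apply: lime_le.
  by apply/cvg_ex; eexists; exact: hc.
apply: nearW => n; rewrite lee_fin -hnorm2// lerXn2r ?nnegrE ?hnorm_ge0//.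
exact: le_trans (hnorm_ge0 _ _) (h 0%N).
Qed.

Lemma fcalc_norm f u : fdom f u ->
  (<< fcalc f u, fcalc f u >>%:E = \int[sm u]_x ((f x) ^+ 2)%:E)%E.
Proof.
move=> hf; have [hl hc] := fcalcP hf; have hu := fdom_car hf.
have h := @apx_norm_cvg f u hu; by apply: Ecvg_eq h (hcvg_rip2 _ hl hc) _ => // n; auto.
Qed.

Lemma fcalc_bound f u n : fdom f u -> n[So (apx f n) u] <= n[fcalc f u].
Proof.
move=> hf; have hu := fdom_car hf; have cf := fcalc_car hf.
by rewrite hnorm_le// -lee_fin fcalc_norm//; exact: apx_norm_le.
Qed.

Lemma fdom_subspace f : is_subspace (fdom f).
Proof.
split.
  apply: (@fdom_bounded _ _ 0); first exact: car0.
  by move=> n; rewrite sop0 hnorm0.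
move=> c u v hu hv; have cu := fdom_car hu; have cv := fdom_car hv.
apply: (@fdom_bounded _ _ (complex.Re `|c| * n[fcalc f u] + n[fcalc f v])) => // n.
rewrite sop_lin//; apply: le_trans (hnormD _ _) _ => //; apply: lerD.
  by rewrite hnormZ// ler_wpM2l ?fcalc_bound// normc_def sqrtr_ge0.
exact: fcalc_bound.
Qed.

Lemma fcalc_lin f c u v : fdom f u -> fdom f v ->
  fcalc f (c *: u + v) = c *: fcalc f u + fcalc f v.
Proof.
move=> hu hv; have [cl hl] := fcalcP hu; have [cm hm] := fcalcP hv.
have cu := fdom_car hu; have cv := fdom_car hv.
have [_ /(_ c u v hu hv) hw] := fdom_subspace f; have [ck hk] := fcalcP hw.
apply: (hcvg_unique _ _ _ hk) => //.
rewrite (_ : (fun n => _) = (fun n => c *: So (apx f n) u + So (apx f n) v)); last first.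
  by apply/funext => n; rewrite sop_lin.
by apply: (@hcvgD _ _ K (fun n => c *: So (apx f n) u)) => //; apply: hcvgZ.
Qed.

Lemma fcalc_form2 (q : {nnsfun (mT R) >-> R}) f u : fdom f u ->
  (<< u, So q (fcalc f u) >>%:E = \int[sm u]_x (q x * f x)%:E)%E.
Proof.
move=> hf; have [hl hc] := fcalcP hf; have hu := fdom_car hf.
have h : ((fun n => \int[sm u]_x (q x * apx f n x)%:E) @ \oo --> \int[sm u]_x (q x * f x)%:E)%E.
  apply: (@mono_int u (fun n x => q x * apx f n x)).
  - by move=> n; apply: measurable_funM.
  - by move=> n x; rewrite mulr_ge0.
  - by move=> x m n mn; rewrite ler_wpM2l// apx_nd.
  - by move=> x; apply: cvgMr; exact: apx_cvg.
rewrite ripC//; apply: Ecvg_eq h (hcvg_rip _ _ hu (simpop_cvg q _ hl hc)) _ => // n.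
by rewrite ripC// simpop_form2.
Qed.

Lemma fcalc_form f u : fdom f u -> (<< u, fcalc f u >>%:E = \int[sm u]_x (f x)%:E)%E.
Proof.
move=> hf; have [hl hc] := fcalcP hf; have hu := fdom_car hf.
have h : ((fun n => \int[sm u]_x (apx f n x)%:E) @ \oo --> \int[sm u]_x (f x)%:E)%E.
  apply: (@mono_int u (fun n x => apx f n x)) => //.
  - by move=> x m n mn; rewrite apx_nd.
  - by move=> x; exact: apx_cvg.
rewrite ripC//; apply: Ecvg_eq h (hcvg_rip _ hl hu hc) _ => // n.
by rewrite ripC// simpop_form.
Qed.

Lemma fcalc_sym f u v : fdom f u -> fdom f v -> << fcalc f u, v >> = << u, fcalc f v >>.
Proof.
move=> hu hv; have [cl hl] := fcalcP hu; have [cm hm] := fcalcP hv.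
have cu := fdom_car hu; have cv := fdom_car hv.
have h1 : (fun n => << So (apx f n) u, v >>) @ \oo --> << fcalc f u, v >> by apply: hcvg_rip.
have h2 : (fun n => << So (apx f n) v, u >>) @ \oo --> << fcalc f v, u >> by apply: hcvg_rip.
by rewrite [RHS]ripC//; apply: Rcvg_eq h1 h2 _ => n; rewrite sop_sym// ripC.
Qed.

Lemma fcalc_im0 f u : fdom f u -> << u, 'i%C *: fcalc f u >> = 0.
Proof.
move=> hu; have [cl hl] := fcalcP hu; have cu := fdom_car hu.
have h : (fun n => << 'i%C *: So (apx f n) u, u >>) @ \oo --> << 'i%C *: fcalc f u, u >>.
  by apply: hcvg_rip => //; apply: hcvgZ.
by rewrite ripC//; apply: Rcvg_eq h (cvg_cst 0) _ => n; rewrite ripC// sop_im0.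
Qed.

(** The measure of f(A) u has density f^2 with respect to the measure of u.  Two
    passages to the limit, first in f for simple q, then in g. *)
Lemma fcalc_comp_norm f g u : fdom f u ->
  (\int[sm (fcalc f u)]_x ((g x) ^+ 2)%:E = \int[sm u]_x ((g x * f x) ^+ 2)%:E)%E.
Proof.
move=> hf; have [hl hc] := fcalcP hf; have hu := fdom_car hf; set w := fcalc f u.
have key (q : {nnsfun (mT R) >-> R}) :
    (<< So q w, So q w >>%:E = \int[sm u]_x ((q x * f x) ^+ 2)%:E)%E.
  have h : ((fun n => \int[sm u]_x ((q x * apx f n x) ^+ 2)%:E) @ \oo -->
      \int[sm u]_x ((q x * f x) ^+ 2)%:E)%E.
    apply: (@mono_int u (fun n x => (q x * apx f n x) ^+ 2)).
    - by move=> n; apply: measurable_funX; apply: measurable_funM.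
    - by move=> n x; rewrite sqr_ge0.
    - by move=> x m n mn; rewrite lerXn2r ?nnegrE ?mulr_ge0// ler_wpM2l// apx_nd.
    - move=> x; rewrite expr2; under eq_fun do rewrite expr2.
      by apply: cvgM; apply: cvgMr; exact: apx_cvg.
  apply: Ecvg_eq h (hcvg_rip2 _ _ (simpop_cvg q _ hl hc)) _ => // n.
  by rewrite simpop_mul// simpop_norm.
have h := @apx_norm_cvg g w hl; apply: (cvg_unique _ h) => //.
rewrite (_ : (fun n => _) =
  (fun n => \int[sm u]_x ((apx g n x * f x) ^+ 2)%:E)%E); last first.
  by apply/funext => n; rewrite key.
apply: (@mono_int u (fun n x => (apx g n x * f x) ^+ 2)).
- by move=> n; apply: measurable_funX; apply: measurable_funM => //; exact: nnmf_meas.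
- by move=> n x; rewrite sqr_ge0.
- by move=> x m n mn; rewrite lerXn2r ?nnegrE ?mulr_ge0 ?nnmf_ge0// ler_wpM2r ?nnmf_ge0// apx_nd.
- move=> x; rewrite expr2; under eq_fun do rewrite expr2.
  by apply: cvgM; apply: cvgMl; exact: apx_cvg.
Qed.

Lemma apx_le f n x : apx f n x <= f x.
Proof.
have h := @apx_cvg f x; rewrite -(cvg_lim _ h)//; apply: nondecreasing_cvgn_le.
  by move=> p q pq; exact: apx_nd.
by apply/cvg_ex; eexists; exact: h.
Qed.

Lemma fdom_cut f M C u : measurable M -> (forall x, M x -> f x <= C) -> car u ->
  fdom f (spr hE M u).
Proof.
move=> mM fC hu; have cM : car (spr hE M u) by [].
have C0 := normr_ge0 C.
apply: (@fdom_bounded _ _ (`|C| * n[spr hE M u])) => // n.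
rewrite -ler_sqr ?nnegrE ?mulr_ge0 ?hnorm_ge0// exprMn !hnorm2//.
rewrite -lee_fin simpop_norm// EFinM -(smeasT hE cM).
rewrite -integral_cst//; apply: ae_ge0_le_integral => //.
- by move=> x _; rewrite lee_fin sqr_ge0.
- by apply/measurable_EFinP; apply: measurable_funX.
- by move=> x _; rewrite lee_fin sqr_ge0.
exists (~` M); split; first exact: measurableC.
  rewrite /= (smeasE hE _ cM) (spr_disj hE)//; first by rewrite rip0r.
  - exact: measurableC.
  - exact: setICl.
move=> x /= /not_implyP[_ nab] Mx; apply: nab; rewrite lee_fin lerXn2r ?nnegrE//.
by apply: le_trans (apx_le _ _ _) _; apply: le_trans (fC x Mx) (ler_norm _).
Qed.

(** Continuity of the scalar measure along increasing sets, and
    ||E(M) u - u||^2 = (u, u) - (u, E(M) u). *)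
Lemma spr_cvg (M : nat -> set (mT R)) u : (forall n, measurable (M n)) ->
  (forall m n, (m <= n)%N -> M m `<=` M n) -> \bigcup_n M n = setT -> car u ->
  hcvg K (fun n => spr hE (M n) u) u.
Proof.
move=> mM nd MT hu.
have h : (fun n => << spr hE (M n) u, u >>) @ \oo --> << u, u >>.
  have hh : (sm u \o M) @ \oo --> sm u (\bigcup_n M n).
    apply: nondecreasing_cvg_mu => //; first exact: bigcupT_measurable.
    by move=> m n mn; apply/subsetPset; exact: nd.
  rewrite MT /= (smeasT hE hu) in hh.
  have /fine_cvgP[_] := hh.
  rewrite (_ : _ \o _ = (fun n => << spr hE (M n) u, u >>))//.
  apply/funext => n; apply: (etrans (congr1 fine (smeasE hE (M n) hu))).
  by rewrite /= ripC.
have h2 : (fun n => << u, u >> - << spr hE (M n) u, u >>) @ \oo --> (0 : R).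
  by rewrite -(subrr << u, u >>); apply: cvgB => //; exact: cvg_cst.
apply/hcvgP => e e0; have e2 : 0 < e ^+ 2 by rewrite exprn_gt0.
have /cvgrPdist_lt/(_ _ e2)[N _ hN] := h2; exists N => n Nn.
rewrite -ltr_sqr ?nnegrE ?hnorm_ge0 ?(ltW e0)// hnorm2//.
have := hN n Nn; rewrite sub0r normrN => hh; apply: le_lt_trans hh.
apply: le_trans (ler_norm _); rewrite ripBr// !ripBl//.
have -> : << spr hE (M n) u, spr hE (M n) u >> = << u, spr hE (M n) u >>.
  by rewrite sop_sym// (spr_idem hE).
by rewrite (ripC (sop_car (spr hE (M n)) hu) hu); lra.
Qed.

(** The vectors E(M_n) u with M_n the set where f and h are at most n lie in both
    domains and converge to u.  A common dense domain is what [form_unique] needs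
    to compare g(A) f(A) with h(A). *)
Lemma fdom_dense2 f h : hdense K (fdom f `&` fdom h).
Proof.
move=> u hu e e0.
pose M n : set (mT R) := [set x | f x <= n%:R] `&` [set x | h x <= n%:R].
have mle (q : nnmfun R) n : measurable ([set x | q x <= n%:R] : set (mT R)).
  rewrite -[X in measurable X]setTI; apply: measurable_fun_le => //; exact: nnmf_meas.
have mM n : measurable (M n) by apply: measurableI.
have hc : hcvg K (fun n => spr hE (M n) u) u.
  apply: spr_cvg => //.
- move=> m n mn x [fx hx]; split=> /=; [apply: le_trans fx _|apply: le_trans hx _];
  by rewrite ler_nat.
- apply/seteqP; split=> // x _; exists (Num.bound (f x + h x)) => //=.
  have f0 := nnmf_ge0 f x; have h0 := nnmf_ge0 h x.
  have := archi_boundP (addr_ge0 f0 h0); split=> /=; lra.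
have /hcvgP/(_ _ e0)[N hN] := hc.
exists (spr hE (M N) u); last by rewrite hnorm_distC// hN.
by split; apply: (@fdom_cut _ _ N%:R) => // x [].
Qed.

Lemma fdom_dense f : hdense K (fdom f).
Proof.
move=> u hu e e0; have [v [fv _] vu] := fdom_dense2 f f hu e0.
by exists v.
Qed.

(** The domains agree by [fcalc_comp_norm].  The operators agree because they are
    symmetric with equal quadratic forms on the common domain of f(A) and h(A),
    which is dense. *)
Lemma fcalc_comp N f g h u : measurable N -> (forall v, car v -> spr hE N v = v) ->
  (forall x, N x -> h x = g x * f x) -> fdom f u ->
  (fdom g (fcalc f u) <-> fdom h u) /\ (fdom h u -> fcalc g (fcalc f u) = fcalc h u).
Proof.
move=> mN fullN hgf hf.
have key v : fdom f v -> fdom g (fcalc f v) <-> fdom h v.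
  move=> hv; have cv := fdom_car hv; have cf := fcalc_car hv.
  rewrite /fdom /= fcalc_comp_norm//.
  rewrite (@full_int_eq N _ _ (fun x => h x ^+ 2))//; first by split=> -[].
  - exact: fullN.
  - by apply: measurable_funX; apply: measurable_funM; exact: nnmf_meas.
  - by apply: measurable_funX; exact: nnmf_meas.
  - by move=> x; rewrite sqr_ge0.
  - by move=> x; rewrite sqr_ge0.
  - by move=> x Nx; rewrite hgf.
split; [exact: key|move=> hh].
have [f0 fP] := fdom_subspace f; have [h0 hP] := fdom_subspace h.
have sub v : (fdom f `&` fdom h) v -> fdom g (fcalc f v) by move=> [fv hv]; apply/key.
have gsym (q : {nnsfun (mT R) >-> R}) v w : fdom f v -> fdom f w ->
    << So q (fcalc f v), w >> = << v, So q (fcalc f w) >>.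
  move=> hv hw; have [cfv hvc] := fcalcP hv; have [cfw hwc] := fcalcP hw.
  have cv := fdom_car hv; have cw := fdom_car hw.
  have h1 : (fun n => << So q (So (apx f n) v), w >>) @ \oo --> << So q (fcalc f v), w >>.
    by apply: hcvg_rip => //; apply: simpop_cvg.
  have h2 : (fun n => << So q (So (apx f n) w), v >>) @ \oo --> << So q (fcalc f w), v >>.
    by apply: hcvg_rip => //; apply: simpop_cvg.
  rewrite [RHS]ripC//; apply: Rcvg_eq h1 h2 _ => n.
  by rewrite sop_sym// sop_sym// simpop_comm// ripC.
apply: (@form_unique _ _ K (fdom f `&` fdom h) (fun v => fcalc g (fcalc f v)) (fcalc h)) => //.
- by split=> // c v w [fv hv] [fw hw]; split; [exact: fP|exact: hP].
- by move=> v [/fdom_car].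
- exact: fdom_dense2.
- by move=> v /sub/fcalc_car.
- by move=> v [_ /fcalc_car].
- move=> v w hv hw; rewrite -[v in LHS]scale1r fcalc_lin; [|by case: hv|by case: hw].
  by rewrite fcalc_lin ?scale1r//; exact: sub.
- move=> v w hv hw; rewrite -[v in LHS]scale1r fcalc_lin ?scale1r//; [by case: hv|by case: hw].
- move=> v w hv hw; have [cv hvc] := fcalcP (sub _ hv); have [cw hwc] := fcalcP (sub _ hw).
  have kv := fdom_car hv.1; have kw := fdom_car hw.1.
  have fv := fcalc_car hv.1; have fw := fcalc_car hw.1.
  have h1 := hcvg_rip (fun n => sop_car (So (apx g n)) fv) cv kw hvc.
  have h2 := hcvg_rip (fun n => sop_car (So (apx g n)) fw) cw kv hwc.
  rewrite [RHS]ripC//; apply: Rcvg_eq h1 h2 _ => n.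
  exact: etrans (gsym _ _ _ hv.1 hw.1) (ripC kv (sop_car _ fw)).
- by move=> v w [_ hv] [_ hw]; exact: fcalc_sym.
move=> v hv; have [cv hvc] := fcalcP (sub _ hv); have kv := fdom_car hv.1.
have fv := fcalc_car hv.1.
apply: EFin_inj; rewrite (fcalc_form hv.2).
have h1 := hcvg_rip (fun n => sop_car (So (apx g n)) fv) cv kv hvc.
have h2 : ((fun n => \int[sm v]_x (apx g n x * f x)%:E) @ \oo --> \int[sm v]_x (g x * f x)%:E)%E.
  apply: (@mono_int v (fun n x => apx g n x * f x)).
  - by move=> n; apply: measurable_funM => //; exact: nnmf_meas.
  - by move=> n x; rewrite mulr_ge0// nnmf_ge0.
  - by move=> x m n mn; rewrite ler_wpM2r ?nnmf_ge0// apx_nd.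
  - by move=> x; apply: cvgMl; exact: apx_cvg.
rewrite ripC//; rewrite (Ecvg_eq h2 h1); last first.
  by move=> n; rewrite ripC// fcalc_form2//; case: hv.
apply: (@full_int_eq N) => //.
- exact: fullN.
- by apply: measurable_funM; exact: nnmf_meas.
- exact: nnmf_meas.
- by move=> x; rewrite mulr_ge0 ?nnmf_ge0.
- by move=> x; exact: nnmf_ge0.
- by move=> x Nx; rewrite hgf.
Qed.

Definition fgraph f : operator V := [set p | fdom f p.1 /\ p.2 = fcalc f p.1].

Lemma dom_fgraph f : dom (fgraph f) = fdom f.
Proof.
by apply/seteqP; split=> [_ [[u w] [/= h _] <-] //|u hu]; exists (u, fcalc f u).
Qed.

Lemma fgraph_linear f : linear_operator K K (fgraph f).
Proof.
have [h0 hP] := fdom_subspace f; split.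
- move=> [u w] [/= hu ->]; split=> /=; [exact: fdom_car hu|exact: fcalc_car].
- split=> //=; have := fcalc_lin (-1) h0 h0; rewrite scaler0 addr0 scaleN1r addNr.
  by [].
- by move=> c [u w] [u' w'] [/= hu ->] [/= hu' ->]; split=> /=; [exact: hP|rewrite fcalc_lin].
- by move=> u w w' [_ /= ->] [_ /= ->].
Qed.

Lemma spectral_dom_fdom (q : R -> R) f : (forall x, f x = q x) ->
  spectral_integral_dom K E q = fdom f.
Proof.
move=> fq; have -> : q = f by apply/funext => x; rewrite fq.
by apply/seteqP; split=> u [hu h]; split=> //; move: h; rewrite (integral_dist hE).
Qed.

Lemma fgraph_spectral f : is_spectral_integral K E f (fgraph f).
Proof.
split; first exact: fgraph_linear.
  by rewrite dom_fgraph; apply/esym/spectral_dom_fdom.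
move=> u w [/= hu ->]; have cu := fdom_car hu; have cf := fcalc_car hu.
by rewrite (integral_dist hE)// -fcalc_form//= ip_ri// fcalc_im0// oppr0.
Qed.

(** The definition of a spectral integral prescribes a complex-valued equation, so
    that the form of T is real and T is symmetric by [real_form_sym]. *)
Lemma spectral_integral_unique f (T T' : operator V) : is_spectral_integral K E f T ->
  is_spectral_integral K E f T' -> T = T'.
Proof.
have key (S : operator V) : is_spectral_integral K E f S ->
    [/\ forall u w, S (u, w) -> fdom f u, forall u, fdom f u -> S (u, app S u)
      & forall u, fdom f u -> app S u = fcalc f u].
  move=> [[Sc S0 SP Sf] Sd Sq].
  have sdom : dom S = fdom f by rewrite Sd; exact: spectral_dom_fdom.
  have h1 u w : S (u, w) -> fdom f u by move=> h; rewrite -sdom; exists (u, w).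
  have h2 u : fdom f u -> S (u, app S u).
    rewrite -sdom => -[[u' w] h /= <-]; apply: (@xgetPex _ 0 [set w | S (u', w)]).
    by exists w.
  have ca u : fdom f u -> car (app S u) by move=> /h2/Sc[].
  have lin c u v : fdom f u -> fdom f v -> app S (c *: u + v) = c *: app S u + app S v.
    move=> hu hv; have [_ hP] := fdom_subspace f.
    exact: (Sf _ _ _ (h2 _ (hP c _ _ hu hv)) (SP c _ _ (h2 _ hu) (h2 _ hv))).
  have frm u : fdom f u -> << u, app S u >> = << u, fcalc f u >> /\
      << u, 'i%C *: app S u >> = 0.
    move=> hu; have := Sq _ _ (h2 _ hu); have cu := fdom_car hu; have cau := ca _ hu.
    rewrite (integral_dist hE)// -fcalc_form//= ip_ri//.
    by case=> -> /eqP; rewrite oppr_eq0 => /eqP.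
  split=> //; apply: (@form_unique _ _ K (fdom f)).
  - exact: fdom_subspace.
  - exact: fdom_car.
  - exact: fdom_dense.
  - exact: ca.
  - by move=> u; exact: fcalc_car.
  - by move=> u v hu hv; rewrite -[u in LHS]scale1r lin// scale1r.
  - by move=> u v hu hv; rewrite -[u in LHS]scale1r fcalc_lin// scale1r.
  - apply: (@real_form_sym _ _ K) => //; [exact: fdom_subspace|exact: fdom_car|].
    by move=> u /frm[].
  - by move=> u v hu hv; exact: fcalc_sym.
  - by move=> u /frm[].
move=> hT hT'; have [a1 a2 a3] := key _ hT; have [b1 b2 b3] := key _ hT'.
have [[_ _ _ Tf] _ _] := hT; have [[_ _ _ Tf'] _ _] := hT'.
apply/seteqP; split=> -[u w] h.
  have hu := a1 _ _ h; rewrite (Tf _ _ _ h (a2 _ hu)) a3// -b3//; exact: b2.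
have hu := b1 _ _ h; rewrite (Tf' _ _ _ h (b2 _ hu)) b3// -a3//; exact: a2.
Qed.
End Functional.

(** * The inverse of a self-adjoint operator A >= I *)

Section Inverse.
Variables (R : realType) (V : lmodType R[i]) (K : hilb V) (A : operator V).
Implicit Types (u v w : V).
Local Notation car := (carrier K).
Local Notation "<< u , v >>" := (rip K u v).
Local Notation "n[ u ]" := (hnorm K u).
Hypothesis Asa : selfadjoint K A.

Lemma sa_car u w : A (u, w) -> car u /\ car w.
Proof. by case: Asa => [[h _ _ _] _ _] /h[]. Qed.
Lemma sa_fun u w w' : A (u, w) -> A (u, w') -> w = w'.
Proof. by case: Asa => [[_ _ _ h] _ _]; exact: h. Qed.
Lemma sa_0 : A (0, 0).
Proof. by case: Asa => [[_ h _ _] _ _]. Qed.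
Lemma sa_lin c u w u' w' : A (u, w) -> A (u', w') -> A (c *: u + u', c *: w + w').
Proof. by case: Asa => [[_ _ h _] _ _] h1 h2; exact: (h c _ _ h1 h2). Qed.
Lemma sa_Z c u w : A (u, w) -> A (c *: u, c *: w).
Proof. by move=> h; have := sa_lin c h sa_0; rewrite !addr0. Qed.
Lemma sa_sub u w u' w' : A (u, w) -> A (u', w') -> A (u - u', w - w').
Proof.
by move=> h h'; have := sa_lin (-1) h' h; rewrite !scaleN1r ![- _ + _]addrC.
Qed.

Lemma sa_adj v w : car v -> car w ->
  (forall u z, A (u, z) -> << v, z >> = << w, u >>) -> A (v, w).
Proof.
move=> hv hw h; case: Asa => _ _ <-; split=> // u z uz.
have [hu hz] := sa_car uz; rewrite !ip_ri// (h _ _ uz); congr (Complex _ (- _)).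
by rewrite (h _ _ (sa_Z 'i%C uz)).
Qed.

Lemma sa_sym u w v z : A (u, w) -> A (v, z) -> << u, z >> = << w, v >>.
Proof.
case: Asa => _ _ {1}<- [_ _ h] vz; by rewrite /rip (h _ _ vz).
Qed.

Lemma sa_closed (x y : nat -> V) u w : (forall n, A (x n, y n)) -> car u -> car w ->
  hcvg K x u -> hcvg K y w -> A (u, w).
Proof.
move=> xy hu hw xu yw; apply: sa_adj => // v z vz; have [hv hz] := sa_car vz.
have cx n := (sa_car (xy n)).1; have cy n := (sa_car (xy n)).2.
apply: Rcvg_eq (hcvg_rip cx hu hz xu) (hcvg_rip cy hw hv yw) _ => n.
exact: sa_sym (xy n) vz.
Qed.

Hypothesis A_ge1 : ge_identity K A.

Lemma sa_ge1 u w : A (u, w) -> << u, u >> <= << u, w >>.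
Proof. by move=> /A_ge1; rewrite lecE => /andP[]. Qed.

Lemma sa_norm u w : A (u, w) -> n[u] <= n[w].
Proof.
move=> h; have [hu hw] := sa_car h; have := sa_ge1 h.
have := rip_le hu hw; rewrite -hnorm2// expr2.
have := hnorm_ge0 K u; rewrite le_eqVlt => /predU1P[<- _ _|u0 h1 h2]; first exact: hnorm_ge0.
by rewrite -(ler_pM2l u0); exact: le_trans h2 h1.
Qed.

(** As ||u|| <= ||A u||, the range is closed; a vector w orthogonal to it satisfies
    A w = 0 by self-adjointness, and therefore vanishes. *)
Lemma sa_ran : ran A = car.
Proof.
apply: (@closed_subspace_full _ _ K).
  split.
  - split; first by exists (0, 0) => //; exact: sa_0.
    move=> c _ _ [[u w] h <-] [[u' w'] h' <-].
    by exists (c *: u + u', c *: w + w') => //; exact: sa_lin.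
  - by move=> _ [[u w] /sa_car[_ h] <-].
  move=> x l hx cl xl.
  have /choice[y hy] : forall k, exists v, A (v, x k).
    by move=> k; have [[u w] h <-] := hx k; exists u.
  have cy k := (sa_car (hy k)).1; have cx k := (sa_car (hy k)).2.
  have [|m cm ym] := @hcauchy_cvg _ _ K y cy; last first.
    by exists (m, l) => //; exact: sa_closed hy cm cl ym xl.
  move=> e e0; have /hcvgP/(_ (e / 2))[|N hN] := xl; first by rewrite divr_gt0.
  exists N => p q Np Nq; apply: le_lt_trans (sa_norm (sa_sub (hy p) (hy q))) _.
  have := hnormBD (cx p) cl (cx q); have := hN _ Np; have := hN _ Nq.
  by rewrite (hnorm_distC (cx q) cl); lra.
move=> w hw h; apply: (@rip_eq0 _ _ K) => //; apply/eqP; rewrite eq_le rip_ge0// andbT.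
have : A (w, 0).
  apply: sa_adj => // u z uz; have [cu cz] := sa_car uz.
  by rewrite (rip0l cu); apply: h; exists (u, z).
by move=> /sa_ge1; rewrite rip0r.
Qed.

Let B u : V := xget 0 [set v | A (v, u)].
Let BP u : car u -> A (B u, u).
Proof.
rewrite -sa_ran => -[[v w] h /= <-]; apply: (@xgetPex _ 0 [set v | A (v, w)]).
by exists v.
Qed.
Let Binj0 u : A (u, 0) -> u = 0.
Proof.
move=> h; have [hu _] := sa_car h; apply: (@hnorm_eq0 _ _ K) => //.
apply/eqP; rewrite eq_le hnorm_ge0 andbT; have := sa_norm h.
by rewrite hnorm0.
Qed.
Let Buniq u v : A (v, u) -> B u = v.
Proof.
move=> h; have [_ hu] := sa_car h; have := sa_sub (BP hu) h.
by rewrite subrr => /Binj0/eqP; rewrite subr_eq0 => /eqP.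
Qed.
Let Bcar u : car u -> car (B u).
Proof. by move=> /BP/sa_car[]. Qed.
Let Blin c u v : car u -> car v -> B (c *: u + v) = c *: B u + B v.
Proof. by move=> hu hv; apply: Buniq; apply: sa_lin; exact: BP. Qed.
Let Bsym u v : car u -> car v -> << B u, v >> = << u, B v >>.
Proof. by move=> hu hv; exact: sa_sym (BP hu) (BP hv). Qed.
Definition sa_inv : sop K := Sop Bcar Blin Bsym.

Lemma sa_invP u : car u -> A (sa_inv u, u).
Proof. exact: BP. Qed.
Lemma sa_inv_uniq u v : A (v, u) -> sa_inv u = v.
Proof. exact: Buniq. Qed.
Lemma sa_inv_pos u : car u -> 0 <= << u, sa_inv u >>.
Proof.
move=> hu; have h := sa_invP hu; rewrite ripC//.
by apply: le_trans (sa_ge1 h); rewrite rip_ge0.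
Qed.
Lemma sa_inv_contr u : car u -> n[sa_inv u] <= n[u].
Proof. by move=> hu; exact: sa_norm (sa_invP hu). Qed.
Lemma sa_inv_inj u : car u -> sa_inv u = 0 -> u = 0.
Proof.
move=> hu h; have := sa_invP hu; rewrite h => h0; exact: sa_fun h0 sa_0.
Qed.
End Inverse.

Section Telescope.
Variable R : realType.
(** Cut [0, 1] into n equal pieces: the increments of D add up to at most
    (F 1 - F 0) / n. *)
Lemma telescope_const (D F : R -> R) :
  (forall s t, 0 <= s -> s <= t -> t <= 1 -> `|D t - D s| <= (t - s) * (F t - F s)) ->
  D 1 = D 0.
Proof.
move=> h; have key (n k : nat) : (k <= n.+1)%N ->
    `|D (k%:R / n.+1%:R) - D 0| <= n.+1%:R^-1 * (F (k%:R / n.+1%:R) - F 0).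
  elim: k => [|k IH] kn; first by rewrite mul0r !subrr normr0 mulr0.
  have := IH (ltnW kn).
  set a := k%:R / n.+1%:R; set b := k.+1%:R / n.+1%:R.
  have ba : b - a = n.+1%:R^-1 by rewrite /b /a -mulrBl -natr1 addrC addKr mul1r.
  have a0 : 0 <= a by rewrite divr_ge0.
  have ab : a <= b by rewrite -subr_ge0 ba invr_ge0.
  have b1 : b <= 1 by rewrite ler_pdivrMr ?mul1r ?ler_nat.
  have := h _ _ a0 ab b1; rewrite ba; move: (n.+1%:R^-1) => q h1 h2.
  have -> : D b - D 0 = (D b - D a) + (D a - D 0) by lra.
  apply: le_trans (ler_normD _ _) _; lra.
apply/eqP; rewrite -subr_eq0 -normr_le0.
have hc : (fun n : nat => n.+1%:R^-1 * (F 1 - F 0)) @ \oo --> (0 : R).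
  by rewrite -[X in _ --> X](mul0r (F 1 - F 0)); apply: cvgMl; exact: cvg_harmonic.
apply: ler_cvg_to (cvg_cst _) hc _; apply: nearW => n.
by have := key n n.+1 (leqnn _); rewrite mulfV.
Qed.
End Telescope.

Section SpectralB.
Variables (R : realType) (V : lmodType R[i]) (K : hilb V) (B : sop K).
Implicit Types (u v w : V) (l m : R).
Local Notation car := (carrier K).
Local Notation "<< u , v >>" := (rip K u v).
Local Notation "n[ u ]" := (hnorm K u).
Hypothesis Bpos : forall u, car u -> 0 <= << u, B u >>.
Hypothesis Bcontr : forall u, car u -> n[B u] <= n[u].
Hypothesis Binj : forall u, car u -> B u = 0 -> u = 0.

Let cl l := spec_closed Bpos Bcontr l.
Let P l u := proj K (spec B l) u.

(** On the part of the space between [spec B s] and [spec B t], the operator B lies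
    between s and t. *)
Lemma spec_increment s t u : car u -> s <= t ->
  s * (sfun B u t - sfun B u s) <= << P t u, B (P t u) >> - << P s u, B (P s u) >>
    <= t * (sfun B u t - sfun B u s).
Proof.
move=> hu st.
have cs := proj_car (cl s) hu; have ct := proj_car (cl t) hu.
pose w := P t u - P s u.
have cw : car w by rewrite /w /P.
have sub := spec_mono Bpos Bcontr st.
have [ps os] := projP (cl s) hu; have [pt ot] := projP (cl t) hu.
have wt : spec B t w.
  have [[_ h] _ _] := cl t; rewrite /w /P -scaleN1r addrC; apply: h => //; exact: sub.
have ws v : spec B s v -> << w, v >> = 0.
  move=> hv; have cv := @spec_car _ _ _ B s v hv.
  by have := os _ hv; have := ot _ (sub _ hv); rewrite /w /P !ripBl//; lra.
have FE : sfun B u t - sfun B u s = << w, w >>.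
  by rewrite /w /P proj_diff.
have PE : P t u = P s u + w by rewrite /w addrC subrK.
clearbody w; rewrite FE.
have GE : << P t u, B (P t u) >> - << P s u, B (P s u) >> = << w, B w >>.
  have cb : car (P s u) by exact: cs.
  rewrite PE sopD// ripDr// !ripDl//.
  have h1 : << w, B (P s u) >> = 0 by apply: ws; apply: spec_inv.
  have h2 : << P s u, B w >> = 0 by rewrite -sop_sym// ripC// h1.
  by rewrite h1 h2; lra.
rewrite GE; apply/andP; split.
  exact: spec_lower.
exact: spec_upper.
Qed.

(** The functions t |-> (P_t u, B P_t u) and t |-> int_0^t x dmu both have
    increments between s (F t - F s) and t (F t - F s), where F is the distribution
    function; [telescope_const] then shows that they coincide. *)
Lemma spec_measure_exists u : car u ->
  exists mu : {measure set (mT R) -> \bar R},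
    [/\ forall a, mu `]-oo, a]%classic = << u, proj K (spec B a) u >>%:E,
        mu setT = << u, u >>%:E, mu (~` `]0, 1]%classic) = 0%E
      & (<< u, B u >>%:E = \int[mu]_(x in `]0%R, 1%R]) x%:E)%E].
Proof.
move=> hu.
have f0 l : l <= 0 -> sfun B u l = 0 by move=> l0; apply: sfun_le0.
have f1 l : 1 <= l -> sfun B u l = << u, u >> by move=> l1; apply: sfun_ge1.
have [mu [mua muT]] := cumulative_measure
  (sfun_nd Bpos Bcontr hu) (sfun_rc Bpos Bcontr Binj hu) f0 f1.
exists mu.
have muI a b : a <= b -> mu `]a, b]%classic = (sfun B u b - sfun B u a)%:E.
  move=> ab; have mab : measurable (`]a, b]%classic : set (mT R)) by exact: measurable_itv.
  have ma c : measurable (`]-oo, c]%classic : set (mT R)) by exact: measurable_itv.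
  have E : (mu `]-oo, b]%classic = mu `]-oo, a]%classic + mu `]a, b]%classic)%E.
    have -> : `]-oo, b]%classic = `]-oo, a] `|` `]a, b]%classic.
      apply/seteqP; split=> x /=; rewrite !in_itv/=.
        by move=> xb; have [xa|xa] := leP x a; [left|right].
      by move=> [xa|/andP[]//]; exact: le_trans ab.
    apply: measureU => //; rewrite -subset0 => x /=; rewrite !in_itv/= => -[xa /andP[]].
    by rewrite ltNge xa.
  by move: E; rewrite !mua EFinB => ->; rewrite [X in (X - _)%E]addeC addeK.
split=> //.
  have mI : measurable (`]0, 1]%classic : set (mT R)) by exact: measurable_itv.
  have E : (mu setT = mu `]0%R, 1%R]%classic + mu (~` `]0%R, 1%R]%classic))%E.
    by rewrite -(setUv `]0, 1]%classic) measureU ?setICr//; exact: measurableC.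
  move: E; rewrite muT muI// f1// f0// subr0 => /esym E.
  have {E} : (<<u, u>>%:E + mu (~` `]0%R, 1%R]%classic) - <<u, u>>%:E = 0)%E.
    by rewrite E subee.
  by rewrite [X in (X - _)%E]addeC addeK.
pose I t := (\int[mu]_(x in `]0%R, t]) x%:E)%E.
pose Q s t := (\int[mu]_(x in `]s, t]) x%:E)%E.
have mid (D : set (mT R)) : measurable_fun D (EFin : mT R -> \bar R).
  by apply: measurable_funTS; apply/measurable_EFinP.
have mi s t : measurable (`]s, t]%classic : set (mT R)) by exact: measurable_itv.
have Qb (s t : R) : 0 <= s -> s <= t ->
    ((s * (sfun B u t - sfun B u s))%:E <= Q s t <= (t * (sfun B u t - sfun B u s))%:E)%E.
  move=> s0 st; rewrite !EFinM -muI// -!integral_cst//; apply/andP; split.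
    apply: ge0_le_integral => //.
    by move=> x /=; rewrite in_itv/= => /andP[sx _]; rewrite lee_fin ltW.
  apply: ge0_le_integral => //.
  - by move=> x /=; rewrite in_itv/= => /andP[sx _]; rewrite lee_fin ltW//; exact: le_lt_trans sx.
  - by move=> x /=; rewrite in_itv/= => /andP[_ sx]; rewrite lee_fin.
have Qfin (s t : R) : 0 <= s -> s <= t -> Q s t \is a fin_num.
  move=> s0 st; have /andP[h1 h2] := Qb s t s0 st; rewrite fin_numE; apply/andP; split.
    by apply/eqP => h; rewrite h in h1.
  by apply/eqP => h; rewrite h in h2.
have IE (s t : R) : 0 <= s -> s <= t -> I t = (I s + Q s t)%E.
  move=> s0 st; rewrite /I /Q -ge0_integral_setU//.
  - congr integral; apply/seteqP; split=> x /=; rewrite !in_itv/=.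
      by move=> /andP[x0 xt]; have [xs|xs] := leP x s; [left; rewrite x0|right].
    by move=> [/andP[-> /le_trans->]//|/andP[sx ->]]; rewrite (le_lt_trans s0 sx).
  - move=> x /= []; rewrite in_itv/= => /andP[x0 _]; rewrite lee_fin ltW//.
    exact: le_lt_trans x0.
  - apply/disj_setPS => x /= []; rewrite !in_itv/= => /andP[_ xs] /andP[].
    by rewrite ltNge xs.
pose D t := << P t u, B (P t u) >> - fine (I t).
have := @telescope_const _ D (sfun B u) _.
have I0 : I 0 = 0%E.
  rewrite /I (_ : `]0, 0]%classic = set0) ?integral_set0// -subset0 => x /=.
  by rewrite in_itv/= => /andP[x0]; rewrite leNgt x0.
have P0 : P 0 u = 0.
  have [] := projP (cl 0) hu; rewrite -/(P 0 u) spec_le0//.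
have P1 : P 1 u = u by apply: proj_id => //; rewrite spec_ge1.
have If (t : R) : 0 <= t -> I t \is a fin_num.
  by move=> t0; rewrite (IE 0)// I0 add0e; exact: Qfin.
rewrite /D I0 P0 P1 sop0 rip0r// subr0 => h.
apply/esym; rewrite -/(I 1) -[LHS]fineK ?If//; congr (_%:E).
apply/esym/eqP; rewrite -subr_eq0; apply/eqP; apply: h.
move=> s t s0 st t1; have := spec_increment hu st; have := Qb s t s0 st.
have -> : fine (I t) = fine (I s) + fine (Q s t).
  by rewrite (IE s t s0 st); apply: fineD; [exact: If|exact: Qfin].
have := Qfin s t s0 st; case: (Q s t) => // q _; rewrite !lee_fin /=.
have arith (a b d x y z : R) : a <= d <= b -> a <= x - y <= b ->
    `|x - (z + d) - (y - z)| <= b - a.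
  by move=> /andP[? ?] /andP[? ?]; rewrite ler_norml; apply/andP; split; lra.
by move=> h1 h2; rewrite [leRHS]mulrBl; exact: arith.
Qed.
End SpectralB.

(** * Powers of x, and the existence of a spectral measure *)

Section Powers.
Variables (R : realType) (V : lmodType R[i]) (K : hilb V).
Implicit Types (u v w : V) (N : set (mT R)).
Local Notation car := (carrier K).

Definition pw (r : R) : nnmfun R :=
  @NNMFun R (fun x => x `^ r) (fun x => powR_ge0 x r) (measurable_powR r).

(** The spectral measures of A >= I are carried by this half-line, on which the
    functions x^r form a group under multiplication. *)
Definition ray1 : set (mT R) := `[1, +oo[%classic.
Lemma measurable_ray1 : measurable ray1.
Proof. exact: measurable_itv. Qed.
Lemma ray1P x : ray1 x = (1 <= x).
Proof. by rewrite /ray1/= in_itv/= andbT. Qed.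

Variable E : set R -> V -> V.
Hypothesis hE : projection_valued_measure K E.
Local Notation sm u := (smeas hE u).

Lemma spr_full N : measurable N -> (forall u, car u -> sm u (~` N) = 0%E) ->
  forall u, car u -> spr hE N u = u.
Proof.
move=> mN h u hu; have mC := measurableC mN.
have : u = spr hE N u + spr hE (~` N) u by rewrite -sprU ?setICr// setUv sprT.
suff -> : spr hE (~` N) u = 0 by rewrite addr0.
apply: (@rip_eq0 _ _ K) => //; rewrite -(idem_form (spr_idem hE _))//.
by have := h _ hu; rewrite (smeasE hE _ hu) => -[].
Qed.

Hypothesis full : forall u, car u -> spr hE ray1 u = u.

Lemma fdom_pw_le0 r : r <= 0 -> fdom hE (pw r) = car.
Proof.
move=> r0; apply/seteqP; split=> [|u hu]; first exact: fdom_car.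
rewrite -(full hu); apply: (@fdom_cut _ _ _ _ _ _ _ 1) => //; first exact: measurable_ray1.
move=> x; rewrite ray1P => x1; rewrite /= -(powRr0 x); exact: ler_powR.
Qed.

Lemma fcalc_pw0 u : car u -> fcalc hE (pw 0) u = u.
Proof.
have D0 : fdom hE (pw 0) = car by exact: fdom_pw_le0.
have hD u0 : car u0 -> fdom hE (pw 0) u0 by rewrite D0.
apply: (@form_unique _ _ K car (fcalc hE (pw 0)) id) => //.
- by rewrite -D0; exact: fdom_dense.
- by move=> v /hD; exact: fcalc_car.
- move=> v w /hD hv /hD hw; have := fcalc_lin 1 hv hw.
  by rewrite !scale1r.
- by move=> v w /hD hv /hD hw; exact: fcalc_sym.
- move=> v hv; apply: EFin_inj; rewrite fcalc_form//; last exact: hD.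
  transitivity (\int[sm v]_x (cst 1%E x))%E.
    by apply: eq_integral => x _; rewrite /= powRr0.
  by rewrite integral_cst// mul1e; exact: smeasT.
Qed.

Lemma pw_comp r s u : fdom hE (pw r) u ->
  (fdom hE (pw s) (fcalc hE (pw r) u) <-> fdom hE (pw (s + r)) u) /\
  (fdom hE (pw (s + r)) u -> fcalc hE (pw s) (fcalc hE (pw r) u) = fcalc hE (pw (s + r)) u).
Proof.
move=> h; apply: (fcalc_comp measurable_ray1) => // x; rewrite ray1P => x1 /=.
by apply: powRD; apply/implyP => _; rewrite gt_eqF//; exact: lt_le_trans x1.
Qed.

(** The identity is not nonnegative, but it agrees with x^1 on [1, +oo[, and its
    negative part vanishes there. *)
Lemma fgraph_pw1_spectral : is_spectral_integral K E id (fgraph hE (pw 1)).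
Proof.
have [h1 h2 h3] := fgraph_spectral hE (pw 1).
have mN := measurable_ray1.
have mx : measurable_fun [set: mT R] (fun x : mT R => x) by exact: measurable_id.
have sqE u : car u -> (\int[sm u]_x ((x `^ 1) ^+ 2)%:E = \int[sm u]_x (x ^+ 2)%:E)%E.
  move=> hu; apply: (full_int_eq mN hu (full hu)) => //.
  - by apply: measurable_funX; exact: measurable_powR.
  - by move=> x; rewrite sqr_ge0.
  - by move=> x; rewrite sqr_ge0.
  - by move=> x; rewrite ray1P => x1; rewrite /= powRr1// (le_trans _ x1).
split=> //.
  rewrite h2; apply/seteqP; split=> u [hu h]; split=> //; move: h;
    by rewrite !(integral_dist hE)// sqE.
move=> u w uw; rewrite (h3 _ _ uw); congr (_ (fine _)).
have [/= hf _] := uw; have hu := fdom_car hf.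
rewrite !(integral_dist hE)// [RHS]integralE.
have -> : (\int[sm u]_x ((fun x : mT R => x%:E) ^\- x) = 0)%E.
  transitivity (\int[sm u]_x (0%R : R)%:E)%E; last exact: integral0.
  transitivity (\int[sm u]_x ((Num.max (- x) 0) : R)%:E)%E.
    by apply: eq_integral => x _; rewrite funenegE EFin_max.
  apply: (full_int_eq mN hu (full hu)) => //.
  - by apply: measurable_maxr => //; exact: measurableT_comp.
  - by move=> x; rewrite le_max lexx orbT.
  - by move=> x; rewrite ray1P => x1; apply/max_idPr; rewrite oppr_le0 (le_trans _ x1).
rewrite sube0.
transitivity (\int[sm u]_x ((Num.max x 0) : R)%:E)%E; last first.
  by apply: eq_integral => x _; rewrite funeposE EFin_max.
apply: (full_int_eq mN hu (full hu)) => //.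
- by apply: measurable_maxr.
- by move=> x; rewrite powR_ge0.
- by move=> x; rewrite le_max lexx orbT.
move=> x; rewrite ray1P => x1 /=; have x0 : 0 <= x by exact: le_trans x1.
by rewrite powRr1//; apply/esym/max_idPl.
Qed.

End Powers.

Section Existence.
Variables (R : realType) (V : lmodType R[i]) (K : hilb V) (A : operator V).
Implicit Types (u v w : V).
Local Notation car := (carrier K).
Local Notation "<< u , v >>" := (rip K u v).
Hypotheses (Asa : selfadjoint K A) (A_ge1 : ge_identity K A).
Let B := sa_inv Asa A_ge1.
Let phi (x : mT R) : mT R := x `^ (-1).
Let mphi : measurable_fun setT phi := measurable_powR (-1).

(** The spectral measures of B = A^(-1) live on ]0, 1], and x |-> x^(-1) carries
    them to [1, +oo[.  In the resulting functional calculus x^(-1) yields B, and A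
    is then identified with the operator of x by composing the two. *)
Lemma sa_spectral_exists : exists E, is_spectral_measure K A E.
Proof.
have Bpos := sa_inv_pos Asa A_ge1.
have Bcontr := sa_inv_contr Asa A_ge1.
have Binj u (hu : car u) := @sa_inv_inj _ _ _ _ Asa A_ge1 u hu.
have /choice[muB hB] : forall u, exists mu : {measure set (mT R) -> \bar R}, car u ->
    [/\ forall a, mu `]-oo, a]%classic = << u, proj K (spec B a) u >>%:E,
        mu setT = << u, u >>%:E, mu (~` `]0, 1]%classic) = 0%E
      & (<< u, B u >>%:E = \int[mu]_(x in `]0%R, 1%R]) x%:E)%E].
  move=> u; have [hu|nu] := pselect (car u); last by exists mzero.
  by have [mu hmu] := spec_measure_exists Bpos Bcontr Binj hu; exists mu.
have muBT u : car u -> muB u setT = << u, u >>%:E by case/hB.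
have muB_ray a : exists T : sop K, represents muB `]-oo, a]%classic T.
  exists (sproj (spec_closed Bpos Bcontr a)); split.
    move=> u hu; apply: proj_id; first exact: spec_closed.
    by case: (projP (spec_closed Bpos Bcontr a) hu).
  by move=> u /hB[].
pose muA0 u : {measure set (mT R) -> \bar R} := pushforward (muB u) phi.
pose muA := muA0 mphi.
have muAT u : car u -> muA u setT = << u, u >>%:E.
  by move=> hu; rewrite /muA /muA0 /= /pushforward preimage_setT muBT.
have muA_ray a : exists T : sop K, represents muA `]-oo, a]%classic T.
  have mr : measurable (phi @^-1` `]-oo, a]%classic).
    by rewrite -[X in measurable X]setTI; apply: mphi => //; exact: measurable_itv.
  by have [T hT] := represents_exists muBT muB_ray mr; exists T.
have [E [hE EA]] := pvm_exists muAT muA_ray; exists E; split=> //.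
have smA u M : car u -> measurable M -> smeas hE u M = muA u M.
  by move=> hu mM; rewrite -(EA _ mM _ hu) (spectral_dist_smeas hE).
have m01 : measurable (`]0, 1]%classic : set (mT R)) by exact: measurable_itv.
have full u : car u -> spr hE (@ray1 R) u = u.
  move=> hu; apply: (spr_full _ _ hu) => [|v hv]; first exact: measurable_ray1.
  rewrite smA//; last by apply: measurableC; exact: measurable_ray1.
  apply/eqP; rewrite eq_le measure_ge0 andbT /muA /muA0 /= /pushforward.
  have [_ _ <- _] := hB _ hv; apply: le_measure; rewrite ?inE.
  - rewrite -[X in measurable X]setTI; apply: mphi => //.
    by apply: measurableC; exact: measurable_ray1.
  - exact: measurableC.
  - move=> x /= nx x01; apply: nx; move: x01; rewrite ray1P !in_itv/= => /andP[x0 x1].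
    have h : 1 <= (x : R)^-1 by rewrite invf_ge1.
    by rewrite /phi powR_inv1// ltW.
pose p := @pw R.
have Dm1 : fdom hE (p (-1)) = car by apply: fdom_pw_le0 => //; rewrite oppr_le0.
have hD u : car u -> fdom hE (p (-1)) u by rewrite Dm1.
have BE u : car u -> fcalc hE (p (-1)) u = B u.
  apply: (@form_unique _ _ K car (fcalc hE (p (-1))) B) => //.
    - by rewrite -Dm1; exact: fdom_dense.
  - by move=> v /hD; exact: fcalc_car.
  - move=> v w /hD hv /hD hw; have := fcalc_lin 1 hv hw.
    by rewrite !scale1r.
  - by move=> v w; exact: sopD.
  - by move=> v w /hD hv /hD hw; exact: fcalc_sym.
  - by move=> v w hv hw; rewrite sop_sym.
  - move=> v hv; apply: EFin_inj; rewrite fcalc_form//; last exact: hD.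
    have [_ _ mu0 ->] := hB _ hv.
    transitivity (\int[muA v]_x (p (-1) x)%:E)%E.
      by apply: raw_integral_eq => M mM; exact: smA.
    have mp : measurable_fun [set: mT R] (fun x => (p (-1) x)%:E).
      by apply/measurable_EFinP; exact: measurable_powR.
    rewrite /muA /muA0 ge0_integral_pushforward//; last by move=> x _; rewrite lee_fin nnmf_ge0.
    pose N : set (mT R) := ~` `]0%R, 1%R]%classic.
    rewrite preimage_setT (ge0_negligible_integral (N := N))//.
    + rewrite /N setTD setCK; apply: eq_integral => x; rewrite inE/= in_itv/= => /andP[x0 x1].
      by rewrite /phi -powRrM mulrN1 opprK powRr1// ltW.
    + exact: measurableC.
    + by apply: (measurableT_comp mp).
    + by move=> x _; rewrite /= lee_fin powR_ge0.
have -> : A = fgraph hE (p 1); last exact: fgraph_pw1_spectral.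
have key u : car u -> fdom hE (p 1) (B u) /\ fcalc hE (p 1) (B u) = u.
  move=> hu; have [h1 h2] := pw_comp full 1 (hD _ hu).
  rewrite subrr in h1 h2; rewrite -BE//; split; first by apply/h1; rewrite fdom_pw_le0.
  by rewrite h2 ?fdom_pw_le0// fcalc_pw0.
apply/seteqP; split=> [[u w] uw|[u w] [/= hu ->]].
  have [cu cw] := sa_car Asa uw; have [h1 h2] := key _ cw.
  by rewrite (sa_inv_uniq Asa A_ge1 uw) in h1 h2; split.
have cu := fdom_car hu; have cf := fcalc_car hu.
have [h1 h2] := pw_comp full (-1) hu.
have := sa_invP Asa A_ge1 cf; rewrite -/B -BE// h2; last by rewrite addNr fdom_pw_le0.
by rewrite addNr fcalc_pw0.
Qed.
End Existence.

(** * Powers of A *)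

Section HellingerToeplitz.
Variables (R : realType) (V : lmodType R[i]) (K : hilb V).
Implicit Types (u v w : V).
Local Notation car := (carrier K).
Local Notation "<< u , v >>" := (rip K u v).
Local Notation "n[ u ]" := (hnorm K u).

(** The theorem of Hellinger and Toeplitz, by a gliding hump.  If T is unbounded,
    choose e_n with ||T e_n|| > n 3^n ||e_n|| and add up vectors of norm 3^(-n) in
    the directions of T e_n, the sign being chosen so that the sum of the terms up to the n-th has
    inner product at least 3^(-n) ||T e_n|| with T e_n.  The later terms contribute
    at most half of this, so for the limit l the number
    |(e_n, T l)| = |(T e_n, l)| exceeds n/2 ||e_n||, for every n. *)
Lemma sop_bounded (T : sop K) : exists C, forall u, car u -> n[T u] <= C * n[u].
Proof.
apply: contrapT => /forallNP unb.
have /choice[e he] : forall n : nat, exists e, car e /\ n%:R * 3 ^+ n * n[e] < n[T e].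
  move=> n; have := unb (n%:R * 3 ^+ n) => /existsNP[e /not_implyP[ce /negP]].
  by rewrite -ltNge => h; exists e.
have ce n : car (e n) := (he n).1.
have e0 n : 0 < n[e n].
  rewrite lt_def hnorm_ge0 andbT; apply/eqP => /(hnorm_eq0 (ce n)) h.
  by have := (he n).2; rewrite h sop0 hnorm0 mulr0 ltxx.
have Te0 n : 0 < n[T (e n)].
  apply: le_lt_trans (he n).2; rewrite !mulr_ge0//; exact: hnorm_ge0.
pose c n : R := (3^-1) ^+ n.
have c0 n : 0 < c n by rewrite exprn_gt0// invr_gt0.
have cS n : c n = 3 * c n.+1 by rewrite /c exprS mulrA mulfV// mul1r.
pose y n := (c n / n[T (e n)])%:C *: T (e n).
have cy n : car (y n) by rewrite /y.
have ny n : n[y n] = c n.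
  by rewrite /y hnormZr// gtr0_norm ?divr_gt0// mulfVK// gt_eqF.
have Ty n : << T (e n), y n >> = c n * n[T (e n)].
  rewrite /y ripZr// -hnorm2// expr2 mulrA mulfVK//; by rewrite gt_eqF.
pose fix x n := if n is m.+1 then
  if c m * n[T (e m)] <= `|<< T (e m), x m + y m >>| then x m + y m else x m - y m else 0.
have cx n : car (x n) by elim: n => [|n IH] //=; case: ifP.
have xS n : n[x n.+1 - x n] = c n.
  rewrite /=; case: ifP => _; first by rewrite addrAC subrr add0r ny.
  by rewrite addrAC subrr add0r hnormN.
have xT n : c n * n[T (e n)] <= `|<< T (e n), x n.+1 >>|.
  rewrite /=; case: ifPn => [//|]; rewrite -ltNge ripDr// ripBr// Ty.
  move: << T (e n), x n >> (mulr_gt0 (c0 n) (Te0 n)) => a; move: (_ * _) => b b0.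
  by rewrite ltr_norml => /andP[h1 h2]; rewrite ler_normr; apply/orP; right; lra.
have xd m n : (m <= n)%N -> n[x n - x m] <= 3 / 2 * (c m - c n).
  move=> /subnK <-; elim: (n - m)%N => [|k IH].
    by rewrite add0n !subrr hnorm0 mulr0.
  rewrite addSn; apply: le_trans (hnormBD (cx _) (cx (k + m)%N) (cx _)) _.
  by rewrite xS; have := cS (k + m)%N; lra.
have c_cvg : c @ \oo --> (0 : R).
  by apply: cvg_expr; rewrite gtr0_norm ?invr_gt0// invf_lt1// ltr1n.
have [|l cl xl] := @hcauchy_cvg _ _ K x cx.
  move=> eps eps0; have /cvgrPdist_lt/(_ (eps / 3))[|N _ hN] := c_cvg.
    by rewrite divr_gt0.
  exists N => m n Nm Nn.
  apply: le_lt_trans (hnormBD (cx m) (cx N) (cx n)) _.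
  rewrite (hnorm_distC (cx N) (cx n)); have := xd _ _ Nm; have := xd _ _ Nn.
  have := hN N (leqnn N); rewrite sub0r normrN gtr0_norm//; have := c0 m; have := c0 n.
  lra.
have ld n : n[x n.+1 - l] <= c n / 2.
  have h : (fun m => n[x n.+1 - x (m + n.+1)%N]) @ \oo --> n[x n.+1 - l].
    apply: hcvg_hnorm => //; apply: (@hcvg_le _ _ _ (fun m => x (m + n.+1)%N) _ l _ 1).
      by move=> m; rewrite mul1r opprB addrC addrA subrK hnorm_distC.
    by move: xl; rewrite /hcvg -(@cvg_shiftn n.+1).
  apply: cvgn_le h _ => m; rewrite hnorm_distC//.
  have := xd n.+1 (m + n.+1)%N (leq_addl _ _); have := c0 (m + n.+1)%N; have := cS n.
  by lra.
have key n : n%:R / 2 <= n[T l].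
  have h1 : c n / 2 * n[T (e n)] <= `|<< T (e n), l >>|.
    have : << T (e n), l >> = << T (e n), x n.+1 >> - << T (e n), x n.+1 - l >>.
      by rewrite ripBr//; lra.
    move=> ->; have := rip_CS (sop_car T (ce n)) (carD (cx n.+1) (carN cl)).
    have := ler_wpM2l (hnorm_ge0 K (T (e n))) (ld n); have := xT n.
    have := lerB_normD << T (e n), x n.+1 >> (- << T (e n), x n.+1 - l >>).
    by rewrite normrN; lra.
  have h2 : `|<< T (e n), l >>| <= n[e n] * n[T l] by rewrite sop_sym// rip_CS.
  have h3 := le_trans h1 h2; rewrite -(ler_pM2l (e0 n)); apply: le_trans h3.
  have h4 : n%:R * n[e n] <= c n * n[T (e n)].
    rewrite -ler_pdivrMl// /c exprVn invrK mulrCA mulrA; exact: ltW (he n).2.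
  lra.
have := archi_boundP (hnorm_ge0 K (T l)).
have := key (2 * Num.bound n[T l])%N; rewrite natrM; lra.
Qed.
End HellingerToeplitz.

Section FullRay.
Variables (R : realType) (V : lmodType R[i]) (K : hilb V) (A : operator V).
Implicit Types (u v w : V).
Local Notation car := (carrier K).
Local Notation "<< u , v >>" := (rip K u v).
Hypothesis A_ge1 : ge_identity K A.
Variable E : set R -> V -> V.
Hypotheses (hE : projection_valued_measure K E) (hI : is_spectral_integral K E id A).
Local Notation sm u := (smeas hE u).

Lemma int_le_cst (f : mT R -> R) M C v : measurable M -> car v -> spr hE M v = v ->
  measurable_fun setT f -> (forall x, 0 <= f x) -> 0 <= C -> (forall x, M x -> f x <= C) ->
  (\int[sm v]_x (f x)%:E <= (C * << v, v >>)%:E)%E.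
Proof.
move=> mM hv Mv mf f0 C0 fC.
have -> : (\int[sm v]_x (f x)%:E = \int[sm v]_x (Num.min (f x) C)%:E)%E.
  apply: (full_int_eq mM hv Mv) => //; first exact: measurable_minr.
    by move=> x; rewrite le_min f0.
  by move=> x /fC h; apply/esym/min_idPl.
rewrite EFinM -(smeasT hE hv) -integral_cst//; apply: ge0_le_integral => //.
- by move=> x _; rewrite lee_fin le_min f0.
- by apply/measurable_EFinP; exact: measurable_minr.
- by move=> x _; rewrite lee_fin ge_min lexx orbT.
Qed.

(** On the range of E([-n, 1 - 1/(n+1)]) the operator A is bounded and satisfies
    (v, A v) <= (1 - 1/(n+1)) (v, v), against A >= I; so this range is {0}.  The
    union of these intervals is the complement of [1, +oo[. *)
Lemma spectral_full u : car u -> spr hE (@ray1 R) u = u.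
Proof.
have sq (x a c : R) : - a <= x -> x <= c -> 0 <= a -> c < 1 -> x ^+ 2 <= a ^+ 2 + 1.
  by move=> h1 h2 h3 h4; have [x0|x0] := leP 0 x; nra.
move=> hu; pose C n : R := 1 - n.+1%:R^-1.
have C1 n : 0 <= C n < 1.
  by rewrite /C subr_ge0 invf_le1// ler1n /= ltrBlDr ltrDl invr_gt0.
pose M n : set (mT R) := `[- n%:R, C n]%classic.
have mM n : measurable (M n) by exact: measurable_itv.
have M0 n : spr hE (M n) u = 0.
  set v := spr hE (M n) u; have hv : car v by [].
  have Mv : spr hE (M n) v = v by rewrite /v spr_idem.
  have /andP[Cn0 Cn1] := C1 n.
  have [_ dE fE] := hI.
  have : dom A v.
    rewrite dE; split=> //; rewrite (integral_dist hE)//.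
    apply: (@le_lt_trans _ _ ((n%:R ^+ 2 + 1) * << v, v >>)%:E); last exact: ltry.
    apply: (int_le_cst (mM n)) => //.
    - by move=> x; rewrite sqr_ge0.
    - move=> x; rewrite /M/= in_itv/= => /andP[h1 h2].
      exact: sq h1 h2 (ler0n _ _) Cn1.
  move=> [[v' w] /= vw vE]; rewrite vE in vw; apply: (@rip_eq0 _ _ K) => //.
  have h1 : << v, v >> <= << v, w >> by have := A_ge1 vw; rewrite lecE => /andP[].
  suff h2 : << v, w >> <= C n * << v, v >>.
    apply/eqP; rewrite eq_le rip_ge0// andbT; move: Cn1 (le_trans h1 h2) (rip_ge0 hv).
    by move: << v, v >> (C n) => a b; nra.
  rewrite /rip (fE _ _ vw) /= (integral_dist hE)// -/(rip K v v).
  have : (\int[sm v]_x (x%:E) <= (C n * << v, v >>)%:E)%E.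
    rewrite integralE.
    apply: (@le_trans _ _ (\int[sm v]_x ((fun x : mT R => x%:E) ^\+ x))%E).
      by rewrite -[leRHS]sube0; apply: leeB => //; apply: integral_ge0.
    rewrite (_ : (\int[sm v]_x ((fun x : mT R => x%:E) ^\+ x) =
      \int[sm v]_x (Num.max x 0 : R)%:E)%E).
      apply: (int_le_cst (mM n)) => //.
      - by apply: measurable_maxr.
      - by move=> x; rewrite le_max lexx orbT.
      - by move=> x; rewrite /M/= in_itv/= => /andP[h3 h4]; rewrite ge_max h4.
    by apply: eq_integral => x _; rewrite funeposE EFin_max.
  case: (\int[sm v]_x x%:E)%E => //= _.
  by rewrite mulr_ge0// rip_ge0.
pose N n := M n `|` @ray1 R.
have mN := @measurable_ray1 R.
have NE n : spr hE (N n) u = spr hE (@ray1 R) u.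
  rewrite sprU// ?M0 ?add0r// -subset0 => x []; rewrite ray1P /M/= in_itv/= => /andP[_ h1] h2.
  by have /andP[_ h3] := C1 n; move: (le_lt_trans (le_trans h2 h1) h3); rewrite ltxx.
have := @spr_cvg _ _ _ _ hE N u; rewrite (funext NE) => h.
apply: (@hcvg_unique _ _ K (fun=> spr hE (@ray1 R) u)) => //; first exact: hcvg_cst.
apply: h => //.
- by move=> n; exact: measurableU.
- move=> m n mn x [|]; last by right.
  rewrite /M /= !in_itv/= => /andP[h1 h2]; left; apply/andP; split.
    by apply: le_trans h1; rewrite lerN2 ler_nat.
  by apply: le_trans h2 _; rewrite lerB// lef_pV2 ?posrE// ler_nat.
- rewrite -subTset => x _; have [x1|x1] := leP 1 x; first by exists 0%N => //; right; rewrite ray1P.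
  have e0 : 0 < 1 - x by rewrite subr_gt0.
  pose k := (Num.bound (1 - x)^-1 + Num.bound `|x|)%N.
  have ex0 : 0 <= (1 - x)^-1 by rewrite invr_ge0 ltW.
  exists k => //; left; rewrite /M/= in_itv/=; apply/andP; split.
    have h : `|x| <= k%:R by rewrite natrD ler_wpDl// ltW// archi_boundP.
    by move: h; rewrite ler_norml => /andP[].
  rewrite /C lerBrDr -lerBrDl invf_ple ?posrE// /k.
  rewrite -addSn natrD ler_wpDr// ltW// -natr1 ltr_wpDr//.
  exact: archi_boundP.
Qed.
End FullRay.

Section PowerFamily.
Variables (R : realType) (V : lmodType R[i]) (K : hilb V) (A : operator V).
Implicit Types (u v w : V) (r s : R).
Local Notation car := (carrier K).
Local Notation "<< u , v >>" := (rip K u v).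
Local Notation "n[ u ]" := (hnorm K u).

(** What the sequel uses of the powers of A.  The index set is the whole real
    line: for negative exponents the operators are bounded, and they invert the
    positive powers. *)
Record powers (P : R -> operator V) : Prop := Powers {
  power_graph : forall r u w, P r (u, w) <-> dom (P r) u /\ w = app (P r) u;
  power1 : P 1 = A;
  pdom_car : forall r, dom (P r) `<=` car;
  pap_car : forall r u, dom (P r) u -> car (app (P r) u);
  pdom_le0 : forall r, r <= 0 -> dom (P r) = car;
  pdom_subspace : forall r, is_subspace (dom (P r));
  pap_lin : forall r c u v, dom (P r) u -> dom (P r) v ->
    app (P r) (c *: u + v) = c *: app (P r) u + app (P r) v;
  pap0 : forall u, car u -> app (P 0) u = u;
  pdom_comp : forall r s u, dom (P r) u -> dom (P s) (app (P r) u) <-> dom (P (s + r)) u;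
  pap_comp : forall r s u, dom (P r) u -> dom (P (s + r)) u ->
    app (P s) (app (P r) u) = app (P (s + r)) u;
  pap_le0 : forall r u, r <= 0 -> car u -> n[app (P r) u] <= n[u] }.

Arguments pdom_car [P] hP [r t] _ : rename.
Arguments pap_car [P] hP [r u] _ : rename.
Arguments pdom_le0 [P] hP [r] _ : rename.
Arguments pap_lin [P] hP [r] c [u v] _ _ : rename.
Arguments pap0 [P] hP [u] _ : rename.
Arguments pdom_comp [P] hP [r] s [u] _ : rename.
Arguments pap_comp [P] hP [r s u] _ _ : rename.
Arguments pap_le0 [P] hP [r u] _ _ : rename.

Variable P : R -> operator V.
Hypothesis hP : powers P.
Notation pdom r := (dom (P r)).
Notation pap r := (app (P r)).

Lemma pdom_mono r s : r <= s -> pdom s `<=` pdom r.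
Proof.
move=> rs u hu; have [h _] := pdom_comp hP (r - s) hu; rewrite subrK in h.
by apply: h; rewrite (pdom_le0 hP) ?subr_le0//; exact: (pap_car hP).
Qed.

Lemma papK r u : pdom r u -> pdom (- r) (pap r u) /\ pap (- r) (pap r u) = u.
Proof.
move=> hu; have cu := pdom_car hP hu; have h0 : pdom (- r + r) u by rewrite addNr (pdom_le0 hP).
by split; [apply/(pdom_comp hP)|rewrite (pap_comp hP)// addNr (pap0 hP)].
Qed.

Lemma dom_A : dom A = pdom 1.
Proof. by rewrite (power1 hP). Qed.

(** If A^d is defined everywhere, so is A^(k d) for every k by the group law, and
    the domains decrease with the exponent. *)
Lemma pdom_total d : 0 < d -> pdom d = car -> forall r, pdom r = car.
Proof.
move=> d0 dd r; have dk (k : nat) : pdom (k%:R * d) = car.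
  elim: k => [|k IH]; first by rewrite mul0r (pdom_le0 hP).
  apply/seteqP; split=> [|u hu]; first exact: (pdom_car hP).
  rewrite -natr1 mulrDl mul1r; apply/(pdom_comp hP); first by rewrite dd.
  by rewrite IH; apply: (pap_car hP); rewrite dd.
apply/seteqP; split=> [|u hu]; first exact: (pdom_car hP).
apply: (@pdom_mono _ ((Num.bound (`|r| / d))%:R * d)); last by rewrite dk.
rewrite -ler_pdivrMr//; apply: (@le_trans _ _ (`|r| / d)).
  by rewrite ler_pM2r ?invr_gt0// ler_norm.
by apply/ltW/archi_boundP; rewrite divr_ge0// ltW.
Qed.

Hypothesis Asa : selfadjoint K A.

(** A self-adjoint operator is closed and densely defined; if it is bounded, its
    domain is closed as well. *)
Lemma bounded_total : bounded_operator K A -> pdom 1 = car.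
Proof.
rewrite -dom_A => -[c hc]; apply/seteqP; split=> [|u hu]; first by rewrite dom_A; exact: (pdom_car hP).
have [_ dA _] := Asa.
have /choice[x hx] : forall k : nat, exists x, dom A x /\ n[u - x] < k.+1%:R^-1.
  by move=> k; have [|x dx h] := dA u hu k.+1%:R^-1; [rewrite invr_gt0|exists x].
have /choice[y hy] : forall k, exists y, A (x k, y).
  by move=> k; have [[[x' y'] /= h <-] _] := hx k; exists y'.
have cx k := (sa_car Asa (hy k)).1; have cy k := (sa_car Asa (hy k)).2.
have xu : hcvg K x u.
  apply: (@null_le _ _ (fun n : nat => n.+1%:R^-1)); last exact: cvg_harmonic.
  by move=> n; rewrite hnorm_ge0/= hnorm_distC// ltW// (hx n).2.
have [|w cw yw] := @hcauchy_cvg _ _ K y cy.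
  move=> e e0; pose C := `|c| + 1; have C0 : 0 < C by rewrite ltr_wpDl.
  have /hcvgP/(_ (e / C / 2))[|N hN] := xu; first by rewrite !divr_gt0.
  exists N => p q Np Nq; have h1 := hc _ _ (sa_sub Asa (hy p) (hy q)).
  have h2 : c * n[x p - x q] <= C * n[x p - x q].
    by rewrite ler_wpM2r ?hnorm_ge0// /C ler_wpDr// ler_norm.
  apply: (le_lt_trans (le_trans h1 h2)); rewrite -ltr_pdivlMl// mulrC.
  have := hnormBD (cx p) hu (cx q); have := hN _ Np; have := hN _ Nq.
  by rewrite (hnorm_distC (cx q) hu); move: (e / C) => d; lra.
by exists (u, w) => //; exact: sa_closed Asa _ _ _ _ hy hu cw xu yw.
Qed.

(** If A is defined everywhere, it is bounded by Hellinger and Toeplitz. *)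
Lemma total_bounded d : 0 < d -> pdom d = car -> bounded_operator K A.
Proof.
move=> d0 dd; have d1 := pdom_total d0 dd 1.
have h u : car u -> A (u, pap 1 u).
  by move=> hu; rewrite -[X in X (_, _)](power1 hP); apply/(power_graph hP); rewrite d1.
have cA u (hu : car u) : car (pap 1 u) by apply: (pap_car hP); rewrite d1.
have lA c u v (hu : car u) (hv : car v) : pap 1 (c *: u + v) = c *: pap 1 u + pap 1 v.
  by apply: (pap_lin hP); rewrite d1.
have sA u v (hu : car u) (hv : car v) : << pap 1 u, v >> = << u, pap 1 v >>.
  by apply/esym; exact: sa_sym (h u hu) (h v hv).
have [C hC] := sop_bounded (Sop cA lA sA); exists C => u w uw.
have hu := (sa_car Asa uw).1; rewrite -(sa_fun Asa (h u hu) uw); exact: hC.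
Qed.

(** If the domain of A^r were contained in that of A^s, then A^(s-r) would be
    defined on all vectors v, because A^(-r) v lies in the domain of A^r. *)
Lemma pdom_strict r s : 0 <= r -> r < s -> ~ bounded_operator K A -> pdom s `<` pdom r.
Proof.
move=> r0 rs nb; split; first by apply: pdom_mono; exact: ltW.
move=> h; apply: nb; apply: (@total_bounded (s - r)); first by rewrite subr_gt0.
apply/seteqP; split=> [|v hv]; first exact: (pdom_car hP).
have hv' : pdom (- r) v by rewrite (pdom_le0 hP)// oppr_le0.
apply/(pdom_comp hP) => //; apply: h.
by have := papK hv'; rewrite opprK => -[].
Qed.

Lemma bounded_pdom : bounded_operator K A -> forall r, pdom r = car.
Proof. by move=> /bounded_total; exact: pdom_total. Qed.

Lemma bounded_pap : bounded_operator K A -> forall r,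
  exists2 C, 0 < C & forall u, car u -> n[pap r u] <= C * n[u].
Proof.
move=> bA r; have dd := bounded_pdom bA; have [c hc] := bA.
pose C := `|c| + 1; have C0 : 0 < C by rewrite ltr_wpDl.
have hC u : car u -> n[pap 1 u] <= C * n[u].
  move=> hu; have hA : A (u, pap 1 u).
    by rewrite -[X in X (_, _)](power1 hP); apply/(power_graph hP); rewrite dd.
  apply: le_trans (hc _ _ hA) _; rewrite ler_wpM2r ?hnorm_ge0//.
  by rewrite /C ler_wpDr// ler_norm.
have hk (k : nat) u : car u -> n[pap k%:R u] <= C ^+ k * n[u].
  elim: k u => [|k IH] u hu; first by rewrite (pap0 hP)// expr0 mul1r.
  rewrite -natr1 -(pap_comp hP) ?dd//; apply: le_trans (IH _ _) _.
    by apply: (pap_car hP); rewrite dd.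
  by rewrite exprSr -mulrA ler_wpM2l ?hC// exprn_ge0// ltW.
pose k := Num.bound `|r|; exists (C ^+ k) => [|u hu]; first exact: exprn_gt0.
have h1 : pdom k%:R u by rewrite dd.
have h2 : pdom (r - k%:R + k%:R) u by rewrite dd.
have e := pap_comp hP h1 h2; have er : r - k%:R + k%:R = r by rewrite subrK.
rewrite er in e; rewrite -e.
apply: le_trans (pap_le0 hP _ _) (hk k u hu); last by apply: (pap_car hP); rewrite dd.
rewrite subr_le0; apply: le_trans (ler_norm r) _; apply/ltW/archi_boundP; exact: normr_ge0.
Qed.
End PowerFamily.

Section Power.
Variables (R : realType) (V : lmodType R[i]) (K : hilb V) (A : operator V).
Implicit Types (u v w : V) (r s : R).
Local Notation car := (carrier K).
Local Notation "n[ u ]" := (hnorm K u).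
Hypotheses (Asa : selfadjoint K A) (A_ge1 : ge_identity K A).
Notation pdom r := (dom (power K A r)).
Notation pap r := (app (power K A r)).

Let E := spectral_measure K A.
Let hEA : is_spectral_measure K A E.
Proof. exact: xgetPex (sa_spectral_exists Asa A_ge1). Qed.
Let hE := hEA.1.
Let full := spectral_full A_ge1 hE hEA.2.

(** [power] selects a spectral integral, and there is only one. *)
Let powerE r : power K A r = fgraph hE (pw r).
Proof.
rewrite /power; case: xgetP => [T _ hT|/(_ (fgraph hE (pw r)))[]].
  exact: (@spectral_integral_unique _ _ _ _ hE (pw r) _ _ hT (fgraph_spectral hE (pw r))).
exact: fgraph_spectral.
Qed.

Let pdomE r : pdom r = fdom hE (pw r).
Proof. by rewrite powerE dom_fgraph. Qed.

Let graph r u w : power K A r (u, w) <-> pdom r u /\ w = pap r u.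
Proof.
have key : pdom r u -> power K A r (u, pap r u).
  by move=> [[u' w'] /= h <-]; apply: (@xgetPex _ 0 [set z | power K A r (u', z)]); exists w'.
split=> [h|[hu ->]]; last exact: key.
have hu : pdom r u by exists (u, w).
by split=> //; move: h (key hu); rewrite powerE => -[_ /= ->] [_ /= ->].
Qed.

Let papE r u : pdom r u -> pap r u = fcalc hE (pw r) u.
Proof.
move=> hu; have /graph := conj hu (erefl (pap r u)).
by rewrite powerE => -[].
Qed.

Let power_one : power K A 1 = A.
Proof.
have h := @fgraph_pw1_spectral _ _ _ _ hE full; rewrite powerE.
have [h1 h2 h3] := h; have [g1 g2 g3] := hEA.2.
have pwE : spectral_integral_dom K E id = fdom hE (pw 1) by rewrite -h2 dom_fgraph.
have hI : is_spectral_integral K E (pw 1) A.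
  have [_ f2 f3] := fgraph_spectral hE (pw 1).
  split=> //; first by rewrite -f2 h2.
  move=> u w uw; rewrite g3//; have hu : fdom hE (pw 1) u by rewrite -pwE -g2; exists (u, w).
  by rewrite -(h3 u (fcalc hE (pw 1) u))// (f3 u (fcalc hE (pw 1) u)).
exact: spectral_integral_unique (fgraph_spectral hE (pw 1)) hI.
Qed.

Let dom_car r : pdom r `<=` car.
Proof. by rewrite pdomE; exact: fdom_car. Qed.
Let app_car r u : pdom r u -> car (pap r u).
Proof. by move=> hu; rewrite papE//; apply: fcalc_car; rewrite -pdomE. Qed.
Let dom_le0 r : r <= 0 -> pdom r = car.
Proof. by move=> r0; rewrite pdomE fdom_pw_le0. Qed.
Let dom_subspace r : is_subspace (pdom r).
Proof. by rewrite pdomE; exact: fdom_subspace. Qed.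
Let domP r c u v : pdom r u -> pdom r v -> pdom r (c *: u + v).
Proof. by case: (dom_subspace r) => _; apply. Qed.
Let app_lin r c u v : pdom r u -> pdom r v ->
  pap r (c *: u + v) = c *: pap r u + pap r v.
Proof.
move=> hu hv; rewrite !papE//; last exact: domP.
by apply: fcalc_lin; rewrite -pdomE.
Qed.
Let app_0 u : car u -> pap 0 u = u.
Proof. by move=> hu; rewrite papE ?dom_le0// fcalc_pw0. Qed.
Let dom_comp r s u : pdom r u -> pdom s (pap r u) <-> pdom (s + r) u.
Proof.
move=> hu; have hf : fdom hE (pw r) u by rewrite -pdomE.
have [h1 h2] := (pw_comp full s hf).1; split=> h.
  by rewrite pdomE; apply: h1; move: h; rewrite papE// pdomE.
by rewrite papE// pdomE; apply: h2; rewrite -pdomE.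
Qed.
Let app_comp r s u : pdom r u -> pdom (s + r) u -> pap s (pap r u) = pap (s + r) u.
Proof.
move=> hu hsr; have hs := (dom_comp s hu).2 hsr; apply: (etrans (papE hs)); apply: (etrans _ (esym (papE hsr))); rewrite (papE hu).
have hf : fdom hE (pw r) u by rewrite -pdomE.
by apply: (pw_comp full s hf).2; rewrite -pdomE.
Qed.
Let app_le0 r u : r <= 0 -> car u -> n[pap r u] <= n[u].
Proof.
move=> r0 hu; have hr : pdom r u by rewrite dom_le0.
have cr := app_car hr; rewrite hnorm_le// papE//.
rewrite -lee_fin fcalc_norm -?pdomE// -[X in (_ <= X%:E)%E]mul1r.
apply: (int_le_cst (@measurable_ray1 R)) => //; first exact: full.
- by apply: measurable_funX; exact: measurable_powR.
- by move=> x; rewrite sqr_ge0.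
- move=> x; rewrite ray1P => x1; rewrite /= expr_le1 ?powR_ge0//.
  by rewrite -(powRr0 x); exact: ler_powR.
Qed.

Lemma power_powers : powers K A (power K A).
Proof.
split.
- exact: graph.
- exact: power_one.
- exact: dom_car.
- exact: app_car.
- exact: dom_le0.
- exact: dom_subspace.
- exact: app_lin.
- exact: app_0.
- exact: dom_comp.
- exact: app_comp.
- exact: app_le0.
Qed.
End Power.

(** * Transport along isometric isomorphisms *)

Section FiniteDimensional.
Variables (F : fieldType) (V : lmodType F).
Implicit Types (D : set V) (u v : V) (e : nat -> V).

(** Finite dimension is expressed by a spanning family that may lie outside D;
    before it can be mapped by an isometry defined on the space only, it has to
    be replaced by vectors of D.  Induction on the size of the family: D is
    spanned by its vectors without e_n-component and at most one more vector. *)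
Lemma spanned_by_own_vectors n e D : D 0 ->
  (forall a u v, D u -> D v -> D (a *: u + v)) ->
  (forall u, D u -> exists c : nat -> F, u = \sum_(i < n) c i *: e i) ->
  exists m f, (forall i, (i < m)%N -> D (f i)) /\
    forall u, D u -> exists c : nat -> F, u = \sum_(i < m) c i *: f i.
Proof.
elim: n D => [|n IH] D D0 DP De.
  by exists 0%N, (fun=> 0); split=> // u /De[c ->]; exists c; rewrite !big_ord0.
pose S u := exists c : nat -> F, u = \sum_(i < n) c i *: e i.
have S0 : S 0 by exists (fun=> 0); rewrite big1// => i _; rewrite scale0r.
have SP a u v : S u -> S v -> S (a *: u + v).
  move=> [c ->] [d ->]; exists (fun i => a * c i + d i).
  rewrite scaler_sumr -big_split; apply: eq_bigr => i _.
  by rewrite scalerDl scalerA.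
have [m [f [Df fS]]] := IH (D `&` S) (conj D0 S0)
  (fun a u v hu hv => conj (DP a u v hu.1 hv.1) (SP a u v hu.2 hv.2)) (fun u hu => hu.2).
have [[s Ds nS]|DS] := pselect (exists2 s, D s & ~ S s); last first.
  exists m, f; split=> [i /Df[]//|u Du]; apply: fS; split=> //.
  by apply: contrapT => nS; apply: DS; exists u.
have [c sE] := De _ Ds; rewrite big_ord_recr/= in sE.
have cn0 : c n != 0.
  by apply/eqP => cn; apply: nS; exists c; rewrite sE cn scale0r addr0.
exists m.+1, (fun i => if (i < m)%N then f i else s); split=> [i _|u Du].
  by case: ifP => // /Df[].
have [d uE] := De _ Du; rewrite big_ord_recr/= in uE.
have [|b bE] := fS (- (d n / c n) *: s + u).
  split; first exact: DP.
  have -> : - (d n / c n) *: s + u =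
      - (d n / c n) *: (\sum_(i < n) c i *: e i) + \sum_(i < n) d i *: e i.
    rewrite {1}sE {1}uE scalerDr scalerA mulNr mulfVK// (scaleNr (d n)).
    by rewrite addrACA addNr addr0.
  by apply: SP; [exists c|exists d].
exists (fun i => if (i < m)%N then b i else d n / c n).
rewrite big_ord_recr/= ltnn; under eq_bigr => i _ do rewrite ltn_ord.
by rewrite -bE scaleNr addrAC addNr add0r.
Qed.
End FiniteDimensional.

Section Transport.
Variables (R : realType) (V : lmodType R[i]).
Implicit Types (K L : hspace V) (B C : operator V) (u v w : V) (g h : V -> V) (S : set V).

(** Mutually inverse isometries, given by functions rather than by graphs.  All
    conditions come in pairs, which makes the notion symmetric in K and L: each
    invariant is transported in one direction only, and equality follows by
    exchanging the roles. *)
Record iso K L g h : Prop := Iso {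
  iso_l : forall u, carrier K u -> carrier L (g u);
  iso_r : forall u, carrier L u -> carrier K (h u);
  iso_lK : forall u, carrier K u -> h (g u) = u;
  iso_rK : forall u, carrier L u -> g (h u) = u;
  iso_lin : forall c u v, carrier K u -> carrier K v -> g (c *: u + v) = c *: g u + g v;
  iso_rin : forall c u v, carrier L u -> carrier L v -> h (c *: u + v) = c *: h u + h v;
  iso_lip : forall u v, carrier K u -> carrier K v -> ip L (g u) (g v) = ip K u v;
  iso_rip : forall u v, carrier L u -> carrier L v -> ip K (h u) (h v) = ip L u v }.

Lemma iso_sym K L g h : iso K L g h -> iso L K h g.
Proof. by case=> *; split. Qed.

Lemma iso_comp K L M g h g' h' : iso K L g h -> iso L M g' h' ->
  iso K M (g' \o g) (h \o h').
Proof.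
move=> i j; have hg := iso_l i; have hg' := iso_l j; have hh := iso_r i; have hh' := iso_r j.
split=> /= [u hu|u hu|u hu|u hu|c u v hu hv|c u v hu hv|u v hu hv|u v hu hv].
- by apply: hg'; exact: hg.
- by apply: hh; exact: hh'.
- by rewrite (iso_lK j) ?(iso_lK i)//; exact: hg.
- by rewrite (iso_rK i) ?(iso_rK j)//; exact: hh'.
- by rewrite (iso_lin i)// (iso_lin j)//; exact: hg.
- by rewrite (iso_rin j)// (iso_rin i)//; exact: hh'.
- by rewrite (iso_lip j) ?(iso_lip i)//; exact: hg.
- by rewrite (iso_rip i) ?(iso_rip j)//; exact: hh'.
Qed.

Lemma iso_eq K L g h g' h' : iso K L g h -> (forall u, carrier K u -> g u = g' u) ->
  (forall u, carrier L u -> h u = h' u) -> is_subspace (carrier K) -> is_subspace (carrier L) ->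
  iso K L g' h'.
Proof.
move=> i gg hh [_ KP] [_ LP]; have hl := iso_l i; have hr := iso_r i.
split=> [u hu|u hu|u hu|u hu|c u v hu hv|c u v hu hv|u v hu hv|u v hu hv].
- by rewrite -gg//; exact: hl.
- by rewrite -hh//; exact: hr.
- by rewrite -gg// -hh ?(iso_lK i)//; exact: hl.
- by rewrite -hh// -gg ?(iso_rK i)//; exact: hr.
- by rewrite -!gg ?(iso_lin i)//; exact: KP.
- by rewrite -!hh ?(iso_rin i)//; exact: LP.
- by rewrite -!gg ?(iso_lip i).
- by rewrite -!hh ?(iso_rip i).
Qed.

(** The operator C is B conjugated by g. *)
Record intertwine K L g B C : Prop := Intertwine {
  tw_l : B `<=` carrier K `*` carrier K;
  tw_r : C `<=` carrier L `*` carrier L;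
  tw : forall u v, carrier K u -> carrier K v -> B (u, v) <-> C (g u, g v) }.

Lemma intertwine_sym K L g h B C : iso K L g h -> intertwine K L g B C ->
  intertwine L K h C B.
Proof.
move=> i [bl cl t]; split=> // u v hu hv.
by rewrite t ?(iso_rK i)//; exact: iso_r i _ _.
Qed.

Section Iso.
Variables (K L : hspace V) (g h : V -> V).
Hypothesis i : iso K L g h.
Notation car := (carrier K).
Hypothesis Ks : is_subspace car.

Lemma iso_hnorm u : car u -> hnorm L (g u) = hnorm K u.
Proof. by move=> hu; rewrite /hnorm (iso_lip i). Qed.

Lemma iso_0 : g 0 = 0.
Proof.
by have := iso_lin i (-1) Ks.1 Ks.1; rewrite scaler0 addr0 scaleN1r addNr.
Qed.

Lemma iso_Z c u : car u -> g (c *: u) = c *: g u.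
Proof. by move=> hu; have := iso_lin i c hu Ks.1; rewrite !addr0 iso_0 addr0. Qed.

Lemma iso_B u v : car u -> car v -> g (u - v) = g u - g v.
Proof.
by move=> hu hv; have := iso_lin i (-1) hv hu; rewrite !scaleN1r ![- _ + _]addrC.
Qed.

Lemma carB u v : car u -> car v -> car (u - v).
Proof. by move=> hu hv; have := Ks.2 (-1) v u hv hu; rewrite scaleN1r addrC. Qed.

Lemma car_lin n (c : nat -> R[i]) (F : nat -> V) : (forall k, (k < n)%N -> car (F k)) ->
  car (\sum_(k < n) c k *: F k) /\ g (\sum_(k < n) c k *: F k) = \sum_(k < n) c k *: g (F k).
Proof.
elim: n => [|n IH] hF; first by rewrite !big_ord0 iso_0; split=> //; case: Ks.
have [|IH1 IH2] := IH; first by move=> k kn; apply: hF; exact: ltnW.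
have hn := hF n (ltnSn n); have e := iso_lin i (c n) hn IH1.
rewrite !big_ord_recr/= addrC e IH2 [RHS]addrC; split=> //; exact: Ks.2.
Qed.

Lemma iso_hcvg (x : nat -> V) l : (forall n, car (x n)) -> car l ->
  hcvg K x l -> hcvg L (fun n => g (x n)) (g l).
Proof.
move=> cx cl; rewrite /hcvg.
rewrite [X in _ -> X @ _ --> _](_ : _ = fun n => hnorm K (x n - l))//; apply/funext => n.
by rewrite -iso_B// iso_hnorm//; exact: carB.
Qed.
End Iso.

Section OneWay.
Variables (K L : hspace V) (g h : V -> V) (B C : operator V).
Hypotheses (i : iso K L g h) (t : intertwine K L g B C).
Notation car := (carrier K).
Notation dar := (carrier L).

Lemma tw_inv w w' : C (w, w') -> B (h w, h w').
Proof.
move=> hC; have [/= dw dw'] := tw_r t hC.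
by apply/(tw t); rewrite ?(iso_rK i)//; exact: iso_r i _ _.
Qed.

Lemma tw_fwd u u' : B (u, u') -> C (g u, g u').
Proof. by move=> hB; have [/= cu cu'] := tw_l t hB; apply/(tw t). Qed.

Lemma resolvent_set_sub : resolvent_set K B `<=` resolvent_set L C.
Proof.
move=> z [h1 [c hc]]; split=> [w dw|].
  have cw := iso_r i dw; have [u [Bu uu]] := h1 _ cw; have [/= cu cv] := tw_l t Bu.
  exists (g u); split=> [|u' Cu'].
    have := tw_fwd Bu; rewrite addrC (iso_lin i)// (iso_rK i)//.
    by rewrite addrC.
  have [/= du' _] := tw_r t Cu'; rewrite (uu (h u')) ?(iso_rK i)//.
  by have := tw_inv Cu'; rewrite addrC (iso_rin i)// addrC.
exists c => u w dw Cu; have [/= du _] := tw_r t Cu.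
have cu := iso_r i du; have cw := iso_r i dw.
have := tw_inv Cu; rewrite addrC (iso_rin i)// addrC => Bu.
by have := hc _ _ cw Bu; rewrite -(iso_hnorm i cu) -(iso_hnorm i cw) !(iso_rK i).
Qed.

Hypotheses (Ks : is_subspace car) (Ls : is_subspace dar).

Lemma op_eigenspace_fwd z u : op_eigenspace B z u -> op_eigenspace C z (g u).
Proof.
move=> Bu; have [/= cu czu] := tw_l t Bu; have := tw_fwd Bu.
by rewrite (iso_Z i).
Qed.

Lemma op_eigenspace_inv z u : op_eigenspace C z u -> op_eigenspace B z (h u).
Proof.
move=> Cu; have [/= cu czu] := tw_r t Cu; have := tw_inv Cu.
by rewrite (iso_Z (iso_sym i)).
Qed.

Lemma op_eigenspace_car z : op_eigenspace B z `<=` car.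
Proof. by move=> u /(tw_l t)[]. Qed.

Lemma point_spectrum_sub : point_spectrum B `<=` point_spectrum C.
Proof.
move=> z [u u0 Bu]; exists (g u); last exact: op_eigenspace_fwd.
apply: contra_neq u0 => gu0; have cu := op_eigenspace_car Bu.
by rewrite -(iso_lK i cu) gu0 (iso_0 (iso_sym i)).
Qed.

Lemma eigenspace_subspace z : linear_operator K K B -> is_subspace (op_eigenspace B z).
Proof.
case=> _ B0 BP _; split; first by rewrite /op_eigenspace/= scaler0.
move=> a u v hu hv; have := BP a _ _ hu hv.
by rewrite /op_eigenspace /= scalerDr !scalerA mulrC -scalerA.
Qed.

Lemma eigenspace_finite z : linear_operator K K B ->
  finite_dimensional (op_eigenspace B z) -> finite_dimensional (op_eigenspace C z).
Proof.
move=> /(eigenspace_subspace z)[S0 SP] [n [e he]].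
pose e' k := if insub k is Some j then e j else 0.
have [|m [f [Df fS]]] := @spanned_by_own_vectors _ V n e' _ S0 SP.
  move=> u /he[c ->]; exists (fun k => if insub k is Some j then c j else 0).
  by apply: eq_bigr => j _; rewrite /e' valK.
exists m, (fun k : 'I_m => g (f k)) => u hu; have [/= du _] := tw_r t hu.
have [c hc] := fS _ (op_eigenspace_inv hu); exists (fun k : 'I_m => c k).
have fc k : (k < m)%N -> car (f k) by move=> /Df; exact: op_eigenspace_car.
by rewrite -(iso_rK i du) hc (car_lin i Ks c fc).2.
Qed.

End OneWay.

Section TwoWay.
Variables (K L : hspace V) (g h : V -> V) (B C : operator V).
Hypotheses (i : iso K L g h) (t : intertwine K L g B C).
Notation car := (carrier K).
Notation dar := (carrier L).
Hypotheses (Ks : is_subspace car) (Ls : is_subspace dar).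
Let i' := iso_sym i.
Let t' := intertwine_sym i t.

Lemma resolvent_set_eq : resolvent_set K B = resolvent_set L C.
Proof. by apply/seteqP; split; apply: resolvent_set_sub; eassumption. Qed.

Lemma spectrum_eq : spectrum K B = spectrum L C.
Proof. by rewrite /spectrum resolvent_set_eq. Qed.

Lemma point_spectrum_eq : point_spectrum B = point_spectrum C.
Proof. apply/seteqP; split; [exact: (point_spectrum_sub i t)|exact: (point_spectrum_sub i' t')]. Qed.

Hypotheses (Bl : linear_operator K K B) (Cl : linear_operator L L C).

Lemma discrete_spectrum_eq : discrete_spectrum K B = discrete_spectrum L C.
Proof.
have fE z : finite_dimensional (op_eigenspace B z) = finite_dimensional (op_eigenspace C z).
  apply/propext; split; [exact: (eigenspace_finite i t)|exact: (eigenspace_finite i' t')].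
by rewrite /discrete_spectrum spectrum_eq point_spectrum_eq; under eq_set do rewrite fE.
Qed.

Lemma essential_spectrum_eq : essential_spectrum K B = essential_spectrum L C.
Proof. by rewrite /essential_spectrum spectrum_eq discrete_spectrum_eq. Qed.

(** The spectrum of a part of an operator only involves the restricted operators
    on the subspaces, which are again intertwined. *)
Lemma spectrum_in_eq S S' : S `<=` car -> S' `<=` dar -> (forall u, S u -> S' (g u)) ->
  (forall u, S' u -> S (h u)) -> spectrum_in K B S = spectrum_in L C S'.
Proof.
move=> Sc Sd SS SS'; rewrite /spectrum_in /spectrum; congr (~` _).
have j : iso (Hspace S (ip K)) (Hspace S' (ip L)) g h.
  case: (i) => i1 i2 i3 i4 i5 i6 i7 i8.
  split=> //= [u /Sc|u /Sd|c u v /Sc hu /Sc|c u v /Sd hu /Sd|u v /Sc hu /Sc|u v /Sd hu /Sd].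
  - exact: i3.
  - exact: i4.
  - exact: i5.
  - exact: i6.
  - exact: i7.
  - exact: i8.
have s : intertwine (Hspace S (ip K)) (Hspace S' (ip L)) g
    (B `&` S `*` S) (C `&` S' `*` S').
  split=> [p []//|p []//|u v /= hu hv]; have [cu cv] := (Sc _ hu, Sc _ hv).
  have [t1 t2] := tw t cu cv.
  split=> -[h1 _]; first by split; [exact: t1|split; exact: SS].
  by split; [exact: t2|split].
have j' := iso_sym j; have s' := intertwine_sym j s.
by apply/seteqP; split; apply: resolvent_set_sub; eassumption.
Qed.
End TwoWay.

Section Structure.
Variables (K L : hspace V) (g h : V -> V) (B C : operator V).
Hypotheses (i : iso K L g h) (t : intertwine K L g B C).
Notation car := (carrier K).
Notation dar := (carrier L).
Hypotheses (Ks : is_subspace car) (Ls : is_subspace dar).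
Let i' := iso_sym i.
Let t' := intertwine_sym i t.

Lemma iso_hilbert : hilbert K -> hilbert L.
Proof.
case=> _ [k1 k2 k3 k4] k5; have hr u := @iso_r _ _ _ _ i u.
split=> //.
  split=> [a u v w du dv dw|u v du dv|u du|u du u0].
  - by rewrite -!(iso_rip i)//; [rewrite (iso_rin i)// k1//; exact: hr|exact: Ls.2].
  - by rewrite -!(iso_rip i)//; apply: k2; exact: hr.
  - by rewrite -(iso_rip i)//; apply: k3; exact: hr.
  - rewrite -(iso_rK i du) (k4 (h u) (hr _ du)) ?(iso_0 i Ks)//.
    by rewrite (iso_rip i).
move=> x dx cx; have [||l cl hl] := k5 (fun n => h (x n)).
- by move=> n; exact: hr.
- move=> e e0; have [N hN] := cx e e0; exists N => m n Nm Nn.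
  by rewrite -(iso_B i')// (iso_hnorm i') ?hN//; exact: carB.
exists (g l); first exact: iso_l i _ _.
have := iso_hcvg i Ks (fun n => hr _ (dx n)) cl hl; rewrite /hcvg.
by under eq_fun do rewrite (iso_rK i)//.
Qed.

Lemma iso_separable : hseparable K -> hseparable L.
Proof.
move=> [x cx dx]; exists (fun n => g (x n)) => [n|]; first exact: iso_l i _ _.
move=> u du e e0; have cu := iso_r i du; have [_ [n _ <-] hn] := dx _ cu e e0.
exists (g (x n)); first by exists n.
by rewrite -(iso_rK i du) -(iso_B i)// (iso_hnorm i)//; exact: carB.
Qed.

Lemma tw_linear : linear_operator K K B -> linear_operator L L C.
Proof.
case=> _ B0 BP Bf; split; first exact: tw_r t.
- by have := tw_fwd t B0; rewrite /= (iso_0 i Ks).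
- move=> a [u u'] [v v'] Cu Cv; have [/= du du'] := tw_r t Cu; have [/= dv dv'] := tw_r t Cv.
  have := tw_fwd t (BP a _ _ (tw_inv i t Cu) (tw_inv i t Cv)).
  by rewrite /= !(iso_lin i) ?(iso_rK i)//; exact: iso_r i _ _.
- move=> u w w' Cu Cu'; have [/= _ dw] := tw_r t Cu; have [/= _ dw'] := tw_r t Cu'.
  by rewrite -(iso_rK i dw) -(iso_rK i dw') (Bf _ _ _ (tw_inv i t Cu) (tw_inv i t Cu')).
Qed.

Lemma tw_selfadjoint : selfadjoint K B -> selfadjoint L C.
Proof.
case=> Bl Bd Ba; have hr u := @iso_r _ _ _ _ i u; split; first exact: tw_linear.
  move=> u du e e0; have [_ [[v v'] Bv <-] hv] := Bd _ (hr _ du) e e0.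
  have [/= cv _] := tw_l t Bv; have cu := hr _ du.
  exists (g v); first by exists (g v, g v') => //=; exact: (tw_fwd t Bv).
  by rewrite -(iso_rK i du) -(iso_B i)// (iso_hnorm i)//; exact: carB.
apply/seteqP; split=> [[v w] [/= dv dw hvw]|[v w] Cv].
  have : B (h v, h w).
    rewrite -Ba; split; [exact: hr|exact: hr|] => u z Buz /=.
    have [/= cu cz] := tw_l t Buz; have cv := hr _ dv; have cw := hr _ dw.
    rewrite -(iso_lip i cv cz) -(iso_lip i cw cu) !(iso_rK i)//.
    exact: hvw (tw_fwd t Buz).
  by move=> /(tw_fwd t); rewrite !(iso_rK i).
have [/= dv dw] := tw_r t Cv; split=> //= u z Cu; have [/= du dz] := tw_r t Cu.
have := tw_inv i t Cv; rewrite -Ba => -[/= _ _ /(_ _ _ (tw_inv i t Cu))].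
by rewrite !(iso_rip i).
Qed.

Lemma iso_unitary : hilbert K -> unitary K L [set p | car p.1 /\ p.2 = g p.1].
Proof.
move=> hK; split.
- split=> [[u w] [/= cu ->]|||] /=.
  + by split=> //; exact: iso_l i _ _.
  + by rewrite (iso_0 i Ks); split=> //; case: Ks.
  + move=> a [u u'] [v v'] [/= cu ->] [/= cv ->]; split; first exact: Ks.2.
    by rewrite (iso_lin i).
  + by move=> u w w' [/= _ ->] [/= _ ->].
- by apply/seteqP; split=> [_ [[u w] [/= cu _] <-]//|u cu]; exists (u, g u).
- apply/seteqP; split=> [_ [[u w] [/= cu ->] <-]|u du]; first exact: iso_l i _ _.
  exists (h u, u) => //=; split; first exact: iso_r i _ _.
  by rewrite (iso_rK i).
- by move=> u u' w w' [/= cu ->] [/= cu' ->]; rewrite (iso_lip i).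
Qed.

Lemma tw_unitarily_equivalent : hilbert K -> unitarily_equivalent K B L C.
Proof.
move=> hK; exists [set p | car p.1 /\ p.2 = g p.1]; first exact: iso_unitary.
apply/seteqP; split=> [[w w'] /=|[w w'] Cw].
  move=> [u' [u [cu wE] Bu] [cu' wE']]; rewrite /= in cu wE cu' wE'.
  by rewrite wE wE'; have := tw_fwd t Bu.
have [/= dw dw'] := tw_r t Cw.
have hr u := @iso_r _ _ _ _ i u.
exists (h w'); last by split; [exact: hr|rewrite /= (iso_rK i)].
exists (h w); last by have := tw_inv i t Cw.
by split; [exact: hr|rewrite /= (iso_rK i)].
Qed.
End Structure.

Section SpectralOneWay.
Variables (K L : hspace V) (g h : V -> V) (B C : operator V).
Hypotheses (i : iso K L g h) (t : intertwine K L g B C).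
Notation car := (carrier K).
Notation dar := (carrier L).
Hypotheses (Ks : is_subspace car) (Ls : is_subspace dar).
Hypotheses (Bl : linear_operator K K B) (Cl : linear_operator L L C).

Definition push (E : set R -> V -> V) : set R -> V -> V := fun M v => g (E M (h v)).

Section Push.
Variable E : set R -> V -> V.
Hypothesis hE : projection_valued_measure K E.

Lemma push_dist v M : dar v -> measurable M ->
  spectral_dist L (push E) v M = spectral_dist K E (h v) M.
Proof.
move=> dv mM; rewrite /spectral_dist /push; congr (complex.Re _)%:E.
have cv := iso_r i dv; have [e1 _ _] := hE; have [hc _ _ _] := e1 M mM.
by rewrite -{1}(iso_rK i dv) (iso_lip i)//; exact: hc.
Qed.
End Push.

Lemma push_pvm E : projection_valued_measure K E -> projection_valued_measure L (push E).
Proof.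
have hr u := @iso_r _ _ _ _ i u; have hl u := @iso_l _ _ _ _ i u.
case=> e1 e2 e3; split=> [M /e1[m1 m2 m3 m4]|u du|F mF tF u du].
- split=> [u du|a u v du dv|u du|u v du dv].
  + by apply: hl; apply: m1; exact: hr.
  + by rewrite /push (iso_rin i)// m2 ?(iso_lin i)//; try exact: hr; apply: m1; exact: hr.
  + by have cu := hr _ du; rewrite /push (iso_lK i) ?m3//; exact: m1.
  + have cu := hr _ du; have cv := hr _ dv; rewrite /push.
    rewrite -{1}(iso_rK i du) -{2}(iso_rK i dv) !(iso_lip i)//; try exact: m1.
    exact: m4.
- by rewrite /push e2 ?(iso_rK i)//; exact: hr.
have cu := hr _ du.
have ce n : car (E (F n) (h u)) by have [h1 _ _ _] := e1 _ (mF n); exact: h1.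
have cU : car (E (\bigcup_n F n) (h u)).
  by have [h1 _ _ _] := e1 _ (bigcupT_measurable _ mF); exact: h1.
have cs n := car_lin i Ks (fun=> 1) (F := fun k => E (F k) (h u)) (n := n) (fun k _ => ce k).
have sE (G : nat -> V) n : \sum_(k < n) G k = \sum_(k < n) (1 : R[i]) *: G k.
  by apply: eq_bigr => k _; rewrite scale1r.
have cS n : car (\sum_(k < n) E (F k) (h u)) by rewrite (sE (fun k => E (F k) (h u))); exact: (cs n).1.
have := iso_hcvg i Ks cS cU (e3 F mF tF _ cu).
rewrite (_ : (fun n => g (\sum_(k < n) E (F k) (h u))) =
             (fun n => \sum_(k < n) push E (F k) u)) //.
apply/funext => n; rewrite (sE (fun k => E (F k) (h u))) (cs n).2.
by rewrite (sE (fun k => push E (F k) u)).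
Qed.

(** The scalar measures of the conjugated projections are those of the original
    ones at the preimage vector, so the integrals that characterize the spectral
    measure are the same. *)
Lemma push_spectral_measure E : is_spectral_measure K B E -> is_spectral_measure L C (push E).
Proof.
move=> [hE [_ bd bf]]; split; first exact: push_pvm.
have hr u := @iso_r _ _ _ _ i u.
have ie u (f : mT R -> \bar R) : dar u ->
    (\int[spectral_dist L (push E) u]_(x in setT) f x =
     \int[spectral_dist K E (h u)]_(x in setT) f x)%E.
  by move=> du; apply: raw_integral_eq => M mM; exact: push_dist.
split=> //.
  apply/seteqP; split=> [_ [[u w] Cu <-]|u [du Iu]].
    have [/= du dw] := tw_r t Cu; split=> //; rewrite ie//.
    have : dom B (h u) by exists (h u, h w) => //; have := tw_inv i t Cu.
    by rewrite bd => -[].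
  have : dom B (h u) by rewrite bd; split; [exact: hr|rewrite -ie].
  move=> [[u' w] /= Bu uE]; have := tw_fwd t Bu; rewrite uE (iso_rK i)// => Cu.
  by exists (u, g w).
move=> u w Cu; have [/= du dw] := tw_r t Cu.
by rewrite ie// -(iso_rip i)// (bf _ _ (tw_inv i t Cu)).
Qed.

Lemma push_dist_g E u M : is_spectral_measure K B E -> car u -> measurable M ->
  spectral_dist L (push E) (g u) M = spectral_dist K E u M.
Proof.
move=> hE cu mM; rewrite (push_dist hE.1)//; last exact: iso_l i _ _.
by rewrite (iso_lK i).
Qed.

Lemma ac_subspace_fwd u : ac_subspace K B u -> ac_subspace L C (g u).
Proof.
move=> [cu [E hE ac]]; split; first exact: iso_l i _ _.
exists (push E) => [|M mM M0]; first exact: push_spectral_measure.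
by rewrite (push_dist_g hE)//; exact: ac.
Qed.

Lemma sc_subspace_fwd u : sc_subspace K B u -> sc_subspace L C (g u).
Proof.
move=> [cu [E hE [sc [N [mN N0 hN]]]]]; split; first exact: iso_l i _ _.
exists (push E); first exact: push_spectral_measure.
split=> [x|]; first by rewrite (push_dist_g hE).
by exists N; split=> //; rewrite (push_dist_g hE)//; exact: measurableC.
Qed.

Lemma uniform_multiplicity_fwd n Om mu :
  uniform_multiplicity_part K B n Om mu -> uniform_multiplicity_part L C n Om mu.
Proof.
have hr u := @iso_r _ _ _ _ i u; have hl u := @iso_l _ _ _ _ i u.
move=> [n0 muT mOm [E [e [hE e1 e2 e3]]]]; split=> //.
have ec M u (mM : measurable M) (cu : car u) : car (E M u).
  by have [h0 _ _] := hE.1; have [h1 _ _ _] := h0 M mM; exact: h1.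
exists (push E), (fun k => g (e k)); split.
- exact: push_spectral_measure.
- move=> k Ik; have [ck Ok dk] := e1 _ Ik; split; first exact: hl.
    by rewrite /push (iso_lK i)// Ok.
  by move=> M mM; rewrite (push_dist_g hE)//; exact: dk.
- move=> j k Ij Ik jk M mM; have [cj _ _] := e1 _ Ij; have [ck _ _] := e1 _ Ik.
  by rewrite /push (iso_lK i)// (iso_lip i) ?e2//; exact: ec.
- move=> u du Ou hu; have cu := hr _ du; have cOu := ec _ _ mOm cu.
  rewrite -(iso_rK i du) (e3 (h u)) ?(iso_0 i Ks)//.
    by rewrite -{2}Ou /push (iso_lK i).
  move=> k M Ik mM; have [ck _ _] := e1 _ Ik; have cM := ec _ _ mM ck.
  by rewrite -(iso_lip i) ?(iso_rK i)//; have := hu k M Ik mM; rewrite /push (iso_lK i).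
Qed.
End SpectralOneWay.

Lemma same_invariants K L g h B C : iso K L g h -> intertwine K L g B C ->
  is_subspace (carrier K) -> is_subspace (carrier L) ->
  linear_operator K K B -> linear_operator L L C -> same_listed_invariants K B L C.
Proof.
move=> i t Ks Ls Bl Cl; have i' := iso_sym i; have t' := intertwine_sym i t.
split; split.
- exact: (spectrum_eq i t).
- exact: (essential_spectrum_eq i t).
- exact: (point_spectrum_eq i t).
- exact: (discrete_spectrum_eq i t).
- apply: (spectrum_in_eq i t) => [u []//|u []//|u|u].
    exact: (ac_subspace_fwd i t).
  exact: (ac_subspace_fwd i' t').
- apply: (spectrum_in_eq i t) => [u []//|u []//|u|u].
    exact: (sc_subspace_fwd i t).
  exact: (sc_subspace_fwd i' t').
- exact: (resolvent_set_eq i t).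
- move=> n Om mu; split; first exact: (uniform_multiplicity_fwd i t).
  exact: (uniform_multiplicity_fwd i' t').
Qed.
End Transport.

(** * Left-definite spaces *)

Section LeftDefinite.
Variables (R : realType) (V : lmodType R[i]) (K : hilb V) (A : operator V).
Implicit Types (u v w : V) (p q r s : R).
Local Notation car := (carrier K).
Hypothesis Asa : selfadjoint K A.
Variable P : R -> operator V.
Hypothesis hP : powers K A P.
Notation pdom r := (dom (P r)).
Notation pap r := (app (P r)).

(** The left-definite spaces formed with an arbitrary family of powers; for the
    family [power] they are the spaces of the theorem, by definition. *)
Definition ld_dom r : set V := dom (P (r / 2)).
Definition ld r : hspace V :=
  Hspace (ld_dom r) (fun f g => ip K (app (P (r / 2)) f) (app (P (r / 2)) g)).
Notation LD r := (ld r).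

Definition ld_op r : operator V := restr A (ld_dom (r + 2)).

Lemma half_add2 r : (r + 2) / 2 = 1 + r / 2.
Proof. by field. Qed.

Lemma ld_domE r : ld_dom (r + 2) = pdom (1 + r / 2).
Proof. by rewrite /ld_dom half_add2. Qed.

Lemma ld_dom_mono r s : r <= s -> ld_dom s `<=` ld_dom r.
Proof.
by move=> rs; apply: (pdom_mono hP); rewrite ler_pM2r// invr_gt0.
Qed.

Lemma A_graph u v : A (u, v) <-> pdom 1 u /\ v = pap 1 u.
Proof. by rewrite -[X in X (_, _)](power1 hP); exact: (power_graph hP). Qed.

Lemma ld_opP r u v : 0 <= r -> ld_op r (u, v) <-> pdom (1 + r / 2) u /\ v = pap 1 u.
Proof.
move=> r0; have r2 : 1 <= 1 + r / 2 by rewrite lerDl divr_ge0.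
have e := A_graph u v; rewrite /ld_op ld_domE; split.
  by move=> [/= h uv]; split=> //; have [_ ->] := e.1 uv.
move=> [h vE]; split=> //=; apply/e; split=> //.
exact: (pdom_mono hP r2).
Qed.

Lemma dom_ld_op r : 0 <= r -> dom (ld_op r) = ld_dom (r + 2).
Proof.
move=> r0; rewrite ld_domE; apply/seteqP; split=> [_ [[u v] /(ld_opP _ _ r0)[h _] <-]//|u hu].
by exists (u, pap 1 u) => //; apply/ld_opP.
Qed.

Lemma ld_dom2 : ld_dom 2 = dom A.
Proof.
by rewrite (dom_A hP) /ld_dom divff// pnatr_eq0.
Qed.

Lemma dom_ld_op_mono r s : 0 <= r -> r <= s -> dom (ld_op s) `<=` dom (ld_op r).
Proof.
move=> r0 rs; rewrite !dom_ld_op//; last exact: le_trans r0 rs.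
by apply: ld_dom_mono; rewrite lerD2r.
Qed.

Lemma ld_op0 : ld_op 0 = A.
Proof.
rewrite /ld_op add0r ld_dom2; apply/seteqP; split=> [[u v] []//|[u v] uv].
by split=> //; exists (u, v).
Qed.

Lemma pap_inv a u : 0 <= a -> car u ->
  pdom a (pap (- a) u) /\ pap a (pap (- a) u) = u.
Proof.
move=> a0 hu; have h : pdom (- a) u by rewrite (pdom_le0 hP)// oppr_le0.
by have := papK hP h; rewrite opprK.
Qed.

Lemma ld_iso r : 0 <= r -> iso (LD r) K (pap (r / 2)) (pap (- (r / 2))).
Proof.
move=> r0; have a0 : 0 <= r / 2 by rewrite divr_ge0.
split=> [u hu|u hu|u hu|u hu|c u v hu hv|c u v hu hv|u v hu hv|u v hu hv] //.
- exact: (pap_car hP hu).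
- exact: (pap_inv a0 hu).1.
- exact: (papK hP hu).2.
- exact: (pap_inv a0 hu).2.
- exact: (pap_lin hP c hu hv).
- by apply: (pap_lin hP); rewrite (pdom_le0 hP)// oppr_le0.
- rewrite /= (pap_inv a0 hu).2 (pap_inv a0 hv).2. by [].
Qed.

Lemma ld_subspace r : is_subspace (carrier (LD r)).
Proof. exact: (pdom_subspace hP). Qed.

Lemma K_subspace : is_subspace car.
Proof. by have [] := hilbP K. Qed.

(** A^(r/2) commutes with A: for u in V_(r+2) both orders give A^(1+r/2) u, and
    conversely A A^(r/2) u = A^(r/2) v determines v = A u since A^(r/2) is
    injective. *)
Lemma ld_tw r : 0 <= r -> intertwine (LD r) K (pap (r / 2)) (ld_op r) A.
Proof.
move=> r0; have a0 : 0 <= r / 2 by rewrite divr_ge0.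
have r2 : r / 2 <= 1 + r / 2 by rewrite lerDr.
split=> [[u v] /(ld_opP _ _ r0)[h ->]|[u v] /(sa_car Asa)//|u v hu hv].
  split=> /=; first exact: (pdom_mono hP r2).
  have h1 : pdom 1 u by apply: (pdom_mono hP) h; rewrite lerDl.
  by apply/(pdom_comp hP _ h1); rewrite addrC.
have e1 w := A_graph (pap (r / 2) u) w.
split=> [/(ld_opP _ _ r0)[h ->]|/e1[h1 h2]].
  have h1 : pdom 1 u by apply: (pdom_mono hP) h; rewrite lerDl.
  apply/e1; split; first exact/(pdom_comp hP _ hu).
  have h' : pdom (r / 2 + 1) u by rewrite addrC.
  apply: (etrans (pap_comp hP h1 h')).
  by apply: (etrans _ (esym (pap_comp hP hu h))); rewrite addrC.
have h : pdom (1 + r / 2) u by apply/(pdom_comp hP _ hu).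
apply/ld_opP => //; split=> //.
have h3 : pdom 1 u by apply: (pdom_mono hP) h; rewrite lerDl.
have h' : pdom (r / 2 + 1) u by rewrite addrC.
have h4 : pdom (r / 2) (pap 1 u) by apply/(pdom_comp hP _ h3).
have k1 := (papK hP h4).2; have k2 := (papK hP hv).2.
rewrite -k1 -k2; congr (pap (- (r / 2)) _).
have e2 := pap_comp hP h3 h'; have e3 := pap_comp hP hu h.
rewrite (addrC (r / 2)) in e2.
by apply: (etrans h2); apply: (etrans e3); exact: esym.
Qed.

Lemma ld_hilbert r : 0 <= r -> hilbert (LD r).
Proof.
by move=> r0; apply: (iso_hilbert (iso_sym (ld_iso r0)) K_subspace (ld_subspace r) (hilbP K)).
Qed.

Lemma ld_separable r : 0 <= r -> hseparable K -> hseparable (LD r).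
Proof.
by move=> r0; apply: (iso_separable (iso_sym (ld_iso r0)) K_subspace).
Qed.

Lemma ld_selfadjoint r : 0 <= r -> selfadjoint (LD r) (ld_op r).
Proof.
move=> r0; have t := intertwine_sym (ld_iso r0) (ld_tw r0).
exact: (tw_selfadjoint (iso_sym (ld_iso r0)) t K_subspace).
Qed.

Lemma ld_dom_strict r s : 0 <= r -> r < s -> ~ bounded_operator K A ->
  dom (ld_op s) `<` dom (ld_op r).
Proof.
move=> r0 rs nb; have s0 : 0 <= s by exact: ltW (le_lt_trans r0 rs).
rewrite !dom_ld_op// !ld_domE.
apply: (pdom_strict hP Asa) => //; first by rewrite addr_ge0// divr_ge0.
by rewrite ltrD2l ltr_pM2r// invr_gt0.
Qed.

Lemma ld_comp r s u : 0 <= r -> 0 <= s -> carrier (LD r) u ->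
  pap (- (s / 2)) (pap (r / 2) u) = pap ((r - s) / 2) u.
Proof.
move=> r0 s0 hu.
have e : - (s / 2) + r / 2 = (r - s) / 2 by rewrite mulrBl addrC.
have h : pdom (- (s / 2) + r / 2) u.
  by apply: (pdom_mono hP) hu; rewrite gerDr oppr_le0 divr_ge0.
by rewrite -e; exact: (pap_comp hP hu h).
Qed.

(** Through H: the composite of A^(r/2) and A^(-s/2) is A^((r-s)/2). *)
Lemma ld_iso2 r s : 0 <= r -> 0 <= s ->
  iso (LD r) (LD s) (pap ((r - s) / 2)) (pap ((s - r) / 2)).
Proof.
move=> r0 s0; apply: (iso_eq (iso_comp (ld_iso r0) (iso_sym (ld_iso s0)))).
- by move=> u hu /=; exact: ld_comp.
- by move=> u hu /=; exact: ld_comp.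
- exact: ld_subspace.
- exact: ld_subspace.
Qed.

Lemma ld_tw2 r s : 0 <= r -> 0 <= s ->
  intertwine (LD r) (LD s) (pap ((r - s) / 2)) (ld_op r) (ld_op s).
Proof.
move=> r0 s0; have [t1 t2 t3] := ld_tw r0; have [t1' t2' t3'] := ld_tw s0.
split=> // u v hu hv; have i := ld_iso2 r0 s0.
have key x : carrier (LD r) x -> pap (s / 2) (pap ((r - s) / 2) x) = pap (r / 2) x.
  move=> hx; have cx := pap_car hP hx.
  have s20 : 0 <= s / 2 by rewrite divr_ge0.
  by rewrite -(ld_comp r0 s0 hx); exact: (pap_inv s20 cx).2.
have cu := iso_l i hu; have cv := iso_l i hv.
have e := t3' _ _ cu cv; rewrite (key _ hu) (key _ hv) in e.
by have e' := t3 _ _ hu hv; split=> [/e'/e|/e/e'].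
Qed.

Lemma ld_power_restr q r u v : q <= r / 2 ->
  (restr (P q) (ld_dom r)) (u, v) <->
  carrier (LD r) u /\ v = pap q u.
Proof.
move=> qr; have e := power_graph hP q u v; split.
  by move=> [/= h /e[_ ->]].
move=> [h ->]; split=> //=; have [_] := power_graph hP q u (pap q u); apply.
by split=> //; exact: (pdom_mono hP qr).
Qed.

Lemma ld_unitary r s t : 0 <= r -> 0 <= s -> 0 <= t ->
  unitary (LD (r + t)) (LD (s + t))
    (restr (P ((r - s) / 2)) (ld_dom (r + t))).
Proof.
move=> r0 s0 t0; have rt0 : 0 <= r + t by rewrite addr_ge0.
have st0 : 0 <= s + t by rewrite addr_ge0.
have e : (r - s) / 2 = (r + t - (s + t)) / 2 by rewrite opprD addrACA subrr addr0.
have := iso_unitary (ld_iso2 rt0 st0) (ld_subspace _) (ld_hilbert rt0).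
rewrite -e; congr unitary; apply/seteqP; split=> [[u v]|[u v]].
  move=> h; apply/ld_power_restr => //.
  by rewrite ler_pM2r ?invr_gt0//; lra.
by move=> /ld_power_restr; apply; rewrite ler_pM2r ?invr_gt0//; lra.
Qed.

(** The product on the left is taken on its natural domain: w has to lie in the
    domain of A^(-q), and A^(-q) w in V_(r+2); by the group law this happens
    exactly for w in V_(s+2). *)
Lemma ld_conjugate r s : 0 <= r -> 0 <= s ->
  (P ((r - s) / 2) \; ld_op r \; P (- (r - s) / 2))%relation = ld_op s.
Proof.
move=> r0 s0; rewrite mulNr; set q := (r - s) / 2.
have qE : 1 + r / 2 - q = 1 + s / 2 by rewrite /q; field.
have sE : - q + q = 0 by rewrite addNr.
have hq : - q <= 1 + s / 2 by rewrite /q; lra.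
have hq1 : 1 - q <= 1 + s / 2 by rewrite /q; lra.
have key w : pdom (1 + s / 2) w -> [/\ pdom (- q) w, pdom (1 + r / 2) (pap (- q) w),
    pdom q (pap 1 (pap (- q) w)) & pap q (pap 1 (pap (- q) w)) = pap 1 w].
  move=> hw; have h1 : pdom (- q) w by exact: (pdom_mono hP hq).
  have h2 : pdom (1 + r / 2) (pap (- q) w).
    by apply/(pdom_comp hP _ h1); rewrite qE.
  have h3 : pdom (1 - q) w by exact: (pdom_mono hP hq1).
  have h4 : pdom 1 w by apply: (pdom_mono hP) hw; rewrite lerDl divr_ge0.
  have e1 := pap_comp hP h1 h3.
  have h5 : pdom (q + (1 - q)) w by rewrite addrC subrK.
  have e2 := pap_comp hP h3 h5; rewrite -e1 addrC subrK in e2.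
  by split=> //; rewrite e1; apply/(pdom_comp hP _ h3).
apply/seteqP; split=> [[w w'] /=|[w w'] /(ld_opP _ _ s0)[hw ->]].
  move=> [u' [u hwu /(ld_opP _ _ r0)[hu u'E]] hu'w].
  have [h1 uE] := (power_graph hP _ _ _).1 hwu.
  have [h2 w'E] := (power_graph hP _ _ _).1 hu'w.
  rewrite uE in hu; have hw : pdom (1 + s / 2) w.
    by rewrite -qE; apply/(pdom_comp hP _ h1).
  apply/ld_opP => //; split=> //.
  by have [_ _ _ <-] := key w hw; rewrite w'E u'E uE.
have [h1 h2 h3 h4] := key w hw.
exists (pap 1 (pap (- q) w)); last by apply/(power_graph hP).
exists (pap (- q) w); first by apply/(power_graph hP).
by apply/ld_opP.
Qed.

Lemma ld_img r s : 0 <= r -> 0 <= s ->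
  dom (ld_op s) = img (P ((r - s) / 2)) (dom (ld_op r)).
Proof.
move=> r0 s0; rewrite !dom_ld_op// !ld_domE; set q := (r - s) / 2.
have qE : 1 + r / 2 - q = 1 + s / 2 by rewrite /q; field.
have qE' : 1 + s / 2 + q = 1 + r / 2 by rewrite /q; field.
have hq : - q <= 1 + s / 2 by rewrite /q; lra.
apply/seteqP; split=> [w hw|w [u hu /(power_graph hP)[h1 ->]]].
  have h1 : pdom (- q) w by exact: (pdom_mono hP hq).
  exists (pap (- q) w); first by apply/(pdom_comp hP _ h1); rewrite qE.
  apply/(power_graph hP).
  by have := papK hP h1; rewrite opprK => -[h2 ->].
by apply/(pdom_comp hP _ h1); rewrite qE'.
Qed.

Lemma ld_bounded_dom r : bounded_operator K A -> ld_dom r = car.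
Proof. by move=> bA; exact: (bounded_pdom hP Asa bA). Qed.

Lemma ld_bounded_op r : 0 <= r -> bounded_operator K A -> ld_op r = A.
Proof.
move=> r0 bA; rewrite /ld_op ld_bounded_dom//.
by apply/seteqP; split=> [[u v] []//|[u v] uv]; split=> //; have [] := sa_car Asa uv.
Qed.

Lemma ld_hnorm r u : hnorm (LD r) u = hnorm K (pap (r / 2) u).
Proof. by []. Qed.

Lemma ld_norm_le r s : bounded_operator K A ->
  exists2 C, 0 < C & forall u, car u -> hnorm (LD s) u <= C * hnorm (LD r) u.
Proof.
move=> bA; have dd := bounded_pdom hP Asa bA.
have [C C0 hC] := bounded_pap hP Asa bA ((s - r) / 2); exists C => // u hu.
have h1 : pdom (r / 2) u by rewrite dd.
have e : (s - r) / 2 + r / 2 = s / 2 by field.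
have h2 : pdom ((s - r) / 2 + r / 2) u by rewrite dd.
have e2 := pap_comp hP h1 h2; rewrite e in e2.
rewrite (ld_hnorm s) (ld_hnorm r) -e2; apply: hC; exact: (pap_car hP h1).
Qed.

Lemma ld_equivalent r s : bounded_operator K A -> equivalent_norms (LD r) (LD s).
Proof.
move=> bA; split; first by rewrite /= !ld_bounded_dom.
have [C C0 hC] := ld_norm_le r s bA; have [D D0 hD] := ld_norm_le s r bA.
exists D^-1, C; split=> //; first by rewrite invr_gt0.
move=> u /=; rewrite ld_bounded_dom// => hu; split; last exact: hC.
by rewrite ler_pdivrMl// hD.
Qed.

Lemma ld_hnorm0 u : car u -> hnorm (LD 0) u = hnorm K u.
Proof. by move=> hu; rewrite ld_hnorm mul0r (pap0 hP). Qed.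

Lemma ld_equivalentK r : bounded_operator K A -> equivalent_norms (LD r) K.
Proof.
move=> bA; have [rE [c [d [c0 d0 h]]]] := ld_equivalent r 0 bA.
rewrite /= !ld_bounded_dom// in rE h; split; first by rewrite /= ld_bounded_dom.
exists c, d; split=> // u /=; rewrite ld_bounded_dom// => hu.
by have := h u hu; rewrite ld_hnorm0.
Qed.

Lemma ld_equiv_unitary r s : 0 <= r -> 0 <= s ->
  unitarily_equivalent (LD r) (ld_op r) (LD s) (ld_op s).
Proof.
move=> r0 s0.
exact: (tw_unitarily_equivalent (ld_iso2 r0 s0) (ld_tw2 r0 s0) (ld_subspace r)
  (ld_hilbert r0)).
Qed.

Lemma ld_equiv_unitaryK r : 0 <= r -> unitarily_equivalent (LD r) (ld_op r) K A.
Proof.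
move=> r0.
exact: (tw_unitarily_equivalent (ld_iso r0) (ld_tw r0) (ld_subspace r)
  (ld_hilbert r0)).
Qed.

Lemma ld_same_invariants r s : 0 <= r -> 0 <= s ->
  same_listed_invariants (LD r) (ld_op r) (LD s) (ld_op s).
Proof.
move=> r0 s0; have [l1 _ _] := ld_selfadjoint r0; have [l2 _ _] := ld_selfadjoint s0.
exact: (same_invariants (ld_iso2 r0 s0) (ld_tw2 r0 s0) (ld_subspace r) (ld_subspace s)).
Qed.

Lemma ld_same_invariantsK r : 0 <= r -> same_listed_invariants (LD r) (ld_op r) K A.
Proof.
move=> r0; have [l1 _ _] := ld_selfadjoint r0; have [l2 _ _] := Asa.
exact: (same_invariants (ld_iso r0) (ld_tw r0) (ld_subspace r) K_subspace).
Qed.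
End LeftDefinite.

(** * The theorem *)

Local Close Scope complex_scope.

Theorem theorem2p4 (R : realType) (V : lmodType R[i]) (H : hspace V)
    (A : operator V)
    (H_hilbert : hilbert H) (H_separable : hseparable H)
    (A_selfadjoint : selfadjoint H A) (A_ge1 : ge_identity H A) :
  exists Ar : R -> operator V,
  [/\ (* (i) *)
      (forall r : R, 0 <= r ->
         hilbert (left_definite H A r) /\ hseparable (left_definite H A r)) /\
      [/\ forall r : R, 0 <= r -> unique (is_left_definite_operator H A r) (Ar r),
          left_definite_dom H A 2 = dom A,
          forall r : R, 0 <= r -> dom (Ar r) `<=` dom A,
          forall r s : R, 0 <= r -> r < s -> dom (Ar s) `<=` dom (Ar r)
        & ~ bounded_operator H A ->
          (forall r : R, 0 < r -> dom (Ar r) `<` dom A) /\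
          (forall r s : R, 0 <= r -> r < s -> dom (Ar s) `<` dom (Ar r))],
      (* (ii) *)
      bounded_operator H A ->
        (forall r s : R, 0 <= r -> 0 <= s ->
           equivalent_norms (left_definite H A r) (left_definite H A s)) /\
        (forall r : R, 0 <= r ->
           [/\ equivalent_norms (left_definite H A r) H,
               left_definite_dom H A r = carrier H
             & Ar r = A])
    & (* (iii) *)
      [/\ forall r s t : R, 0 <= r -> 0 <= s -> 0 <= t ->
            unitary (left_definite H A (r + t)) (left_definite H A (s + t))
              (restr (power H A ((r - s) / 2)) (left_definite_dom H A (r + t))),
          forall r s : R, 0 <= r -> 0 <= s ->
            (power H A ((r - s) / 2) \; Ar r \; power H A (- (r - s) / 2))%relation
              = Ar s,
          forall r s : R, 0 <= r -> 0 <= s ->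
            [/\ left_definite_dom H A (s + 2) = dom (Ar s),
                dom (Ar s) = img (power H A ((r - s) / 2)) (dom (Ar r))
              & img (power H A ((r - s) / 2)) (dom (Ar r)) =
                img (power H A ((r - s) / 2)) (left_definite_dom H A (r + 2))],
          (forall r s : R, 0 <= r -> 0 <= s ->
             unitarily_equivalent (left_definite H A r) (Ar r)
                                  (left_definite H A s) (Ar s)) /\
          (forall r : R, 0 <= r ->
             unitarily_equivalent (left_definite H A r) (Ar r) H A)
        & ((forall (X : Type) (inv : hspace V -> operator V -> X),
              unitary_invariant inv ->
              (forall r s : R, 0 <= r -> 0 <= s ->
                 inv (left_definite H A r) (Ar r) =
                 inv (left_definite H A s) (Ar s)) /\
              (forall r : R, 0 <= r ->
                 inv (left_definite H A r) (Ar r) = inv H A)) /\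
           (forall r s : R, 0 <= r -> 0 <= s ->
              same_listed_invariants (left_definite H A r) (Ar r)
                                     (left_definite H A s) (Ar s)) /\
           (forall r : R, 0 <= r ->
              same_listed_invariants (left_definite H A r) (Ar r) H A))]].
Proof.
pose K := Hilb H_hilbert; pose P := power H A.
have hP : powers K A P := @power_powers _ _ K A A_selfadjoint A_ge1.
have Asa : selfadjoint K A := A_selfadjoint.

exists (ld_op A P); split.
- split=> [r r0|]; first by split; [exact: (ld_hilbert hP r0)|exact: (ld_separable hP r0)].
  split=> [r r0|||r s r0 rs|nb].
  + split=> [|T []//]; have sa := ld_selfadjoint Asa hP r0; split=> //.
    * by case: sa.
    * exact: (dom_ld_op hP r0).
    * by move=> ->; exact: (ld_op0 hP).
  + exact: (ld_dom2 hP).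
  + by move=> r r0; have := dom_ld_op_mono hP (lexx 0) r0; rewrite (ld_op0 hP).
  + exact: (dom_ld_op_mono hP r0 (ltW rs)).
  + split=> [r r0|r s r0 rs]; last exact: (ld_dom_strict Asa hP r0 rs nb).
    by have := ld_dom_strict Asa hP (lexx 0) r0 nb; rewrite (ld_op0 hP).
- move=> bA; split=> [r s _ _|r r0]; first exact: (ld_equivalent Asa hP r s bA).
  split; first exact: (ld_equivalentK Asa hP r bA).
    exact: (ld_bounded_dom Asa hP r bA).
  exact: (ld_bounded_op Asa hP r0 bA).
split=> [r s t r0 s0 t0|r s r0 s0|r s r0 s0||].
- exact: (ld_unitary hP r0 s0 t0).
- exact: (ld_conjugate hP r0 s0).
- split; first exact: esym (dom_ld_op hP s0).
    exact: (ld_img hP r0 s0).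
  by rewrite (dom_ld_op hP r0).
- split=> [r s r0 s0|r r0]; first exact: (ld_equiv_unitary Asa hP r0 s0).
  exact: (ld_equiv_unitaryK Asa hP r0).
split=> [X inv hinv|].
  have hs r (r0 : 0 <= r) : hseparable (left_definite H A r) := ld_separable hP r0 H_separable.
  split=> [r s r0 s0|r r0]; apply: hinv => //.
  + exact: (ld_hilbert hP r0).
  + exact: hs.
  + exact: (ld_selfadjoint Asa hP r0).
  + exact: (ld_hilbert hP s0).
  + exact: hs.
  + exact: (ld_selfadjoint Asa hP s0).
  + exact: (ld_equiv_unitary Asa hP r0 s0).
  + exact: (ld_hilbert hP r0).
  + exact: hs.
  + exact: (ld_selfadjoint Asa hP r0).
  + exact: (ld_equiv_unitaryK Asa hP r0).
split=> [r s r0 s0|r r0]; first exact: (ld_same_invariants Asa hP r0 s0).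
exact: (ld_same_invariantsK Asa hP r0).
Qed.
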